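(* Let $p<q$ be coprime positive integers and let $f:(\mathbb{C}^2,0)\to(\mathbb{C},0)$ be a nondegenerate isolated singularity of the form $$f=\sum_{p\alpha+q\beta\ \ge\ pq} c_{\alpha\beta}\,x^{\alpha}y^{\beta}.$$ Let $r$ be the remainder of the division of $q$ by $p$. Then the sequence of jumps of Milnor numbers of $f$ begins with $$\underbrace{1,\ \dots,\ 1}_{r(p-r)},$$ that is, its first $r(p-r)$ terms are all equal to $1$.
   Context: An isolated (plane curve) singularity is an analytic germ $f:(\mathbb{C}^2,0)\to(\mathbb{C},0)$ such that $0$ is the only solution of the system of equations $\nabla f(x,y)=f(x,y)=0$. Its Milnor number $\mu(f)$ is the multiplicity of $\nabla f$ at $0$. A deformation of $f$ is an analytic function germ $F:(\mathbb{C}^3,0)\to\mathbb{C}$, $F=F(t,x,y)$, such that $F(0,\cdot)=f$ and $F(t,\cdot)$ is an isolated singularity for every sufficiently small $t$. The Milnor number of the deformation is the value of $\mu(F(t,\cdot))$ for sufficiently small $t\neq 0$; it is always at most $\mu(f)$. Let $(\mu_i)_{i=0,\dots,w}$ be the strictly decreasing sequence of all positive integers attained as Milnor numbers of deformations of $f$; thus $\mu_0=\mu(f)$ and $\mu_w=1$. The sequence of jumps of Milnor numbers of $f$ (Milnor jumps) is the sequence of positive integers $(\mu_{i-1}-\mu_i)_{i=1,\dots,w}$. Nondegenerate means nondegenerate in the sense of Kouchnirenko: writing $f=\sum c_{ij}x^iy^j$, for every compact edge $\gamma$ of the boundary of the convex hull of $\bigcup_{c_{ij}\ne 0}\left((i,j)+[0,\infty)^2\right)$,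 the polynomial $f_\gamma=\sum_{(i,j)\in\gamma}c_{ij}x^iy^j$ is such that $\partial f_\gamma/\partial x$ and $\partial f_\gamma/\partial y$ have no common zero in $(\mathbb{C}\setminus\{0\})^2$.
   Formalization: The formal theorem also assumes that the coefficients of x^q and y^p in f are nonzero, so that the line pα+qβ=pq carries the Newton diagram; without this the claim fails, e.g. p=2, q=3, f=x^4+y^4 has first jump 2. *)

(* Defs.v *)
From HB Require Import structures.
From mathcomp Require Import all_boot all_order all_algebra.
From mathcomp Require Import complex.
From mathcomp Require Import all_classical all_reals all_analysis.

Set Implicit Arguments.
Unset Strict Implicit.
Unset Printing Implicit Defensive.

Import Order.TTheory GRing.Theory Num.Theory.
Import numFieldNormedType.Exports.

Local Open Scope classical_set_scope.
Local Open Scope ring_scope.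

(* As a numClosedFieldType, R[i] gets the topology of its norm. *)
Definition C (R : realType) : numClosedFieldType := R[i].

Section Germs.
Variable R : realType.

(* Analytic germs at the origin are represented by their Taylor coefficients:
   [f i j] is the coefficient of x^i y^j, and [F k i j] that of t^k x^i y^j.
   The germs are the families satisfying [convergent2], resp. [convergent3]. *)
Definition series2 := nat -> nat -> C R.
Definition series3 := nat -> nat -> nat -> C R.

(* Absolute convergence on some closed polydisc of positive radius r: in the
   order of C, 0 < r means that r is a positive real. *)
Definition convergent2 (f : series2) : Prop :=
  exists2 r : C R, 0 < r & exists M : C R, forall n : nat,
    \sum_(i < n) \sum_(j < n) `|f i j| * r ^+ (i + j) <= M.

Definition convergent3 (F : series3) : Prop :=
  exists2 r : C R, 0 < r & exists M : C R, forall n : nat,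
    \sum_(k < n) \sum_(i < n) \sum_(j < n) `|F k i j| * r ^+ (k + i + j) <= M.

(* [limn] is total, so this is the value of the germ only where the series
   converges. *)
Definition eval2 (f : series2) (z : C R * C R) : C R :=
  limn (fun n : nat => \sum_(i < n) \sum_(j < n) f i j * z.1 ^+ i * z.2 ^+ j).

Definition dx (f : series2) : series2 := fun i j => f i.+1 j *+ i.+1.
Definition dy (f : series2) : series2 := fun i j => f i j.+1 *+ j.+1.

Definition isolated_singularity (f : series2) : Prop :=
  convergent2 f /\
  \forall z \near ((0, 0) : C R * C R),
    [/\ eval2 (dx f) z = 0, eval2 (dy f) z = 0 & eval2 f z = 0] <-> z = (0, 0).

Definition mul2 (f g : series2) : series2 := fun i j =>
  \sum_(k < i.+1) \sum_(l < j.+1) f k l * g (i - k)%N (j - l)%N.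

(* [multiplicity g h n]: the C-vector space C{x,y} / (g, h) has dimension n,
   i.e. it has a basis consisting of the classes of n germs e_0, ..., e_(n-1).
   No n satisfies this when that dimension is infinite. *)
Definition multiplicity (g h : series2) (n : nat) : Prop :=
  exists e : 'I_n -> series2,
    [/\ forall k, convergent2 (e k),
        forall u : series2, convergent2 u ->
          exists (a : 'I_n -> C R) (A B : series2),
            [/\ convergent2 A, convergent2 B &
                forall i j, u i j =
                  \sum_(k < n) a k * e k i j + mul2 A g i j + mul2 B h i j]
      & forall (a : 'I_n -> C R) (A B : series2),
          convergent2 A -> convergent2 B ->
          (forall i j, \sum_(k < n) a k * e k i j =
                       mul2 A g i j + mul2 B h i j) ->
          forall k, a k = 0].

Definition milnor_number (f : series2) (n : nat) : Prop :=
  multiplicity (dx f) (dy f) n.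

(* Taylor coefficients at the origin of the germ F(t, -). *)
Definition slice (F : series3) (t : C R) : series2 := fun i j =>
  limn (fun n : nat => \sum_(k < n) F k i j * t ^+ k).

Definition deformation (f : series2) (F : series3) : Prop :=
  [/\ convergent3 F,
      forall i j, slice F 0 i j = f i j
    & \forall t \near (0 : C R), isolated_singularity (slice F t)].

Definition deformation_milnor_number (F : series3) (n : nat) : Prop :=
  \forall t \near (0 : C R)^', milnor_number (slice F t) n.

Definition milnor_sequence (f : series2) (mu : seq nat) : Prop :=
  sorted gtn mu /\
  forall n : nat, n \in mu <->
    (0 < n)%N /\
    exists2 F : series3, deformation f F & deformation_milnor_number F n.

(* Truncated subtraction is harmless: [mu] is to be decreasing. *)
Definition jumps (mu : seq nat) : seq nat :=
  if mu is m :: mu' then pairmap subn m mu' else [::].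

Definition newton_polyhedron (f : series2) : set (R * R) :=
  smallest (fun A : set (R * R) => convex_set A)
    [set z | exists i j : nat,
       [/\ f i j != 0, i%:R <= z.1 & j%:R <= z.2]].

(* An edge is the intersection with a supporting line, when this is not
   reduced to a point. *)
Definition compact_edge (N gamma : set (R * R)) : Prop :=
  [/\ exists a b m : R,
        [/\ (a, b) <> (0, 0),
            forall z, N z -> m <= a * z.1 + b * z.2
          & gamma = N `&` [set z | a * z.1 + b * z.2 = m]],
      exists z w, [/\ gamma z, gamma w & z <> w]
    & compact gamma].

Definition edge_part (f : series2) (gamma : set (R * R)) : series2 :=
  fun i j => if (i%:R, j%:R) \in gamma then f i j else 0.

Definition newton_nondegenerate (f : series2) : Prop :=
  forall gamma : set (R * R), compact_edge (newton_polyhedron f) gamma ->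
  forall x y : C R, x != 0 -> y != 0 ->
  ~ (eval2 (dx (edge_part f gamma)) (x, y) = 0 /\
     eval2 (dy (edge_part f gamma)) (x, y) = 0).

End Germs.

(* Main.v *)
(* Put mu0 = (p - 1)(q - 1).

   No deformation has a Milnor number above mu0: give x and y the weights rho^p
   and rho^q in an l1 norm. For small rho, the partial derivatives of every germ
   close to f are x^(q-1) and y^(p-1) up to a factor and a small relative error,
   so that division by these two monomials, with remainder supported on
   {i < q - 1, j < p - 1}, halves the norm modulo the Jacobian ideal. A linear
   form on the finite-dimensional Jacobian algebra that kills the mu0 monomials
   of that box therefore vanishes.

   Every mu0 - k with 0 <= k <= r(p - r) is attained: a variant of Euclid's
   algorithm yields a convex lattice path with total step (p - r, r) that
   encloses with its chord a region of double area k. With q = m p + r, the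
   unimodular map (a, b) |-> (m a + (m + 1) b, a + b) turns it into a convex path
   from (0, p) to (q, 0) below the segment p i + q j = p q. Adding t times the
   monomials at its inner vertices to f gives, for t <> 0, a germ having no other
   monomials than the vertices on its Newton polygon. Its Milnor number is given
   by Kouchnirenko's formula, which is proved by filtering the Koszul complex of
   the partial derivatives by the Newton function: the filtered complex is exact,
   which reduces the codimension of the ideal to a count of lattice points, and
   Nakayama's lemma passes from formal truncations to convergent germs. *)
Require Import Defs.
From HB Require Import structures.
From mathcomp Require Import all_boot all_order all_algebra.
From mathcomp Require Import zify ring lra complex.
From mathcomp Require Import all_classical all_reals all_analysis.

Set Implicit Arguments.
Unset Strict Implicit.
Unset Printing Implicit Defensive.

Import Order.TTheory GRing.Theory Num.Theory.
Import numFieldNormedType.Exports.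

Local Open Scope ring_scope.

(** * Formal power series in two variables *)

(** For a polygon from (0, p) to (q, 0), Kouchnirenko's number is V - p - q + 1, where V is twice
    the area under it. The chord has V = p q, which gives mu0, and a path that encloses double area
    k with the chord gives exactly mu0 - k; this is why areas of lattice paths govern the jumps. The
    bound r(p - r) is the double area of the triangle between the segment from (0, 0) to (p - r, r)
    and the path with steps (p - r, 0) and (0, r), the most that a convex path with non-negative
    steps can enclose.

    Only the vertices of the path are added to f, never other lattice points of its edges, so that
    the initial form along each edge is a binomial. Nondegeneracy then amounts to the determinant of
    two consecutive vertices being nonzero, and the exactness of the Koszul complex can be checked
    coefficient by coefficient.

    As the multiplicity is defined by a basis of the local algebra, the upper bound works on its
    dimension directly, by the contracting division, instead of counting the zeros of a nearby
    gradient. *)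

Definition fps2 (K : comNzRingType) : Type := nat -> nat -> K.

Lemma sum_ord_only (V : nmodType) n m (F : nat -> V) :
  (forall k, (k < n)%N -> k != m -> F k = 0) ->
  \sum_(k < n) F k = if (m < n)%N then F m else 0.
Proof.
move=> F0; case: ifP => mn.
  rewrite (bigD1 (Ordinal mn)) //= big1 ?addr0 // => k km.
  by apply: F0 => //; rewrite -val_eqE in km.
apply: big1 => k _; apply: F0 => //; apply/eqP => km.
by move: (ltn_ord k); rewrite km mn.
Qed.

Section FormalSeries.
Variable K : comNzRingType.
Implicit Types f g h : fps2 K.

Lemma fps2P f g : (forall i j, f i j = g i j) -> f = g.
Proof. by move=> fg; apply/funext => i; apply/funext => j; apply: fg. Qed.

Definition fps2_add f g : fps2 K := fun i j => f i j + g i j.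
Definition fps2_opp f : fps2 K := fun i j => - f i j.
Definition fps2_mon (m n : nat) : fps2 K := fun i j => ((i == m) && (j == n))%:R.
Definition fps2_mul f g : fps2 K := fun i j =>
  \sum_(k < i.+1) \sum_(l < j.+1) f k l * g (i - k)%N (j - l)%N.

(* The ring axioms for the Cauchy product are inherited from {poly {poly K}}:
   each coefficient of a product only depends on truncations. *)
Let cf (P : {poly {poly K}}) : fps2 K := fun i j => P`_i`_j.
Let trunc n f : {poly {poly K}} := \poly_(i < n) \poly_(j < n) f i j.

Let cfM P Q : cf (P * Q) = fps2_mul (cf P) (cf Q).
Proof.
apply: fps2P => i j; rewrite /cf coefM coef_sum.
by apply: eq_bigr => k _; rewrite coefM.
Qed.

Let cf_trunc n f i j : (i < n)%N -> (j < n)%N -> cf (trunc n f) i j = f i j.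
Proof. by move=> lin ljn; rewrite /cf coef_poly lin coef_poly ljn. Qed.

Let eq_mul f f' g g' i j :
  (forall k l, (k <= i)%N -> (l <= j)%N -> f k l = f' k l) ->
  (forall k l, (k <= i)%N -> (l <= j)%N -> g k l = g' k l) ->
  fps2_mul f g i j = fps2_mul f' g' i j.
Proof.
move=> ff gg; apply: eq_bigr => -[k ki] _; apply: eq_bigr => -[l lj] _ /=.
by rewrite ff // gg ?leq_subr.
Qed.

Let mul_trunc n f g i j : (i < n)%N -> (j < n)%N ->
  fps2_mul f g i j = cf (trunc n f * trunc n g) i j.
Proof.
move=> lin ljn; rewrite cfM; apply: eq_mul => k l ki lj;
  by rewrite cf_trunc // ?(leq_ltn_trans ki) ?(leq_ltn_trans lj).
Qed.

Let addA : associative fps2_add.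
Proof. by move=> f g h; apply: fps2P => i j; apply: addrA. Qed.
Let addC : commutative fps2_add.
Proof. by move=> f g; apply: fps2P => i j; apply: addrC. Qed.
Let add0 : left_id (fun _ _ => 0 : K) fps2_add.
Proof. by move=> f; apply: fps2P => i j; apply: add0r. Qed.
Let addN : left_inverse (fun _ _ => 0 : K) fps2_opp fps2_add.
Proof. by move=> f; apply: fps2P => i j; apply: addNr. Qed.

Let mulC : commutative fps2_mul.
Proof.
move=> f g; apply: fps2P => i j.
by rewrite !(@mul_trunc (maxn i j).+1) ?ltnS ?leq_maxl ?leq_maxr // mulrC.
Qed.

Let mulA : associative fps2_mul.
Proof.
move=> f g h; apply: fps2P => i j; set n := (maxn i j).+1.
have [lin ljn] : (i < n)%N /\ (j < n)%N by rewrite !ltnS leq_maxl leq_maxr.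
have -> : fps2_mul f (fps2_mul g h) i j =
    cf (trunc n f * (trunc n g * trunc n h)) i j.
  rewrite cfM; apply: eq_mul => k l ki lj.
    by rewrite cf_trunc // ?(leq_ltn_trans ki) ?(leq_ltn_trans lj).
  by rewrite (@mul_trunc n) // ?(leq_ltn_trans ki) ?(leq_ltn_trans lj).
rewrite mulrA cfM; apply: eq_mul => k l ki lj.
  by rewrite (@mul_trunc n) // ?(leq_ltn_trans ki) ?(leq_ltn_trans lj).
by rewrite cf_trunc // ?(leq_ltn_trans ki) ?(leq_ltn_trans lj).
Qed.

Lemma fps2_mul_mon m n f i j : fps2_mul (fps2_mon m n) f i j =
  if (m <= i)%N && (n <= j)%N then f (i - m)%N (j - n)%N else 0.
Proof.
rewrite /fps2_mul (@sum_ord_only _ _ m (fun k => \sum_(l < j.+1)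
  fps2_mon m n k l * f (i - k)%N (j - l)%N)) => [|k _ km]; last first.
  by rewrite big1 // => l _; rewrite /fps2_mon (negPf km) mul0r.
rewrite ltnS; case: (m <= i)%N => //=.
rewrite (@sum_ord_only _ _ n (fun l => fps2_mon m n m l * f (i - m)%N (j - l)%N)) => [|l _ ln].
  by rewrite /fps2_mon !eqxx mul1r ltnS.
by rewrite /fps2_mon (negPf ln) andbF mul0r.
Qed.

Let mul1 : left_id (fps2_mon 0 0) fps2_mul.
Proof. by move=> f; apply: fps2P => i j; rewrite fps2_mul_mon !subn0. Qed.
Let mulDl : left_distributive fps2_mul fps2_add.
Proof.
move=> f g h; apply: fps2P => i j.
rewrite /fps2_add -big_split /=; apply: eq_bigr => k _.
by rewrite -big_split /=; apply: eq_bigr => l _; rewrite mulrDl.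
Qed.
Let one_neq0 : fps2_mon 0 0 != (fun _ _ => 0 : K) :> (nat -> nat -> K).
Proof.
apply/eqP => /(congr1 (fun f => f 0%N 0%N)); rewrite /fps2_mon !eqxx /= => /eqP.
by rewrite oner_eq0.
Qed.

HB.instance Definition _ := gen_eqMixin (fps2 K).
HB.instance Definition _ := gen_choiceMixin (fps2 K).
HB.instance Definition _ := GRing.isZmodule.Build (fps2 K) addA addC add0 addN.
HB.instance Definition _ :=
  GRing.Zmodule_isComNzRing.Build (fps2 K) mulA mulC mul1 mulDl one_neq0.

Lemma fps2DE f g i j : (f + g) i j = f i j + g i j. Proof. by []. Qed.
Lemma fps2NE f i j : (- f) i j = - f i j. Proof. by []. Qed.
Lemma fps2BE f g i j : (f - g) i j = f i j - g i j. Proof. by []. Qed.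
Lemma fps20E i j : (0 : fps2 K) i j = 0. Proof. by []. Qed.
Lemma fps2ME f g i j : (f * g) i j =
  \sum_(k < i.+1) \sum_(l < j.+1) f k l * g (i - k)%N (j - l)%N.
Proof. by []. Qed.
Lemma fps2_monE m n f i j : (fps2_mon m n * f) i j =
  if (m <= i)%N && (n <= j)%N then f (i - m)%N (j - n)%N else 0.
Proof. exact: fps2_mul_mon. Qed.
Lemma fps2_sumE (I : Type) (r : seq I) (P : pred I) (F : I -> fps2 K) i j :
  (\sum_(k <- r | P k) F k) i j = \sum_(k <- r | P k) F k i j.
Proof.
elim: r => [|k r IH]; first by rewrite !big_nil.
by rewrite !big_cons; case: ifP => _ //; rewrite fps2DE IH.
Qed.

Definition fps2_scale (c : K) f : fps2 K := fun i j => c * f i j.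

Lemma fps2_scaleE c f i j : fps2_scale c f i j = c * f i j. Proof. by []. Qed.
Lemma fps2_scaleM c f g : fps2_scale c f * g = fps2_scale c (f * g).
Proof.
apply: fps2P => i j; rewrite fps2_scaleE !fps2ME mulr_sumr; apply: eq_bigr => k _.
by rewrite mulr_sumr; apply: eq_bigr => l _; rewrite mulrA.
Qed.

Lemma fps2_monM m n m' n' :
  fps2_mon m n * fps2_mon m' n' = fps2_mon (m + m') (n + n').
Proof.
apply: fps2P => i j; rewrite fps2_monE /fps2_mon.
have -> : (i == m + m')%N = (m <= i)%N && (i - m == m')%N by lia.
have -> : (j == n + n')%N = (n <= j)%N && (j - n == n')%N by lia.
by case: (m <= i)%N; case: (n <= j)%N; rewrite //= ?andbF.
Qed.

(** Writing the two surviving terms with monomials makes a term with m > i or n > j vanish, where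
    [g (i - m) (j - n)] would be truncated. *)
Lemma fps2M_two f g i j m n m' n' : (m, n) <> (m', n') ->
  (forall k l, (k <= i)%N -> (l <= j)%N -> f k l != 0 -> g (i - k)%N (j - l)%N != 0 ->
     (k, l) = (m, n) \/ (k, l) = (m', n')) ->
  (f * g) i j = f m n * (fps2_mon m n * g) i j + f m' n' * (fps2_mon m' n' * g) i j.
Proof.
move=> neq H; rewrite !fps2_monE.
have E (c d : nat) (x : K) :
    \sum_(k < i.+1) \sum_(l < j.+1) (if (k == c :> nat) && (l == d :> nat) then x else 0)
    = if (c <= i)%N && (d <= j)%N then x else 0.
  rewrite (@sum_ord_only _ _ c (fun k => \sum_(l < j.+1)
    if (k == c) && (l == d :> nat) then x else 0)) => [|k _ km]; last first.
    by rewrite big1 // => l _; rewrite (negPf km).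
  rewrite ltnS eqxx; case: (c <= i)%N => //=.
  rewrite (@sum_ord_only _ _ d (fun l => if l == d then x else 0)) => [|l _ ln].
    by rewrite eqxx ltnS.
  by rewrite (negPf ln).
have E2 (c d : nat) : f c d * (if (c <= i)%N && (d <= j)%N then g (i - c)%N (j - d)%N else 0) =
   \sum_(k < i.+1) \sum_(l < j.+1) (if (k == c :> nat) && (l == d :> nat) then f c d * g (i - c)%N (j - d)%N else 0).
  by rewrite E; case: ifP => //; rewrite mulr0.
rewrite !E2 -big_split /= fps2ME; apply: eq_bigr => k _.
rewrite -big_split /=; apply: eq_bigr => l _.
have k_i : (k <= i)%N by rewrite -ltnS.
have l_j : (l <= j)%N by rewrite -ltnS.
case: (boolP ((k == m :> nat) && (l == n :> nat))) => [/andP[/eqP km /eqP ln]|N1].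
  rewrite {1}km {1}ln; case: ifP => [/andP[/eqP km' /eqP ln']|_].
    by case: neq; rewrite -km -ln km' ln'.
  by rewrite addr0 km ln.
case: (boolP ((k == m' :> nat) && (l == n' :> nat))) => [/andP[/eqP km /eqP ln]|N2].
  by rewrite add0r km ln.
rewrite addr0; have [->|fn0] := eqVneq (f k l) 0; first by rewrite mul0r.
have [->|gn0] := eqVneq (g (i - k)%N (j - l)%N) 0; first by rewrite mulr0.
case: (H _ _ k_i l_j fn0 gn0) => -[E1' E2'].
  by move: N1; rewrite E1' E2' !eqxx.
by move: N2; rewrite E1' E2' !eqxx.
Qed.

Lemma fps2_boxE m1 m2 f i j :
  (\sum_(k < m1) \sum_(l < m2) fps2_scale (f k l) (fps2_mon k l)) i j =
  if (i < m1)%N && (j < m2)%N then f i j else 0.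
Proof.
rewrite fps2_sumE.
rewrite (@sum_ord_only _ m1 i (fun k => (\sum_(l < m2) fps2_scale (f k l) (fps2_mon k l)) i j)).
  case: (i < m1)%N => //=; rewrite fps2_sumE.
  rewrite (@sum_ord_only _ m2 j (fun l => fps2_scale (f i l) (fps2_mon i l) i j)).
    by case: (j < m2)%N => //; rewrite fps2_scaleE /fps2_mon !eqxx mulr1.
  by move=> l _ lj; rewrite fps2_scaleE /fps2_mon (eq_sym j) (negPf lj) andbF mulr0.
move=> k _ ki; rewrite fps2_sumE big1 // => l _.
by rewrite fps2_scaleE /fps2_mon (eq_sym i) (negPf ki) mulr0.
Qed.

End FormalSeries.

(** * Newton polygons *)

(* The vertices are (vx e, vy e) for e <= s, and the e-th edge lies on the line
   al e * x + be e * y = D, where D is the same for all edges. *)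
Record polygon (s D p q : nat) (vx vy al be : nat -> nat) : Prop := Polygon {
  pol_s : (0 < s)%N;
  pol_x0 : vx 0%N = 0%N;
  pol_y0 : vy 0%N = p;
  pol_xs : vx s = q;
  pol_ys : vy s = 0%N;
  pol_xlt : forall e, (e < s)%N -> (vx e < vx e.+1)%N;
  pol_ylt : forall e, (e < s)%N -> (vy e.+1 < vy e)%N;
  pol_al : forall e, (e < s)%N -> (0 < al e)%N;
  pol_be : forall e, (e < s)%N -> (0 < be e)%N;
  pol_ge : forall e m, (e < s)%N -> (m <= s)%N -> (D <= al e * vx m + be e * vy m)%N;
  pol_eq : forall e m, (e < s)%N -> (m <= s)%N ->
    (al e * vx m + be e * vy m == D)%N = (m == e) || (m == e.+1) }.

Section Polygon.
Variables (s D p q : nat) (vx vy al be : nat -> nat).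
Hypothesis pol : polygon s D p q vx vy al be.
Local Open Scope nat_scope.

Definition ell e i j := al e * i + be e * j.
(** The Newton function, scaled to the value D on the polygon. The seed [ell 0] belongs to an edge
    since s > 0. *)
Definition nu i j := foldr (fun e => minn (ell e i j)) (ell 0 i j) (iota 0 s).
(** The cone over the edge e, cut out by two determinants. Neighbouring cones share a ray. *)
Definition cone e i j := [&& e < s, j * vx e <= i * vy e & i * vy e.+1 <= j * vx e.+1].
(** Twice the area of the triangle formed by the origin and the edge e; the subtraction is exact by
    [deltaE]. *)
Definition delta e := vx e.+1 * vy e - vx e * vy e.+1.

Lemma nu_le e i j : e < s -> nu i j <= ell e i j.
Proof.
move=> es; rewrite /nu; have : e \in iota 0 s by rewrite mem_iota.
elim: (iota 0 s) => //= a r IH; rewrite inE => /predU1P[->|/IH]; first exact: geq_minl.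
by apply: leq_trans; exact: geq_minr.
Qed.

Lemma nu_ex i j : exists2 e, e < s & nu i j = ell e i j.
Proof.
rewrite /nu; have : all (fun e => e < s) (iota 0 s) by apply/allP => e; rewrite mem_iota.
elim: (iota 0 s) => [_|a r IH /andP[as_ /IH[e es E]]] /=.
  by exists 0 => //; exact: pol_s pol.
by rewrite E; case: (leqP (ell a i j) (ell e i j)) => _; [exists a | exists e].
Qed.

Lemma vx_le m n : m <= n -> n <= s -> vx m <= vx n.
Proof.
elim: n => [|n IH]; first by rewrite leqn0 => /eqP ->.
rewrite leq_eqVlt => /orP[/eqP -> //|]; rewrite ltnS => mn ns.
exact: leq_trans (IH mn (ltnW ns)) (ltnW (pol_xlt pol ns)).
Qed.

Lemma vy_gt0 e : e < s -> 0 < vy e.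
Proof. by move=> es; apply: leq_ltn_trans (pol_ylt pol es). Qed.

Lemma vx_gt0 e : e < s -> 0 < vx e.+1.
Proof. by move=> es; apply: leq_ltn_trans (pol_xlt pol es). Qed.

Lemma deltaE e : e < s -> delta e + vx e * vy e.+1 = vx e.+1 * vy e.
Proof.
move=> es; apply: subnK; have := pol_xlt pol es; have := pol_ylt pol es; nia.
Qed.

Lemma delta_gt0 e : e < s -> 0 < delta e.
Proof.
move=> es; rewrite subn_gt0; have := pol_xlt pol es; have := pol_ylt pol es; nia.
Qed.

Lemma vert_inj m n : m <= s -> n <= s -> (vx m, vy m) = (vx n, vy n) -> m = n.
Proof.
wlog mn : m n / m <= n => [W ms ns E|ms ns [E _]].
  by case: (leqP m n) => [?|/ltnW ?]; [exact: W | symmetry; exact: W].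
move: mn; rewrite leq_eqVlt => /orP[/eqP //|mn].
have := vx_le mn ns; rewrite -E leqNgt (pol_xlt pol) //.
exact: leq_trans mn ns.
Qed.

Lemma ell_vert e : e < s -> (ell e (vx e) (vy e) = D) * (ell e (vx e.+1) (vy e.+1) = D).
Proof.
move=> es; split; apply/eqP; rewrite /ell (pol_eq pol) ?eqxx ?orbT //.
exact: ltnW.
Qed.

Lemma ellD e i j i' j' : ell e (i + i') (j + j') = ell e i j + ell e i' j'.
Proof. by rewrite /ell; lia. Qed.

Let cone_dec_nat x y x' y' d i j a b : d + x * y' = x' * y ->
  i * y = j * x + a -> j * x' = i * y' + b ->
  d * i = b * x + a * x' /\ d * j = b * y + a * y'.
Proof.
move=> Ed Ea Eb.
have := congr1 (muln^~ x) Eb; have := congr1 (muln^~ y) Eb.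
have := congr1 (muln^~ x') Ea; have := congr1 (muln^~ y') Ea.
have := congr1 (muln^~ i) Ed; have := congr1 (muln^~ j) Ed.
rewrite !mulnDl; nia.
Qed.

(** Cramer's rule without subtraction: a and b are delta e times the coordinates of (i, j) on the
    vertices e+1 and e. *)
Lemma cone_dec e i j : cone e i j -> exists a b,
  [/\ i * vy e = j * vx e + a, j * vx e.+1 = i * vy e.+1 + b,
      delta e * i = b * vx e + a * vx e.+1 & delta e * j = b * vy e + a * vy e.+1].
Proof.
case/and3P=> es /subnKC Ea /subnKC Eb.
exists (i * vy e - j * vx e), (j * vx e.+1 - i * vy e.+1); split=> //;
  by case: (cone_dec_nat (deltaE es) (esym Ea) (esym Eb)).
Qed.

(** The rays through successive vertices turn clockwise, so a point above one of them is above all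
    later ones. *)
Lemma side_succ e i j : e < s -> j * vx e >= i * vy e -> j * vx e.+1 >= i * vy e.+1.
Proof.
move=> es H; have := deltaE es; have := vy_gt0 es => y0 Ed.
have : i * vy e * vy e.+1 <= j * vx e * vy e.+1 by rewrite leq_mul2r H orbT.
rewrite -(leq_pmul2r y0) => ?; have := congr1 (muln j) Ed; nia.
Qed.

Lemma side_succ_lt e i j : e < s -> 0 < j -> j * vx e >= i * vy e ->
  j * vx e.+1 > i * vy e.+1.
Proof.
move=> es j0 H; have := deltaE es; have := vy_gt0 es => y0 Ed.
have := delta_gt0 es => d0.
have : i * vy e * vy e.+1 <= j * vx e * vy e.+1 by rewrite leq_mul2r H orbT.
rewrite -(ltn_pmul2r y0) => ?; have := congr1 (muln j) Ed; nia.
Qed.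

Lemma side_pred e i j : e.+1 < s -> i * vy e.+1 >= j * vx e.+1 -> i * vy e >= j * vx e.
Proof.
move=> es1 H; have es : e < s by exact: ltnW.
have := deltaE es; have := vy_gt0 es1 => y0 Ed.
have : j * vx e.+1 * vy e <= i * vy e.+1 * vy e by rewrite leq_mul2r H orbT.
rewrite -(leq_pmul2r y0) => ?; have := congr1 (muln j) Ed; nia.
Qed.

Lemma cone_ex i j : exists e, cone e i j.
Proof.
have ex : exists e, (e < s) && (i * vy e.+1 <= j * vx e.+1).
  by exists s.-1; rewrite !(prednK (pol_s pol)) (pol_ys pol) muln0 !leqnn.
case: (ex_minnP ex) => e /andP[es H] min_e; exists e; rewrite /cone es H andbT /=.
case: e es H min_e => [|e] es H min_e; first by rewrite (pol_x0 pol) muln0.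
apply/negbNE/negP; rewrite -ltnNge => /ltnW K.
by have := min_e e; rewrite K (ltnW es) ltnn => /(_ isT).
Qed.

Lemma cone_ell e i j a b : e < s -> delta e * i = b * vx e + a * vx e.+1 ->
  delta e * j = b * vy e + a * vy e.+1 ->
  forall e', delta e * ell e' i j =
    b * ell e' (vx e) (vy e) + a * ell e' (vx e.+1) (vy e.+1).
Proof. by move=> es Ei Ej e'; rewrite /ell; nia. Qed.

(** Every other edge form is at least D at both vertices that span the cone, hence at least [ell e]
    on their positive combinations. *)
Lemma cone_nu e i j : cone e i j -> nu i j = ell e i j.
Proof.
move=> c; have es : e < s by case/and3P: c.
apply/eqP; rewrite eqn_leq nu_le //=.
have [e' es' ->] := nu_ex i j.
have [a [b [_ _ /(cone_ell es) H /H {}H]]] := cone_dec c.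
rewrite -(leq_pmul2l (delta_gt0 es)) !H !ell_vert // leq_add // leq_mul2l /ell.
  by rewrite (pol_ge pol) ?orbT // ltnW.
by rewrite (pol_ge pol) ?orbT.
Qed.

(** Let e' be a cone containing the point. Equality of the two forms forces [ell e] to be D at each
    vertex of e' that has a nonzero coordinate, so these vertices lie on the edge e too. The four
    cases are the possible vanishings of the two coordinates. *)
Lemma nu_cone e i j : e < s -> nu i j = ell e i j -> cone e i j.
Proof.
move=> es E; have [e' c] := cone_ex i j.
have es' : e' < s by case/and3P: (c).
have := cone_nu c; rewrite E.
have [a [b [Ea Eb Ei Ej]]] := cone_dec c.
have H := cone_ell es' Ei Ej.
move/(congr1 (muln (delta e'))); rewrite !H !ell_vert //.
have g1 := pol_ge pol es (ltnW es'); have g2 := pol_ge pol es es'.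
have q1 := pol_eq pol es (ltnW es'); have q2 := pol_eq pol es es'.
rewrite -/(ell e (vx e') (vy e')) in g1 q1; rewrite -/(ell e (vx e'.+1) (vy e'.+1)) in g2 q2.
move=> Eq; move: (ell e (vx e') (vy e')) (ell e (vx e'.+1) (vy e'.+1)) g1 g2 q1 q2 Eq.
move=> L1 L2 g1 g2 q1 q2 Eq {H}.
have [e_e'|ne] := eqVneq e e'; first by rewrite e_e'.
have [b0|b0] := posnP b; have [a0|a0] := posnP a.
- have d0 := delta_gt0 es'.
  have i0 : i = 0 by apply/eqP; rewrite -(eqn_pmul2l d0) Ei a0 b0 !mul0n muln0.
  have j0 : j = 0 by apply/eqP; rewrite -(eqn_pmul2l d0) Ej a0 b0 !mul0n muln0.
  by rewrite /cone es i0 j0 !mul0n.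
- have : L2 == D by rewrite b0 !mul0n !add0n in Eq; nia.
  rewrite q2 eqSS (eq_sym e') (negPf ne) orbF => /eqP e'e.
  rewrite /cone es -e'e; rewrite b0 addn0 in Eb.
  rewrite Eb leqnn /=; apply: side_succ; rewrite ?e'e //.
  by rewrite -e'e Eb.
- have : L1 == D by rewrite a0 !mul0n !addn0 in Eq; nia.
  rewrite q1 (eq_sym e') (negPf ne) /= => /eqP e'e.
  rewrite /cone es -e'e; rewrite a0 addn0 in Ea.
  rewrite Ea leqnn andbT; apply: side_pred; rewrite -e'e //.
  by rewrite Ea.
- have : L1 == D by nia.
  have : L2 == D by nia.
  by rewrite q1 q2 eqSS (eq_sym e') (negPf ne) !orbF /= => /eqP E1 /eqP E2; lia.
Qed.

Lemma nuD i j i' j' : nu i j + nu i' j' <= nu (i + i') (j + j').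
Proof.
have [e es ->] := nu_ex (i + i') (j + j').
by rewrite ellD leq_add // nu_le.
Qed.

Lemma nu_vert m : m <= s -> nu (vx m) (vy m) = D.
Proof.
move=> ms; have [e es em] : exists2 e, e < s & (m == e) || (m == e.+1).
  case: m ms => [|m] ms; first by exists 0; [exact: (pol_s pol)|].
  by exists m; rewrite ?eqxx ?orbT.
apply/eqP; rewrite eqn_leq; apply/andP; split.
  rewrite (leq_trans (nu_le _ _ es)) // /ell.
  by rewrite leq_eqVlt (pol_eq pol) // em.
have [e' es' ->] := nu_ex (vx m) (vy m); exact: (pol_ge pol).
Qed.

Lemma nu_mono i j i' j' : i <= i' -> j <= j' -> nu i j <= nu i' j'.
Proof. by move=> /subnKC <- /subnKC <-; apply: leq_trans (nuD _ _ _ _); exact: leq_addr. Qed.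

Lemma nu_deg i j : i + j <= nu i j.
Proof.
have [e es ->] := nu_ex i j; rewrite /ell.
by rewrite leq_add // leq_pmull // ?(pol_al pol) ?(pol_be pol).
Qed.

Lemma D_gt0 : 0 < D.
Proof.
have := nu_vert (leq0n s); rewrite (pol_x0 pol) => <-.
by apply: leq_trans (nu_deg _ _); rewrite add0n vy_gt0 // (pol_s pol).
Qed.

(** A vertex can be subtracted without leaving the cone as soon as its coordinate, scaled by delta
    e, is at least delta e. *)
Lemma cone_sub_vert e i j m : cone e i j -> m = e \/ m = e.+1 ->
  (forall a b, i * vy e = j * vx e + a -> j * vx e.+1 = i * vy e.+1 + b ->
    delta e <= (if m == e then b else a)) ->
  [/\ vx m <= i, vy m <= j & cone e (i - vx m) (j - vy m)].
Proof.
move=> c me H; have es : e < s by case/and3P: (c).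
have [a [b [Ea Eb Ei Ej]]] := cone_dec c; have {}H := H _ _ Ea Eb.
have d0 := delta_gt0 es; have Ed := deltaE es.
have ix : vx m <= i.
  rewrite -(leq_pmul2l d0) Ei; case: me H => ->; rewrite ?eqxx ?(gtn_eqF (ltnSn e)) => H.
    by rewrite (leq_trans _ (leq_addr _ _)) // leq_mul2r H orbT.
  by rewrite (leq_trans _ (leq_addl _ _)) // leq_mul2r H orbT.
have jy : vy m <= j.
  rewrite -(leq_pmul2l d0) Ej; case: me H {ix} => ->; rewrite ?eqxx ?(gtn_eqF (ltnSn e)) => H.
    by rewrite (leq_trans _ (leq_addr _ _)) // leq_mul2r H orbT.
  by rewrite (leq_trans _ (leq_addl _ _)) // leq_mul2r H orbT.
split=> //; rewrite /cone es /= !mulnBl.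
by case: me H ix jy => ->; rewrite ?eqxx ?(gtn_eqF (ltnSn e)) => H ix jy; apply/andP; split; nia.
Qed.

End Polygon.

Definition fps2_dx (K : comNzRingType) (f : fps2 K) : fps2 K := fun i j => f i.+1 j *+ i.+1.
Definition fps2_dy (K : comNzRingType) (f : fps2 K) : fps2 K := fun i j => f i j.+1 *+ j.+1.

(** * Exactness of the Koszul complex for the Newton filtration *)

Section NewtonFiltration.
Variables (K : numFieldType) (s D p q : nat) (vx vy al be : nat -> nat).
Hypothesis pol : polygon s D p q vx vy al be.
Variable F : fps2 K.
Local Notation nu := (nu s al be).
Local Notation ell := (ell al be).
Local Notation cone := (cone s vx vy).
Local Notation delta := (delta vx vy).
Hypothesis F_ge : forall i j, F i j != 0 -> (D <= nu i j)%N.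
Hypothesis F_eq : forall i j, F i j != 0 -> nu i j = D ->
  exists2 m, (m <= s)%N & (i, j) = (vx m, vy m).
Hypothesis F_vert : forall m, (m <= s)%N -> F (vx m) (vy m) != 0.

Definition level n (f : fps2 K) := forall i j, f i j != 0 -> (n <= nu i j)%N.

Lemma level_mul m n f g : level m f -> level n g -> level (m + n) (f * g).
Proof.
move=> lf lg i j; apply: contra_neqT; rewrite -ltnNge => H.
rewrite fps2ME big1 // => k _; rewrite big1 // => l _.
have [->|/lf f0] := eqVneq (f k l) 0; first by rewrite mul0r.
have [->|/lg g0] := eqVneq (g (i - k)%N (j - l)%N) 0; first by rewrite mulr0.
have := leq_trans (leq_add f0 g0) (nuD pol _ _ _ _).
have ki : (k <= i)%N by rewrite -ltnS.
have lj : (l <= j)%N by rewrite -ltnS.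
by rewrite !subnKC // leqNgt H.
Qed.

Lemma level_le m n f : (m <= n)%N -> level n f -> level m f.
Proof. by move=> mn lf i j /lf; apply: leq_trans. Qed.

(** The logarithmic derivatives x F_x and y F_y multiply the coefficients of F by i and by j. Unlike
    F_x and F_y they keep the support inside the Newton polyhedron. *)
Let GX : fps2 K := fps2_mon _ 1 0 * fps2_dx F.
Let GY : fps2 K := fps2_mon _ 0 1 * fps2_dy F.
Let c m := F (vx m) (vy m).

Let GXE i j : GX i j = i%:R * F i j.
Proof.
rewrite /GX fps2_monE /= subn0 andbT; case: i => [|i]; first by rewrite mul0r.
by rewrite subn1 /= /fps2_dx mulr_natl.
Qed.

Let GYE i j : GY i j = j%:R * F i j.
Proof.
rewrite /GY fps2_monE /= subn0; case: j => [|j]; first by rewrite mul0r.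
by rewrite subn1 /= /fps2_dy mulr_natl.
Qed.

Let level_GX : level D GX.
Proof. by move=> i j; rewrite GXE mulf_eq0 negb_or => /andP[_ /F_ge]. Qed.

Let level_GY : level D GY.
Proof. by move=> i j; rewrite GYE mulf_eq0 negb_or => /andP[_ /F_ge]. Qed.

Let vm m := fps2_mon K (vx m) (vy m).

(* The initial form of F along the edge e has two terms only. *)
Lemma edge_coef (th : nat -> nat -> K) (H a : fps2 K) n e i j :
  (forall i j, H i j = th i j * F i j) -> level n a -> (e < s)%N ->
  ell e i j = (n + D)%N ->
  (a * H) i j = th (vx e) (vy e) * c e * (vm e * a) i j +
                th (vx e.+1) (vy e.+1) * c e.+1 * (vm e.+1 * a) i j.
Proof.
move=> HE la es Ew; rewrite mulrC -!HE; apply: fps2M_two.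
  by move=> /(vert_inj pol (ltnW es) es) /eqP; rewrite ltn_eqF.
move=> k l ki lj; rewrite HE mulf_eq0 negb_or => /andP[_ Fkl] /la.
move: Ew; rewrite -(subnKC ki) -(subnKC lj) ellD !addKn.
have := F_ge Fkl; have := nu_le al be k l es; have := nu_le al be (i - k) (j - l) es.
move=> h1 h2 h3 Ew h4.
have [m ms [km lm]] : exists2 m, (m <= s)%N & (k, l) = (vx m, vy m).
  by apply: F_eq => //; lia.
have : ell e k l == D by lia.
by rewrite km lm (pol_eq pol) // => /orP[/eqP ->|/eqP ->]; [left|right].
Qed.

Section Step.
Variables (a b : fps2 K) (d : nat).
Hypotheses (la : level d a) (lb : level d b).
Hypothesis ab0 : forall i j, nu i j = (d + D)%N -> (a * GX + b * GY) i j = 0.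
Hypothesis ab_lt : forall i j, (nu i j < d + D)%N -> (a * GX + b * GY) i j = 0.

(** In weight d + D of the edge e, a x F_x + b y F_y is the sum of c m times the monomial of the
    vertex m times L m, over the two ends m of the edge. As delta e is nonzero, L e and L (e+1)
    determine a and b. *)
Let L m : fps2 K := fps2_scale (vx m)%:R a + fps2_scale (vy m)%:R b.

Let vmL m n i j :
  (vm m * L n) i j = (vx n)%:R * (vm m * a) i j + (vy n)%:R * (vm m * b) i j.
Proof.
by rewrite mulrDr fps2DE ![vm m * fps2_scale _ _]mulrC !fps2_scaleM !fps2_scaleE ![_ * vm m]mulrC.
Qed.

Let edge_rel e i j : (e < s)%N -> ell e i j = (d + D)%N ->
  c e * (vm e * L e) i j + c e.+1 * (vm e.+1 * L e.+1) i j = 0.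
Proof.
move=> es Ew; have : (a * GX + b * GY) i j = 0.
  by have := nu_le al be i j es; rewrite Ew leq_eqVlt => /orP[/eqP /ab0|/ab_lt].
rewrite fps2DE (edge_coef GXE la es Ew) (edge_coef GYE lb es Ew) => H.
by rewrite !vmL -[RHS]H; ring.
Qed.

(** Outside the cone of e, [nu] is strictly below [ell e], so the point lies under the level d of a
    and b. *)
Let L_out m e i j : (e < s)%N -> ell e i j = d -> ~~ cone e i j -> L m i j = 0.
Proof.
move=> es Ed nc; have nud : nu i j <> d.
  by move=> nud; move/negP: nc; apply; apply: (nu_cone pol es); rewrite Ed.
have nult : (nu i j < d)%N by have := nu_le al be i j es; lia.
have a0 : a i j = 0 by apply: contraTeq nult => /la; rewrite -leqNgt.
have b0 : b i j = 0 by apply: contraTeq nult => /lb; rewrite -leqNgt.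
by rewrite /L fps2DE !fps2_scaleE a0 b0 !mulr0 addr0.
Qed.

(** The only value that the cofactor C can take at (i, j) if [L_same] is to hold at (i, j) plus the
    vertex e+1. *)
Let val e i j : K := - L e (i + vx e.+1)%N (j + vy e.+1)%N / (c e.+1 * (delta e)%:R).

Let vmE m f i j : (vm m * f) (i + vx m)%N (j + vy m)%N = f i j.
Proof. by rewrite fps2_monE !leq_addl /= !addnK. Qed.

Let deltaR e : (e < s)%N ->
  (delta e)%:R = (vx e.+1)%:R * (vy e)%:R - (vx e)%:R * (vy e.+1)%:R :> K.
Proof. by move=> es; rewrite -!natrM -(deltaE pol es) natrD addrK. Qed.

Let deltaR_neq0 e : (e < s)%N -> (delta e)%:R != 0 :> K.
Proof. by move=> es; rewrite pnatr_eq0 -lt0n (delta_gt0 pol). Qed.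

(** On the ray shared by two cones both formulas must give the same value. This is the only place
    where different edges interact. *)
Let val_step e i j : (e.+1 < s)%N -> (i * vy e.+1 = j * vx e.+1)%N ->
  (nu i j + D = d)%N -> val e i j = val e.+1 i j.
Proof.
move=> es1 ray nud; have es : (e < s)%N by exact: ltnW.
have c0 : cone e i j by rewrite /cone es ray leqnn andbT; apply: (side_pred pol); rewrite ?ray.
have c1 : cone e.+1 i j by rewrite /cone es1 ray leqnn /=; apply: (side_succ pol); rewrite ?ray.
have E0 := cone_nu pol c0; have E1 := cone_nu pol c1.
have [V0 V1] := ell_vert pol es; have [W0 W1] := ell_vert pol es1.
have := @edge_rel e (i + vx e.+1 + vx e.+1) (j + vy e.+1 + vy e.+1) es.
rewrite !ellD V1 vmE => /(_ _)/wrap[]; first by lia.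
(* Twice the vertex e+1 minus the vertex e leads out of the cone of e, so the relation of e reduces
   to the vanishing of [L e.+1] at (i, j) plus the vertex e+1. *)
have -> : (vm e * L e) (i + vx e.+1 + vx e.+1)%N (j + vy e.+1 + vy e.+1)%N = 0.
  rewrite fps2_monE; case: ifP => // /andP[hx hy].
  apply: (@L_out _ e) => //.
    have : ell e (i + vx e.+1 + vx e.+1) (j + vy e.+1 + vy e.+1) = (d + D)%N.
      by rewrite !ellD V1; lia.
    by rewrite -{1}(subnK hx) -{1}(subnK hy) ellD V0; lia.
  rewrite /cone es /= negb_and -!ltnNge; apply/orP; right.
  have := delta_gt0 pol es; have := deltaE pol es; rewrite !mulnBl; nia.
rewrite mulr0 add0r => /eqP; rewrite mulf_eq0 (negPf (F_vert es)) /= => /eqP H0.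
have := @edge_rel e.+1 (i + vx e.+1 + vx e.+2) (j + vy e.+1 + vy e.+2) es1.
rewrite !ellD W0 W1 vmE => /(_ _)/wrap[]; first by lia.
have -> : (i + vx e.+1 + vx e.+2 = i + vx e.+2 + vx e.+1)%N by lia.
have -> : (j + vy e.+1 + vy e.+2 = j + vy e.+2 + vy e.+1)%N by lia.
rewrite vmE => H1.
have [C1 C2] : c e.+1 != 0 /\ c e.+2 != 0 by split; exact: F_vert.
have [D0 D1] := (deltaR_neq0 es, deltaR_neq0 es1).
have -> : val e.+1 i j = L e.+2 (i + vx e.+1)%N (j + vy e.+1)%N / (c e.+1 * (delta e.+1)%:R).
  rewrite /val; move/eqP: H1; rewrite addr_eq0 => /eqP H1.
  apply/eqP; rewrite eqr_div ?mulf_neq0 //; apply/eqP.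
  transitivity (- (c e.+1 * L e.+1 (i + vx e.+2)%N (j + vy e.+2)%N) * (delta e.+1)%:R).
    by ring.
  by rewrite H1; ring.
rewrite /val.
move: H0 {H1}; rewrite /L !fps2DE !fps2_scaleE.
move: (a _ _) (b _ _) D0 D1; rewrite !deltaR // => x y D0 D1 H0.
apply/eqP; rewrite eqr_div ?mulf_neq0 //; apply/eqP.
apply/eqP; rewrite -subr_eq0; apply/eqP.
(* This is the linear relation between the three plane vectors given by the vertices e, e+1 and e+2;
   the middle one contributes nothing by [H0]. *)
rewrite -[RHS](mulr0 (c e.+1 * ((vx e)%:R * (vy e.+2)%:R - (vx e.+2)%:R * (vy e)%:R))) -H0; ring.
Qed.

(** A point in the cones of e and e' lies on all the rays between them, so [val_step] can be
    chained. *)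
Let val_indep e e' i j : cone e i j -> cone e' i j -> (nu i j + D = d)%N ->
  val e i j = val e' i j.
Proof.
wlog ee : e e' / (e <= e')%N => [W c0 c1 nud|].
  by case: (leqP e e') => [?|/ltnW ?]; [exact: W | symmetry; exact: W].
rewrite -(subnKC ee); elim: (e' - e)%N => [|k IH] c0 c1 nud; first by rewrite addn0.
have k1s : ((e + k).+1 < s)%N by rewrite -addnS; case/and3P: c1.
have le1 m : (e.+1 + m < s)%N -> (i * vy (e.+1 + m) <= j * vx (e.+1 + m))%N.
  elim: m => [|m IHm]; first by rewrite addn0; case/and3P: c0.
  rewrite addnS => ms; apply: (side_succ pol); first exact: ltnW.
  by apply: IHm; exact: ltnW.
have ray : (i * vy (e + k).+1 = j * vx (e + k).+1)%N.
  apply/eqP; rewrite eqn_leq; apply/andP; split; last by rewrite -addnS; case/and3P: c1.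
  by have := le1 k; rewrite addSn => /(_ k1s).
have ck : cone (e + k) i j.
  by rewrite /cone (ltnW k1s) ray leqnn andbT; apply: (side_pred pol); rewrite ?ray.
by rewrite (IH c0 ck nud) addnS; apply: val_step.
Qed.

Let ce i j := ex_minn (cone_ex pol i j).
Let ceP i j : cone (ce i j) i j.
Proof. by rewrite /ce; case: ex_minnP. Qed.

Let C : fps2 K := fun i j => if (nu i j + D == d)%N then val (ce i j) i j else 0.

Let CE e i j : cone e i j -> (nu i j + D = d)%N -> C i j = val e i j.
Proof. by move=> co nud; rewrite /C nud eqxx; apply: val_indep => //; exact: ceP. Qed.

Let vmC e m i j : (e < s)%N -> cone e i j -> nu i j = d -> m = e \/ m = e.+1 ->
  (vm m * C) i j != 0 ->
  [/\ (vx m <= i)%N, (vy m <= j)%N, cone e (i - vx m) (j - vy m)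
    & (nu (i - vx m) (j - vy m) + D = d)%N].
Proof.
move=> es co nud me; rewrite fps2_monE; case: ifP => [/andP[hx hy]|_ /eqP //].
rewrite {1}/C; case: (eqVneq (nu (i - vx m) (j - vy m) + D)%N d) => [E|_ /eqP //] _; split=> //.
apply: (nu_cone pol es); apply/eqP; rewrite -(eqn_add2r D) E -{1}nud (cone_nu pol co).
rewrite -{1}(subnK hx) -{1}(subnK hy) ellD eqn_add2l.
by have [V0 V1] := ell_vert pol es; case: me => ->; rewrite ?V0 ?V1.
Qed.

Let nu_sub e m i j : cone e i j -> nu i j = d -> m = e \/ m = e.+1 ->
  [/\ (vx m <= i)%N, (vy m <= j)%N & cone e (i - vx m) (j - vy m)] ->
  (nu (i - vx m) (j - vy m) + D = d)%N.
Proof.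
move=> co nud me [hx hy co']; have es : (e < s)%N by case/and3P: co.
rewrite (cone_nu pol co') -nud (cone_nu pol co) -{2}(subnK hx) -{2}(subnK hy) ellD.
by have [V0 V1] := ell_vert pol es; case: me => ->; rewrite ?V0 ?V1.
Qed.

(** Passing from (i, j) to (i', j') lowers the scaled coordinate on the vertex m by delta e. That it
    stays non-negative is the condition of [cone_sub_vert]. *)
Let cone_or e i j i' j' m m' : cone e i j -> (m = e /\ m' = e.+1) \/ (m = e.+1 /\ m' = e) ->
  (i' + vx m = i + vx m')%N -> (j' + vy m = j + vy m')%N -> cone e i' j' ->
  [/\ (vx m <= i)%N, (vy m <= j)%N & cone e (i - vx m) (j - vy m)].
Proof.
move=> co mm Ei Ej co'; have es : (e < s)%N by case/and3P: co.
apply: (cone_sub_vert pol) => //; first by case: mm => -[-> _]; [left|right].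
move=> x y Ex Ey; have Ed := deltaE pol es.
have {co'} [x' [y' [Ex' Ey' _ _]]] := cone_dec pol co'.
case: mm Ei Ej => -[-> ->] Ei Ej; rewrite ?eqxx ?(gtn_eqF (ltnSn e)).
  have := congr1 (muln^~ (vy e.+1)) Ei; have := congr1 (muln^~ (vx e.+1)) Ej; nia.
have := congr1 (muln^~ (vy e)) Ei; have := congr1 (muln^~ (vx e)) Ej; nia.
Qed.

Let vmL_out e m m' i j : cone e i j -> nu i j = d ->
  (m = e /\ m' = e.+1) \/ (m = e.+1 /\ m' = e) ->
  ~ [/\ (vx m <= i)%N, (vy m <= j)%N & cone e (i - vx m) (j - vy m)] ->
  (vm m * L m) (i + vx m')%N (j + vy m')%N = 0.
Proof.
move=> co nud mm nsub; have es : (e < s)%N by case/and3P: co.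
rewrite fps2_monE; case: ifP => // /andP[hx hy]; apply: (@L_out _ e) => //.
  have [V0 V1] := ell_vert pol es.
  have : (ell e (i + vx m') (j + vy m') = d + D)%N.
    by rewrite ellD -nud (cone_nu pol co); case: mm => -[_ ->]; rewrite ?V0 ?V1.
  rewrite -{1}(subnK hx) -{1}(subnK hy) ellD.
  by case: mm => -[-> _]; rewrite ?V0 ?V1; lia.
apply/negP => co'; apply: nsub.
by apply: (cone_or co mm _ _ co'); rewrite subnK.
Qed.

Let L_succ e i j : cone e i j -> nu i j = d ->
  L e.+1 i j = c e * (delta e)%:R * (vm e * C) i j.
Proof.
move=> co nud; have es : (e < s)%N by case/and3P: co.
have C1 : c e.+1 != 0 by exact: F_vert.
have := @edge_rel e (i + vx e.+1) (j + vy e.+1) es; rewrite vmE => /(_ _)/wrap[].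
  by rewrite ellD (ell_vert pol es).2 -nud (cone_nu pol co).
have [sub|nsub] := pselect [/\ (vx e <= i)%N, (vy e <= j)%N & cone e (i - vx e) (j - vy e)].
  have nud' := nu_sub co nud (or_introl erefl) sub.
  case: sub => hx hy co'; rewrite !fps2_monE hx hy (CE co' nud') /val.
  have -> : (vx e <= i + vx e.+1)%N by rewrite (leq_trans hx) ?leq_addr.
  have -> : (vy e <= j + vy e.+1)%N by rewrite (leq_trans hy) ?leq_addr.
  rewrite !addnBAC // => /eqP; rewrite addrC addr_eq0 => /eqP H.
  by apply: (mulfI C1); rewrite H /=; field; rewrite C1 deltaR_neq0.
rewrite (vmL_out co nud) //; last by left.
have -> : (vm e * C) i j = 0.
  apply/eqP/negPn/negP => /(vmC es co nud (or_introl erefl)) [? ? ? _]; exact: nsub.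
by rewrite !mulr0 add0r => /eqP; rewrite mulf_eq0 (negPf C1) => /eqP.
Qed.

Let L_same e i j : cone e i j -> nu i j = d ->
  L e i j = - (c e.+1 * (delta e)%:R * (vm e.+1 * C) i j).
Proof.
move=> co nud; have es : (e < s)%N by case/and3P: co.
have C1 : c e.+1 != 0 by exact: F_vert.
have C0 : c e != 0 by apply: F_vert; exact: ltnW.
have [sub|nsub] := pselect [/\ (vx e.+1 <= i)%N, (vy e.+1 <= j)%N
    & cone e (i - vx e.+1) (j - vy e.+1)].
  have nud' := nu_sub co nud (or_intror erefl) sub.
  case: sub => hx hy co'; rewrite !fps2_monE hx hy (CE co' nud') /val !subnK //=.
  by field; rewrite C1 deltaR_neq0.
have := @edge_rel e (i + vx e) (j + vy e) es; rewrite vmE => /(_ _)/wrap[].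
  by rewrite ellD (ell_vert pol es).1 -nud (cone_nu pol co).
rewrite (vmL_out co nud) //; last by right.
have -> : (vm e.+1 * C) i j = 0.
  apply/eqP/negPn/negP => /(vmC es co nud (or_intror erefl)) [? ? ? _]; exact: nsub.
by rewrite !mulr0 addr0 oppr0 => /eqP; rewrite mulf_eq0 (negPf C0) => /eqP.
Qed.

Let vmC_coef (th : nat -> nat -> K) (H : fps2 K) e i j :
  (forall i j, H i j = th i j * F i j) -> cone e i j -> nu i j = d ->
  (C * H) i j = th (vx e) (vy e) * c e * (vm e * C) i j +
                th (vx e.+1) (vy e.+1) * c e.+1 * (vm e.+1 * C) i j.
Proof.
move=> HE co nud; have es : (e < s)%N by case/and3P: co.
case: (leqP D d) => [Dd|dD].
  apply: (@edge_coef th H C (d - D)%N) => //; last by rewrite subnK // -nud (cone_nu pol co).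
  move=> k l; rewrite /C; case: (eqVneq (nu k l + D)%N d) => [<- _|_ /eqP //]; by rewrite addnK.
have -> : C = 0.
  apply: fps2P => k l; rewrite /C; case: eqP => // E; move: dD.
  by rewrite -E ltnNge leq_addl.
by rewrite mul0r !mulr0 !fps20E ?mulr0 addr0.
Qed.

(** Exactness in one degree: a syzygy of the initial forms is a multiple of the trivial one.
    [L_same] and [L_succ] express L e and L (e+1) through C, and Cramer's rule with determinant
    delta e returns a and b. *)
Lemma exact_step : exists2 C : fps2 K, (forall i j, C i j != 0 -> (nu i j + D = d)%N) &
  forall i j, nu i j = d -> a i j = (C * GY) i j /\ b i j = - (C * GX) i j.
Proof.
exists C => [i j|i j nud]; first by rewrite /C; case: (eqVneq (nu i j + D)%N d) => [-> //|_ /eqP //].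
have [e co] := cone_ex pol i j; have es : (e < s)%N by case/and3P: (co).
rewrite !(vmC_coef GXE co nud, vmC_coef GYE co nud).
have := L_same co nud; have := L_succ co nud; rewrite /L !fps2DE !fps2_scaleE deltaR //.
have := deltaR_neq0 es; rewrite deltaR //.
move: (a i j) (b i j) (c e) (c e.+1) ((vm e * C) i j) ((vm e.+1 * C) i j).
move: ((vx e)%:R : K) ((vy e)%:R : K) ((vx e.+1)%:R : K) ((vy e.+1)%:R : K) => x0 y0 x1 y1 a' b' c0 c1 A B d0 E1 E0.
split; apply: (mulfI d0).
  transitivity (y0 * (x1 * a' + y1 * b') - y1 * (x0 * a' + y0 * b')); first by ring.
  by rewrite E0 E1; ring.
transitivity (x1 * (x0 * a' + y0 * b') - x0 * (x1 * a' + y1 * b')); first by ring.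
by rewrite E0 E1; ring.
Qed.

End Step.
Local Notation dX := (fps2_dx F).
Local Notation dY := (fps2_dy F).

(** A, B and A F_x + B F_y are weighed after multiplication by y, x and x y. This turns the plain
    derivatives into logarithmic ones and explains all the index shifts below. *)
Lemma level_mul_dx m (A : fps2 K) : (forall i j, A i j != 0 -> (m <= nu i j.+1)%N) ->
  forall i j, (A * dX) i j != 0 -> (m + D <= nu i.+1 j.+1)%N.
Proof.
move=> HA i j; have lA : level m (fps2_mon K 0 1 * A).
  move=> k [|l]; rewrite fps2_monE /= ?eqxx // subn0 subn1; exact: HA.
move: (@level_mul _ _ _ _ lA level_GX i.+1 j.+1).
by rewrite /GX mulrACA (fps2_monM K 0 1 1 0) fps2_monE /= !subn1.
Qed.

Lemma level_mul_dy m (B : fps2 K) : (forall i j, B i j != 0 -> (m <= nu i.+1 j)%N) ->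
  forall i j, (B * dY) i j != 0 -> (m + D <= nu i.+1 j.+1)%N.
Proof.
move=> HB i j; have lB : level m (fps2_mon K 1 0 * B).
  move=> [|k] l; rewrite fps2_monE /= ?eqxx // subn0 subn1; exact: HB.
move: (@level_mul _ _ _ _ lB level_GY i.+1 j.+1).
by rewrite /GY mulrACA (fps2_monM K 1 0 0 1) fps2_monE /= !subn1.
Qed.

Lemma level_dx m C : level m C -> forall i j, (C * dX) i j != 0 -> (m + D <= nu i.+1 j)%N.
Proof.
move=> lC i j; move: (@level_mul _ _ _ _ lC level_GX i.+1 j).
by rewrite /GX mulrCA fps2_monE /= subn0 subn1.
Qed.

Lemma level_dy m C : level m C -> forall i j, (C * dY) i j != 0 -> (m + D <= nu i j.+1)%N.
Proof.
move=> lC i j; move: (@level_mul _ _ _ _ lC level_GY i j.+1).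
by rewrite /GY mulrCA fps2_monE /= subn0 subn1.
Qed.

(** Induction on n: once (A, B) is a Koszul boundary below level n, the difference has level n, and
    [exact_step] corrects its part of weight exactly n. The correction is homogeneous of weight n -
    D, so it leaves the lower part alone. *)
Lemma koszul_exact n (A B : fps2 K) :
  (forall i j, (nu i.+1 j.+1 < n + D)%N -> (A * dX + B * dY) i j = 0) ->
  exists C : fps2 K, forall i j,
    ((nu i j.+1 < n)%N -> A i j = (C * dY) i j) /\
    ((nu i.+1 j < n)%N -> B i j = - (C * dX) i j).
Proof.
elim: n => [|n IH] Z0; first by exists 0.
case: IH => [i j ij|C HC]; first by apply: Z0; rewrite addSn ltnW.
pose A' := A - C * dY; pose B' := B + C * dX.
have Z' : A' * dX + B' * dY = A * dX + B * dY by rewrite /A' /B'; ring.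
pose a := fps2_mon K 0 1 * A'; pose b := fps2_mon K 1 0 * B'.
have aE i j : a i j.+1 = A' i j by rewrite /a fps2_monE /= subn0 subn1.
have bE i j : b i.+1 j = B' i j by rewrite /b fps2_monE /= subn0 subn1.
have la : level n a.
  move=> i [|j]; first by rewrite /a fps2_monE /= eqxx.
  rewrite aE; apply: contra_neqT; rewrite -ltnNge => /(HC i j).1 E.
  by rewrite /A' fps2BE E subrr.
have lb : level n b.
  move=> [|i] j; first by rewrite /b fps2_monE /= eqxx.
  rewrite bE; apply: contra_neqT; rewrite -ltnNge => /(HC i j).2 E.
  by rewrite /B' fps2DE E addNr.
have abE : a * GX + b * GY = fps2_mon K 1 1 * (A * dX + B * dY).
  rewrite -Z' -[fps2_mon K 1 1](fps2_monM K 1 0 0 1) /a /b /GX /GY; ring.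
have ab0 i j : (nu i j < n.+1 + D)%N -> (a * GX + b * GY) i j = 0.
  rewrite abE fps2_monE; case: i j => [|i] [|j] //= H.
  by rewrite !subn1; apply: Z0.
have [i j ij|i j ij|C' lC' HC'] := exact_step la lb.
- by apply: ab0; rewrite ij addSn.
- by apply: ab0; rewrite addSn ltnW.
have C'Y i j : (C' * GY) i j.+1 = (C' * dY) i j.
  by rewrite mulrCA fps2_monE /= subn0 subn1.
have C'X i j : (C' * GX) i.+1 j = (C' * dX) i j.
  by rewrite mulrCA fps2_monE /= subn0 subn1.
have lC : level (n - D) C' by move=> i j /lC' <-; rewrite addnK.
have lY : level n (C' * GY).
  by apply: level_le (level_mul lC level_GY); rewrite addnC -maxnE leq_maxr.
have lX : level n (C' * GX).
  by apply: level_le (level_mul lC level_GX); rewrite addnC -maxnE leq_maxr.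
exists (C + C') => i j; rewrite !mulrDl !fps2DE opprD; split.
  rewrite ltnS leq_eqVlt => /orP[/eqP /HC'[]|nlt].
    by rewrite aE C'Y /A' fps2BE => <- _; rewrite addrC subrK.
  rewrite (HC i j).1 // -C'Y; apply/eqP; rewrite addrC -subr_eq subrr eq_sym.
  by apply: contraTT nlt => /lY; rewrite -leqNgt.
rewrite ltnS leq_eqVlt => /orP[/eqP /HC'[_]|nlt].
  by rewrite bE C'X /B' fps2DE => <-; rewrite addrC addrK.
rewrite (HC i j).2 // -C'X; apply/eqP; rewrite addrC -subr_eq subrr eq_sym oppr_eq0.
by apply: contraTT nlt => /lX; rewrite -leqNgt.
Qed.

(** At a point of lowest weight d in the cone of e, shifted by the vertex e, both products involve
    only the coefficient of C there and one other coefficient. *)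
Lemma koszul_inj n (C : fps2 K) :
  (forall i j, (nu i j.+1 < n + D)%N -> (C * dY) i j = 0) ->
  (forall i j, (nu i.+1 j < n + D)%N -> (C * dX) i j = 0) ->
  level n C.
Proof.
move=> HY HX.
have CX i j : (nu i j < n + D)%N -> (C * GX) i j = 0.
  rewrite mulrCA fps2_monE /= subn0 andbT; case: i => //= i H.
  by rewrite subn1; exact: HX.
have CY i j : (nu i j < n + D)%N -> (C * GY) i j = 0.
  rewrite mulrCA fps2_monE /= subn0; case: j => //= j H.
  by rewrite subn1; exact: HY.
suff H d : (d <= n)%N -> level d C by exact: H.
elim: d => [//|d IH] dn i j; apply: contra_neqT; rewrite -ltnNge ltnS leq_eqVlt.
have {IH} lC := IH (ltnW dn).
case/orP => [/eqP nud|]; last by apply: contraTeq => /lC; rewrite -leqNgt.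
have [e co] := cone_ex pol i j; have es : (e < s)%N by case/and3P: (co).
have Ew : ell e (i + vx e) (j + vy e) = (d + D)%N.
  by rewrite ellD (ell_vert pol es).1 -nud (cone_nu pol co).
have lt : (nu (i + vx e) (j + vy e) < n + D)%N.
  by rewrite (leq_ltn_trans (nu_le _ _ _ _ es)) // Ew ltn_add2r.
have := CX _ _ lt; have := CY _ _ lt.
rewrite (edge_coef GXE lC es Ew) (edge_coef GYE lC es Ew).
have -> : (vm e * C) (i + vx e)%N (j + vy e)%N = C i j.
  by rewrite fps2_monE !leq_addl /= !addnK.
move: ((vm e.+1 * C) _ _) => y E1 E2.
have C0 : c e != 0 by apply: F_vert; exact: ltnW.
have d0 : (vx e.+1)%:R * (vy e)%:R - (vx e)%:R * (vy e.+1)%:R != 0 :> K.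
  by rewrite -!natrM -(deltaE pol es) natrD addrK pnatr_eq0 -lt0n (delta_gt0 pol).
(* Eliminating the other coefficient y leaves the coefficient of C multiplied by c e and by the
   determinant. *)
apply: (mulfI C0); apply: (mulfI d0); rewrite !mulr0.
have := congr1 (fun t => (vx e.+1)%:R * t) E1; have := congr1 (fun t => (vy e.+1)%:R * t) E2.
rewrite !mulr0 => F1 F2; rewrite -[RHS](subrr 0) -{1}F2 -F1; ring.
Qed.

End NewtonFiltration.

Local Open Scope nat_scope.

(** * Counting lattice points *)

Definition box_pts N (P : nat -> nat -> bool) : seq (nat * nat) :=
  [seq (val x.1, val x.2) | x <- enum [pred x : 'I_N * 'I_N | P x.1 x.2]].

Definition box_cnt N (P : nat -> nat -> bool) : nat := \sum_(i < N) \sum_(j < N) P i j.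

Lemma mem_box_pts N P i j : ((i, j) \in box_pts N P) = [&& P i j, i < N & j < N].
Proof.
apply/mapP/and3P => [[[a b]]|[Pij iN jN]].
  by rewrite mem_enum inE /= => Pab [-> ->].
by exists (Ordinal iN, Ordinal jN); rewrite ?mem_enum.
Qed.

Lemma box_pts_uniq N P : uniq (box_pts N P).
Proof.
by rewrite map_inj_uniq ?enum_uniq // => -[? ?] [? ?] [/val_inj -> /val_inj ->].
Qed.

Lemma size_box_pts N P : size (box_pts N P) = box_cnt N P.
Proof.
rewrite size_map -cardE -sum1_card big_mkcond /= /box_cnt pair_big /=.
by apply: eq_bigr => x _; rewrite inE; case: (P _ _).
Qed.

Lemma box_cnt_bij N (P Q : nat -> nat -> bool) (f g : nat * nat -> nat * nat) :
  (forall x, x \in box_pts N P -> f x \in box_pts N Q /\ g (f x) = x) ->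
  (forall x, x \in box_pts N Q -> g x \in box_pts N P /\ f (g x) = x) ->
  box_cnt N P = box_cnt N Q.
Proof.
move=> fP gQ; rewrite -!size_box_pts; apply/eqP; rewrite eqn_leq; apply/andP; split.
  rewrite -(size_map f); apply: uniq_leq_size => [|_ /mapP[x xP ->]]; last by case: (fP x xP).
  rewrite map_inj_in_uniq ?box_pts_uniq // => x y xP yP E.
  by rewrite -(fP x xP).2 -(fP y yP).2 E.
rewrite -(size_map g); apply: uniq_leq_size => [|_ /mapP[x xQ ->]]; last by case: (gQ x xQ).
rewrite map_inj_in_uniq ?box_pts_uniq // => x y xQ yQ E.
by rewrite -(gQ x xQ).2 -(gQ y yQ).2 E.
Qed.

Lemma box_cnt_shift N (P : nat -> nat -> bool) m n :
  (forall i j, P i j -> i + m < N /\ j + n < N) ->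
  box_cnt N (fun i j => [&& m <= i, n <= j & P (i - m) (j - n)]) = box_cnt N P.
Proof.
move=> PN; apply: (@box_cnt_bij _ _ _ (fun x => (x.1 - m, x.2 - n)) (fun x => (x.1 + m, x.2 + n))).
  case=> i j; rewrite !mem_box_pts /= => /and3P[/and3P[mi nj Pij] iN jN].
  by rewrite Pij !subnK // !(leq_ltn_trans (leq_subr _ _)).
case=> i j; rewrite !mem_box_pts /= => /and3P[Pij _ _].
by rewrite !leq_addl !addnK Pij; have [-> ->] := PN _ _ Pij.
Qed.

Lemma eq_box_cnt N (P Q : nat -> nat -> bool) : (forall i j, P i j = Q i j) -> box_cnt N P = box_cnt N Q.
Proof. by move=> PQ; apply: eq_bigr => i _; apply: eq_bigr => j _; rewrite PQ. Qed.

Lemma box_cntD N (P Q S : nat -> nat -> bool) : (forall i j, (P i j : nat) = Q i j + S i j) ->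
  box_cnt N P = box_cnt N Q + box_cnt N S.
Proof.
move=> PQ; rewrite /box_cnt -big_split /=; apply: eq_bigr => i _.
by rewrite -big_split /=; apply: eq_bigr => j _.
Qed.

Lemma box_cnt_split N (Q P : nat -> nat -> bool) :
  box_cnt N P = box_cnt N (fun i j => P i j && Q i j) + box_cnt N (fun i j => P i j && ~~ Q i j).
Proof. by apply: box_cntD => i j; case: (P i j); case: (Q i j). Qed.

(* A half-open parallelogram spanned by (x, y) and (x', y') has as many lattice
   points as its area: with g = gcd(x, y), each of the lines parallel to (x, y)
   that carry lattice points of the parallelogram contains g of them. *)
Lemma box_cnt_parallelogram N x y x' y' d : 0 < d -> 0 < y -> 0 < x' ->
  d + x * y' = x' * y -> x + x' < N -> y + y' < N ->
  box_cnt N (fun i j => [&& j * x <= i * y, i * y < d + j * x,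
    i * y' < j * x' & j * x' <= d + i * y']) = d.
Proof.
move=> d0 y0 x'0 Ed xN yN.
pose P i j := [&& j * x <= i * y, i * y < d + j * x, i * y' < j * x' & j * x' <= d + i * y'].
pose g := gcdn x y; have g0 : 0 < g by rewrite gcdn_gt0 y0 orbT.
have [x1 Ex] : exists x1, x = x1 * g by exists (x %/ g); rewrite divnK // dvdn_gcdl.
have [y1 Ey] : exists y1, y = y1 * g by exists (y %/ g); rewrite divnK // dvdn_gcdr.
have gz : gcdz x y = Posz g by [].
move: g g0 x1 Ex y1 Ey gz => g g0 x1 Ex y1 Ey gcdE.
have [h Eh] : exists h, d = h * g.
  exists (x' * y1 - x1 * y'); rewrite mulnBl; nia.
have h0 : 0 < h by case: h Eh d0 => // ->.
have Eh1 : h + x1 * y' = x' * y1 by apply/eqP; rewrite -(eqn_pmul2r g0); apply/eqP; nia.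
have [z1 [z2 Ez]] : exists z1 z2 : int, (z1 * y1%:Z - z2 * x1%:Z = 1)%R.
  have [u [v E]] := Bezoutz x y; exists v, (- u)%R.
  have gz : (g%:Z != 0)%R by rewrite -lt0n.
  apply: (mulIf gz); rewrite mul1r; rewrite -[RHS]gcdE -E.
  by rewrite [in RHS]Ex [in RHS]Ey !PoszM; ring.
(* The first component numbers the lines parallel to (x, y). Along a line j x' - i y' moves in steps
   of h and takes values from 1 to d = h g, so the quotient by h numbers its g points. *)
pose phi (u : nat * nat) := ((u.1 * y - u.2 * x) %/ g, (u.2 * x' - u.1 * y').-1 %/ h).
pose ind := [seq (m, k) | m <- iota 0 h, k <- iota 0 g].
have sz : size ind = h * g by rewrite size_allpairs !size_iota.
have memi m k : ((m, k) \in ind) = (m < h) && (k < g).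
  apply/allpairsP/andP => [[[a b] [/= +  + [-> ->]]]|[mh kg]].
    by rewrite !mem_iota.
  by exists (m, k); rewrite /= !mem_iota.
have uind : uniq ind.
  by rewrite allpairs_uniq ?iota_uniq // => -[? ?] [? ?] _ _ [-> ->].
have bez (D1 D2 : int) : (D1 * y1%:Z = D2 * x1%:Z -> exists t, D1 = t * x1%:Z /\ D2 = t * y1%:Z)%R.
  move=> E; exists (z1 * D2 - z2 * D1)%R; split.
    transitivity (D1 * (z1 * y1%:Z - z2 * x1%:Z))%R; first by rewrite Ez mulr1.
    transitivity (z1 * (D1 * y1%:Z) - z2 * D1 * x1%:Z)%R; first by ring.
    by rewrite E; ring.
  transitivity (D2 * (z1 * y1%:Z - z2 * x1%:Z))%R; first by rewrite Ez mulr1.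
  transitivity (z1 * D2 * y1%:Z - z2 * (D2 * x1%:Z))%R; first by ring.
  by rewrite -E; ring.
have PE i j : (i, j) \in box_pts N P -> exists m b,
    [/\ i * y1 = j * x1 + m, m < h, j * x' = i * y' + b.+1, b < d & phi (i, j) = (m, b %/ h)].
  rewrite mem_box_pts => /and3P[/and4P[H1 H2 H3 H4] _ _].
  have Hm : j * x1 <= i * y1 by rewrite -(leq_pmul2r g0); nia.
  have Em : i * y - j * x = (i * y1 - j * x1) * g by rewrite Ex Ey !mulnA -mulnBl.
  have Ha : (i * y1 - j * x1) * g < h * g by rewrite -Em -Eh; lia.
  have mh : i * y1 - j * x1 < h by rewrite ltn_pmul2r in Ha.
  exists (i * y1 - j * x1), (j * x' - i * y').-1; rewrite subnKC //; split=> //; try lia.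
  by rewrite /phi /= Em mulnK.
have -> : box_cnt N P = h * g; last by rewrite -Eh.
rewrite -size_box_pts -sz; apply/eqP; rewrite eqn_leq; apply/andP; split.
  rewrite -(size_map phi); apply: uniq_leq_size; last first.
    move=> _ /mapP[[i j] /PE[m [b [_ mh _ bd ->]]] ->]; rewrite memi mh /=.
    by rewrite ltn_divLR // mulnC -Eh.
  rewrite map_inj_in_uniq ?box_pts_uniq // => -[i j] [i' j'].
  move=> /PE[m [b [Em mh Eb bd ->]]] /PE[m' [b' [Em' mh' Eb' bd' ->]]] [mm bb].
  have [|t [Ei Ej]] := bez (i%:Z - i'%:Z)%R (j%:Z - j'%:Z)%R; first by nia.
  have Et : (t * h%:Z = b%:Z - b'%:Z)%R.
    have : (b%:Z - b'%:Z = (j%:Z - j'%:Z) * x'%:Z - (i%:Z - i'%:Z) * y'%:Z)%R by nia.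
    by rewrite Ei Ej => ->; have := congr1 Posz Eh1; rewrite PoszD !PoszM => /(canRL (addrK _)) ->; ring.
  have : (t = 0)%R.
    have := divn_eq b h; have := divn_eq b' h; rewrite -bb.
    have := ltn_pmod b h0; have := ltn_pmod b' h0 => L1 L2 E1 E2.
    have U1 : (t * h%:Z < 1 * h%:Z)%R by rewrite mul1r Et; lia.
    have U2 : (-1 * h%:Z < t * h%:Z)%R by rewrite mulN1r Et; lia.
    rewrite !ltr_pM2r // in U1 U2; lia.
  by move=> t0; rewrite t0 !mul0r in Ei Ej; congr (_, _); lia.
rewrite -(size_map phi (box_pts N P)); apply: uniq_leq_size => // -[m k]; rewrite memi => /andP[mh kg].
(* Surjectivity: m (z1, z2) is one integer point of the line m, and kk steps along (x1, y1) bring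
   the second determinant to 1 + r + k h. *)
pose w := (z2 * x'%:Z - z1 * y'%:Z)%R.
pose kk := (k%:Z - ((m%:Z * w - 1) %/ h%:Z)%Z)%R.
pose iz := (m%:Z * z1 + kk * x1%:Z)%R; pose jz := (m%:Z * z2 + kk * y1%:Z)%R.
have hz : (h%:Z != 0)%R by rewrite -lt0n.
pose r := ((m%:Z * w - 1) %% h%:Z)%Z.
have r0 : (0 <= r)%R by rewrite modz_ge0.
have rh : (r < h%:Z)%R by rewrite ltz_pmod.
have Ea : (iz * y1%:Z - jz * x1%:Z = m%:Z)%R.
  transitivity (m%:Z * (z1 * y1%:Z - z2 * x1%:Z))%R; last by rewrite Ez mulr1.
  by rewrite /iz /jz; ring.
have Eb : (jz * x'%:Z - iz * y'%:Z = 1 + r + k%:Z * h%:Z)%R.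
  transitivity (m%:Z * w + kk * h%:Z)%R.
    have := congr1 Posz Eh1; rewrite PoszD !PoszM => /(canRL (addrK _)) ->.
    by rewrite /iz /jz /w; ring.
  have := divz_eq (m%:Z * w - 1)%R h%:Z; rewrite -/r => E.
  transitivity ((m%:Z * w - 1) + 1 + kk * h%:Z)%R; first by ring.
  by rewrite {1}E /kk; ring.
have Edz : (d%:Z = x'%:Z * y%:Z - x%:Z * y'%:Z)%R by have := congr1 Posz Ed; rewrite PoszD !PoszM; lia.
have Exz : (x%:Z = x1%:Z * g%:Z)%R by rewrite Ex PoszM.
have Eyz : (y%:Z = y1%:Z * g%:Z)%R by rewrite Ey PoszM.
have Ei : (d%:Z * iz = (1 + r + k%:Z * h%:Z) * x%:Z + (m%:Z * g%:Z) * x'%:Z)%R.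
  by rewrite -Eb -Ea Edz Eyz Exz; ring.
have Ej : (d%:Z * jz = (1 + r + k%:Z * h%:Z) * y%:Z + (m%:Z * g%:Z) * y'%:Z)%R.
  by rewrite -Eb -Ea Edz Eyz Exz; ring.
have dz : (0 < d%:Z)%R by [].
have iz0 : (0 <= iz)%R.
  rewrite -(pmulr_rge0 _ dz) Ei addr_ge0 // mulr_ge0 // addr_ge0 // ?mulr_ge0 //; lia.
have jz0 : (0 <= jz)%R.
  rewrite -(pmulr_rge0 _ dz) Ej addr_ge0 // mulr_ge0 // addr_ge0 // ?mulr_ge0 //; lia.
move: iz jz r iz0 jz0 r0 rh Ea Eb Ei Ej => [i|//] [j|//] [r|//] _ _ _ rh Ea Eb Ei Ej {Edz Exz Eyz dz}.
have {rh} rh : r < h by lia.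
have {}Ea : i * y1 = j * x1 + m by lia.
have {}Eb : j * x' = i * y' + (r + k * h).+1 by lia.
have {}Ei : d * i = (r + k * h).+1 * x + (m * g) * x' by lia.
have {}Ej : d * j = (r + k * h).+1 * y + (m * g) * y' by lia.
have bd : r + k * h < d.
  have := leq_mul kg (leqnn h); rewrite Eh mulSn (mulnC h); apply: leq_trans.
  by rewrite ltn_add2r.
have ad : m * g < d by rewrite Eh ltn_pmul2r.
have iN : i < N.
  by apply: leq_ltn_trans xN; rewrite -(leq_pmul2l d0) Ei mulnDr leq_add // leq_mul // ltnW //.
have jN : j < N.
  by apply: leq_ltn_trans yN; rewrite -(leq_pmul2l d0) Ej mulnDr leq_add // leq_mul // ltnW //.
have Eay : i * y = j * x + m * g by rewrite Ex Ey !mulnA Ea mulnDl.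
apply/mapP; exists (i, j).
  rewrite mem_box_pts iN jN !andbT /P Eay Eb; apply/and4P; split; lia.
by rewrite /phi /= Eay Eb addKn mulnK // addKn /= divnDMl // divn_small // add0n.
Qed.

Section PolygonCount.
Variables (s D p q : nat) (vx vy al be : nat -> nat).
Hypothesis pol : polygon s D p q vx vy al be.
Local Notation nu := (nu s al be).
Local Notation ell := (ell al be).
Local Notation cone := (cone s vx vy).
Local Notation delta := (delta vx vy).

(** The ray of the vertex e is kept and that of e+1 dropped, so that these cones partition the
    points off the x-axis; the axis is counted separately. *)
Definition half_cone e i j :=
  [&& e < s, 0 < j, j * vx e <= i * vy e & i * vy e.+1 < j * vx e.+1].

Lemma half_cone_cone e i j : half_cone e i j -> cone e i j.
Proof. by case/and4P=> es _ H1 H2; rewrite /cone es H1 ltnW. Qed.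

Lemma half_cone_sum i j : (\sum_(e < s) half_cone e i j : nat) = (0 < j).
Proof.
case: (posnP j) => [->|j0].
  by apply: big1 => e _; rewrite /half_cone ltnn andbF.
have ex : exists e, (e < s) && (i * vy e.+1 < j * vx e.+1).
  exists s.-1; rewrite !(prednK (pol_s pol)) (pol_ys pol) (pol_xs pol) muln0 leqnn /=.
  by rewrite muln_gt0 j0 -(pol_xs pol) -(prednK (pol_s pol)) (vx_gt0 pol) // (prednK (pol_s pol)).
case: (ex_minnP ex) => e /andP[es He] min_e.
have hce : half_cone e i j.
  rewrite /half_cone es j0 He andbT /=.
  case: e es He min_e => [|e] es He min_e; first by rewrite (pol_x0 pol) muln0.
  rewrite leqNgt; apply/negP => K.
  by have := min_e e; rewrite K (ltnW es) ltnn => /(_ isT).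
rewrite (bigD1 (Ordinal es)) //= hce big1 // => e' ne.
apply/eqP; rewrite eqb0; apply/negP => /and4P[e's _ H1 H2].
have /min_e ee' : (e' < s) && (i * vy e'.+1 < j * vx e'.+1) by rewrite e's.
have {ne}lt : e < e' by rewrite ltn_neqAle ee' andbT; rewrite -val_eqE /= eq_sym in ne.
move: H1; apply/negP; rewrite -ltnNge.
have : forall m, e.+1 + m <= s -> i * vy (e.+1 + m) < j * vx (e.+1 + m).
  elim=> [|m IH] ms; first by rewrite addn0.
  rewrite addnS; rewrite addnS in ms; apply: (side_succ_lt pol) => //.
  by apply: ltnW; apply: IH; exact: ltnW.
by move=> /(_ (e' - e.+1)); rewrite subnKC //; apply; exact: ltnW.
Qed.

Let vx_leD m : m <= s -> vx m <= D.
Proof. by move=> ms; rewrite -(nu_vert pol ms) (leq_trans _ (nu_deg pol _ _)) ?leq_addr. Qed.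

Let vy_leD m : m <= s -> vy m <= D.
Proof. by move=> ms; rewrite -(nu_vert pol ms) (leq_trans _ (nu_deg pol _ _)) ?leq_addl. Qed.

(** [far] and [right] single out the points of the half-open cone that stay in it when the vertex e,
    respectively e+1, is subtracted. *)
Let far e i j := delta e + i * vy e.+1 < j * vx e.+1.
Let right e i j := delta e + j * vx e <= i * vy e.

Let half_cone_far e x y :
  half_cone e (x + vx e) (y + vy e) && far e (x + vx e) (y + vy e) = half_cone e x y.
Proof.
rewrite /half_cone; case: (ltnP e s) => //= es; have Ed := deltaE pol es.
rewrite !mulnDl (mulnC (vy e) (vx e)) leq_add2r /far !mulnDl.
have -> : (delta e + (x * vy e.+1 + vx e * vy e.+1) < y * vx e.+1 + vy e * vx e.+1)
  = (x * vy e.+1 < y * vx e.+1) by rewrite addnCA Ed (mulnC (vy e)) ltn_add2r.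
have -> : (0 < y + vy e) by rewrite addn_gt0 (vy_gt0 pol es) orbT.
case H : (x * vy e.+1 < y * vx e.+1); rewrite ?andbF // !andbT.
have -> : 0 < y by case: y H => //; rewrite mul0n.
have -> : x * vy e.+1 + vx e * vy e.+1 < y * vx e.+1 + vy e * vx e.+1.
  by have := leq_addl (delta e) (vx e * vy e.+1); rewrite Ed (mulnC (vy e)); lia.
by rewrite andbT.
Qed.

Let half_cone_right e x y :
  half_cone e (x + vx e.+1) (y + vy e.+1) && right e (x + vx e.+1) (y + vy e.+1)
  = half_cone e x y.
Proof.
rewrite /half_cone; case: (ltnP e s) => //= es; have Ed := deltaE pol es.
rewrite !mulnDl (mulnC (vy e.+1) (vx e.+1)) ltn_add2r /right !mulnDl.
have -> : (delta e + (y * vx e + vy e.+1 * vx e) <= x * vy e + vx e.+1 * vy e)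
  = (y * vx e <= x * vy e) by rewrite addnCA (mulnC (vy e.+1)) Ed leq_add2r.
case H1 : (y * vx e <= x * vy e); rewrite ?andbF // !andbT.
case H : (x * vy e.+1 < y * vx e.+1); rewrite ?andbF // !andbT.
have y0 : 0 < y by case: y H {H1} => //; rewrite mul0n.
rewrite addn_gt0 y0 /=.
by have := leq_addl (delta e) (vx e * vy e.+1); rewrite Ed; lia.
Qed.

Let nu_vertD e m x y : e < s -> m = e \/ m = e.+1 ->
  half_cone e x y -> half_cone e (x + vx m) (y + vy m) ->
  nu (x + vx m) (y + vy m) = nu x y + D.
Proof.
move=> es me /half_cone_cone co /half_cone_cone co'.
rewrite (cone_nu pol co) (cone_nu pol co') ellD.
by have [V0 V1] := ell_vert pol es; case: me => ->; rewrite ?V0 ?V1.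
Qed.

Let far_sub e i j : half_cone e i j -> far e i j -> (vx e <= i) && (vy e <= j).
Proof.
move=> hc f; have [|hx hy _] := cone_sub_vert pol (half_cone_cone hc) (or_introl erefl).
  by move=> a b Ea Eb; rewrite eqxx; move: f; rewrite /far; lia.
by rewrite hx hy.
Qed.

Let right_sub e i j : half_cone e i j -> right e i j -> (vx e.+1 <= i) && (vy e.+1 <= j).
Proof.
move=> hc f; have [|hx hy _] := cone_sub_vert pol (half_cone_cone hc) (or_intror erefl).
  by move=> a b Ea Eb; rewrite (gtn_eqF (ltnSn e)); move: f; rewrite /right; lia.
by rewrite hx hy.
Qed.

Let shift_far N m e : e < s -> m + D < N ->
  box_cnt N (fun i j => half_cone e i j && (nu i j < m + D) && far e i j) =
  box_cnt N (fun i j => half_cone e i j && (nu i j < m)).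
Proof.
move=> es mN; have x0 := vx_leD (ltnW es); have y0 := vy_leD (ltnW es).
rewrite -[RHS](@box_cnt_shift _ _ (vx e) (vy e)); last first.
  by move=> i j /andP[_ /(leq_ltn_trans (nu_deg pol i j))]; lia.
apply: eq_box_cnt => i j; case: (boolP ((vx e <= i) && (vy e <= j))); last first.
  rewrite andbA => /negPf ns; rewrite ns; apply/negP => /andP[/andP[hc _] /(far_sub hc)].
  by rewrite ns.
case/andP=> hx hy; rewrite hx hy /= -{1 2 3}(subnK hx) -{1 2 3}(subnK hy) andbAC half_cone_far.
case hc : (half_cone e _ _) => //=; have := hc; rewrite -half_cone_far => /andP[hc' _].
by rewrite (nu_vertD es _ hc hc') ?ltn_add2r //; left.
Qed.

Let shift_right N m e (Q : nat -> nat -> bool) : e < s -> m + D < N ->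
  (forall i j, Q (i + vx e.+1) (j + vy e.+1) = Q i j) ->
  box_cnt N (fun i j => half_cone e i j && (nu i j < m + D) && Q i j && right e i j) =
  box_cnt N (fun i j => half_cone e i j && (nu i j < m) && Q i j).
Proof.
move=> es mN QE; have x0 := vx_leD es; have y0 := vy_leD es.
rewrite -[RHS](@box_cnt_shift _ _ (vx e.+1) (vy e.+1)); last first.
  by move=> i j /andP[/andP[_ /(leq_ltn_trans (nu_deg pol i j))]]; lia.
apply: eq_box_cnt => i j; case: (boolP ((vx e.+1 <= i) && (vy e.+1 <= j))); last first.
  rewrite andbA => /negPf ns; rewrite ns.
  apply/negP => /andP[/andP[/andP[hc _] _] /(right_sub hc)].
  by rewrite ns.
case/andP=> hx hy; rewrite hx hy /= -{1 2 3 4}(subnK hx) -{1 2 3 4}(subnK hy) QE.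
rewrite -andbA [_ && right _ _ _]andbC !andbA [_ && right _ _ _]andbAC half_cone_right.
case hc : (half_cone e _ _) => //=; have := hc; rewrite -half_cone_right => /andP[hc' _].
by rewrite (nu_vertD es _ hc hc') ?ltn_add2r //; right.
Qed.

(** The second difference, with step D, of the number of points below a level. By inclusion and
    exclusion it counts the points of the cone that are translates by neither vertex: a half-open
    parallelogram of area delta e, lying entirely below level 2 D. *)
Lemma half_cone_cnt N n e : n + 2 * D < N -> e < s ->
  box_cnt N (fun i j => half_cone e i j && (nu i j < n + 2 * D)) +
  box_cnt N (fun i j => half_cone e i j && (nu i j < n)) =
  2 * box_cnt N (fun i j => half_cone e i j && (nu i j < n + D)) + delta e.
Proof.
move=> nN es; have D0 := D_gt0 pol.
have Ed := deltaE pol es; have d0 := delta_gt0 pol es.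
have [V0 V1] := ell_vert pol es.
have x0 := vx_leD (ltnW es); have y0 := vy_leD (ltnW es).
have x1 := vx_leD es; have y1 := vy_leD es.
rewrite (box_cnt_split _ (far e)) (_ : n + 2 * D = n + D + D); last by lia.
rewrite shift_far //; last by lia.
rewrite [X in _ + X + _](box_cnt_split _ (right e)).
rewrite (@shift_right _ _ _ (fun i j => ~~ far e i j)) //; first last.
- by move=> i j; rewrite /far !mulnDl addnA (mulnC (vy e.+1) (vx e.+1)) ltn_add2r.
- by lia.
rewrite -[box_cnt _ (fun i j => half_cone e i j && (nu i j < n))](@shift_far N) //; last by lia.
have E := box_cnt_split N (far e) (fun i j => half_cone e i j && (nu i j < n + D)).
suff : box_cnt N (fun i j => half_cone e i j && (nu i j < n + D + D) && ~~ far e i j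
   && ~~ right e i j) = delta e by move: E; lia.
rewrite -[RHS](@box_cnt_parallelogram N (vx e) (vy e) (vx e.+1) (vy e.+1)) //; first last.
- by lia.
- by lia.
- exact: (vx_gt0 pol).
- exact: (vy_gt0 pol).
apply: eq_box_cnt => i j; rewrite /half_cone es /far /right -leqNgt -ltnNge /=.
case H1 : (j * vx e <= i * vy e); rewrite ?andbF //=.
case H2 : (i * vy e.+1 < j * vx e.+1); rewrite ?andbF //=.
have j0 : 0 < j by case: j H2 {H1} => //; rewrite mul0n.
rewrite j0 /=.
case H3 : (j * vx e.+1 <= delta e + i * vy e.+1); rewrite ?andbF //=.
case H4 : (i * vy e < delta e + j * vx e); rewrite ?andbF //=.
have co : cone e i j by rewrite /cone es H1 ltnW.
rewrite !andbT (cone_nu pol co).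
have [a [b [Ea Eb Ei Ej]]] := cone_dec pol co.
rewrite -(ltn_pmul2l d0) (cone_ell _ _ es Ei Ej) V0 V1 -mulnDl.
have ab : b + a < 2 * delta e by lia.
apply: (@leq_trans (2 * delta e * D)); first by rewrite ltn_pmul2r.
by rewrite (mulnC 2) -mulnA leq_mul2l -addnA addnn -mul2n leq_addl orbT.
Qed.

Let nu_x i : nu (i + q) 0 = nu i 0 + D.
Proof.
have sE := prednK (pol_s pol).
have es : s.-1 < s by rewrite sE.
have co k : cone s.-1 k 0 by rewrite /cone es sE (pol_ys pol) mul0n muln0 /= mul0n.
rewrite !(cone_nu pol (co _)) -[X in ell _ _ X](addn0 0) ellD.
by have [_] := ell_vert pol es; rewrite sE (pol_xs pol) (pol_ys pol) => ->.
Qed.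

Let nu_y j : nu 0 (j + p) = nu 0 j + D.
Proof.
have es := pol_s pol.
have co k : cone 0 0 k by rewrite /cone es (pol_x0 pol) mul0n muln0.
rewrite !(cone_nu pol (co _)) -[X in ell _ X _](addn0 0) ellD.
by have [] := ell_vert pol es; rewrite (pol_x0 pol) (pol_y0 pol) => ->.
Qed.

Let q_le : q <= D.
Proof. by rewrite -(pol_xs pol) vx_leD. Qed.

Let p_le : p <= D.
Proof. by rewrite -(pol_y0 pol) vy_leD. Qed.

Let sum_leq N c : c < N -> \sum_(i < N) (0 < i <= c : nat) = c.
Proof.
elim: c N => [|c IH] N cN.
  by apply: big1 => i _; case: (nat_of_ord i).
rewrite (eq_bigr (fun i : 'I_N => (0 < i <= c) + (i == c.+1 :> nat) : nat)).
  rewrite big_split /= IH ?(ltnW cN) // (bigD1 (Ordinal cN)) //= eqxx big1 ?addn0 ?addn1 // => i.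
  by rewrite -val_eqE /= => /negPf ->.
by move=> i _; lia.
Qed.

Let axis_x_cnt N m : 0 < m -> m + D < N ->
  box_cnt N (fun i j => [&& 0 < i, j == 0 & nu i j < m + D]) =
  box_cnt N (fun i j => [&& 0 < i, j == 0 & nu i j < m]) + q.
Proof.
move=> m0 mN; have D0 := D_gt0 pol.
rewrite (box_cnt_split N (fun i j => q < i)); congr (_ + _).
  rewrite -[RHS](@box_cnt_shift _ _ q 0); last first.
    by move=> i j /and3P[_ _ /(leq_ltn_trans (nu_deg pol i j))]; have := q_le; lia.
  apply: eq_box_cnt => i j; case: (leqP q i) => [qi|iq]; last first.
    by rewrite (ltnNge q) (ltnW iq) andbF.
  rewrite /= subn0 subn_gt0; case: (eqVneq j 0) => [->|_]; last by rewrite !andbF.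
  by rewrite -{2}(subnK qi) nu_x ltn_add2r /=; lia.
rewrite -[RHS](@sum_leq N); last by have := q_le; lia.
apply: eq_bigr => i _; rewrite (@sum_ord_only _ N 0 (fun j => [&& 0 < i, j == 0 & nu i j < m + D] && ~~ (q < i) : nat)); last first.
  by move=> j _ /negPf ->; rewrite andbF.
rewrite (leq_ltn_trans _ mN) //= -leqNgt.
case: (leqP i q) => iq; rewrite ?andbF ?andbT //.
rewrite (leq_ltn_trans (nu_mono pol iq (leqnn 0))) ?andbT //.
by rewrite -(add0n q) nu_x ltn_add2r (leq_ltn_trans _ m0) // leqn0; have [e es ->] := nu_ex pol 0 0; rewrite /ell !muln0.
Qed.

Let axis_y_cnt N m : 0 < m -> m + D < N ->
  box_cnt N (fun i j => [&& i == 0, 0 < j & nu i j < m + D]) =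
  box_cnt N (fun i j => [&& i == 0, 0 < j & nu i j < m]) + p.
Proof.
move=> m0 mN; have D0 := D_gt0 pol.
rewrite (box_cnt_split N (fun i j => p < j)); congr (_ + _).
  rewrite -[RHS](@box_cnt_shift _ _ 0 p); last first.
    by move=> i j /and3P[_ _ /(leq_ltn_trans (nu_deg pol i j))]; have := p_le; lia.
  apply: eq_box_cnt => i j; case: (leqP p j) => [pj|jp]; last first.
    by rewrite (ltnNge p) (ltnW jp) andbF.
  rewrite /= subn0 subn_gt0; case: (eqVneq i 0) => [->|_] //=.
  by rewrite -{2}(subnK pj) nu_y ltn_add2r /=; lia.
rewrite /box_cnt exchange_big /= -[RHS](@sum_leq N); last by have := p_le; lia.
apply: eq_bigr => j _; rewrite (@sum_ord_only _ N 0 (fun i => [&& i == 0, 0 < j & nu i j < m + D] && ~~ (p < j) : nat)); last first.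
  by move=> i _ /negPf ->.
rewrite (leq_ltn_trans _ mN) //= -leqNgt.
case: (leqP j p) => jp; rewrite ?andbF ?andbT //.
rewrite (leq_ltn_trans (nu_mono pol (leqnn 0) jp)) ?andbT //.
by rewrite -(add0n p) nu_y ltn_add2r (leq_ltn_trans _ m0) // leqn0; have [e es ->] := nu_ex pol 0 0; rewrite /ell !muln0.
Qed.

(** The Euler characteristic of the truncated Koszul complex. The cones contribute the sum of the
    delta e, the origin contributes 1, and the axes, absent from the shifted sets, account for p and
    q. *)
Lemma polygon_cnt N n : 0 < n -> n + 2 * D < N ->
  box_cnt N (fun i j => nu i.+1 j.+1 < n + 2 * D) + box_cnt N (fun i j => nu i j < n) + p + q =
  box_cnt N (fun i j => nu i j.+1 < n + D) + box_cnt N (fun i j => nu i.+1 j < n + D)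
  + (\sum_(e < s) delta e).+1.
Proof.
move=> n0 nN; have D0 := D_gt0 pol.
pose Ez T := box_cnt N (fun i j => (0 < j) && (nu i j < T)).
have EzE T : Ez T = \sum_(e < s) box_cnt N (fun i j => half_cone e i j && (nu i j < T)).
  rewrite /box_cnt exchange_big /=; apply: eq_bigr => i _; rewrite exchange_big /=.
  apply: eq_bigr => j _; rewrite -mulnb -(half_cone_sum i j) big_distrl /=.
  by apply: eq_bigr => e _; rewrite mulnb.
have E2 : Ez (n + 2 * D) + Ez n = 2 * Ez (n + D) + \sum_(e < s) delta e.
  rewrite !EzE big_distrr -!big_split /=; apply: eq_bigr => e _; exact: half_cone_cnt.
have X := axis_x_cnt n0; have X' := X N.
have Y := @axis_y_cnt N (n + D); rewrite -addnA addnn -mul2n in Y.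
have W : box_cnt N (fun i j => nu i.+1 j.+1 < n + 2 * D) +
     box_cnt N (fun i j => [&& i == 0, 0 < j & nu i j < n + 2 * D]) = Ez (n + 2 * D).
  rewrite -(@box_cnt_shift _ _ 1 1); last first.
    by move=> i j /(leq_ltn_trans (nu_deg pol _ _)); lia.
  apply/esym/box_cntD => -[|i] [|j] //=.
  by rewrite !subn1 addn0.
have A : box_cnt N (fun i j => nu i j.+1 < n + D) = Ez (n + D).
  rewrite -(@box_cnt_shift _ _ 0 1); last first.
    by move=> i j /(leq_ltn_trans (nu_deg pol _ _)); lia.
  by apply: eq_box_cnt => i [|j] //=; rewrite subn0 subn1.
have B : box_cnt N (fun i j => nu i.+1 j < n + D) +
    box_cnt N (fun i j => [&& i == 0, 0 < j & nu i j < n + D]) =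
    Ez (n + D) + box_cnt N (fun i j => [&& 0 < i, j == 0 & nu i j < n + D]).
  rewrite -(@box_cnt_shift _ (fun i j => nu i.+1 j < n + D) 1 0); last first.
    by move=> i j /(leq_ltn_trans (nu_deg pol _ _)); lia.
  rewrite /Ez /box_cnt -!big_split /=; apply: eq_bigr => i _; rewrite -!big_split /=.
  apply: eq_bigr => j _; case: (nat_of_ord i) (nat_of_ord j) => [|i'] [|j'] //=.
  1-3: by rewrite ?subn1 ?subn0 ?addn0 ?add0n.
have Cn : box_cnt N (fun i j => nu i j < n) =
    Ez n + box_cnt N (fun i j => [&& 0 < i, j == 0 & nu i j < n]) + 1.
  have O : box_cnt N (fun i j => (i == 0) && (j == 0)) = 1.
    rewrite /box_cnt (@sum_ord_only _ N 0 (fun i => \sum_(j < N) ((i == 0) && (j == 0 :> nat)))); last first.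
      by move=> i _ /negPf ->; apply: big1.
    rewrite (leq_ltn_trans _ nN) // (@sum_ord_only _ N 0 (fun j => (0 == 0) && (j == 0) : nat)) //.
      by rewrite (leq_ltn_trans _ nN).
    by move=> j _ /negPf ->.
  rewrite -[X in _ = _ + X]O.
  rewrite /Ez /box_cnt -!big_split /=; apply: eq_bigr => i _; rewrite -!big_split /=.
  apply: eq_bigr => j _; case: (nat_of_ord i) (nat_of_ord j) => [|i'] [|j'] //=.
    by have [e es ->] := nu_ex pol 0 0; rewrite /ell !muln0 n0.
  1-3: by rewrite ?addn0.
have := X' _; have := Y _ _; lia.
Qed.

End PolygonCount.

Local Open Scope ring_scope.

(** * Truncated series as row vectors and the dimension of an exact sequence *)

Section FiniteSupport.
Variable K : fieldType.
Implicit Type l : seq (nat * nat).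

Definition fps2_of_row l (r : 'rV[K]_(size l)) : fps2 K := fun i j =>
  \sum_(k < size l) r 0 k * (nth (0%N, 0%N) l k == (i, j))%:R.

Definition row_of_fps2 l (f : fps2 K) : 'rV[K]_(size l) :=
  \row_k f (nth (0%N, 0%N) l k).1 (nth (0%N, 0%N) l k).2.

Lemma row_of_fps2P l f g : (forall i j, (i, j) \in l -> f i j = g i j) <->
  row_of_fps2 l f = row_of_fps2 l g.
Proof.
split=> [fg|/rowP fg i j].
  by apply/rowP => k; rewrite !mxE fg // -surjective_pairing mem_nth.
case/(nthP (0%N, 0%N)) => k kl E.
by have := fg (Ordinal kl); rewrite !mxE /= E.
Qed.

Lemma fps2_of_row_out l r i j : (i, j) \notin l -> fps2_of_row (l := l) r i j = 0.
Proof.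
move=> ijl; apply: big1 => k _; case: eqP => [E|]; last by rewrite mulr0.
by move: ijl; rewrite -E mem_nth.
Qed.

Lemma fps2_of_rowK l : uniq l -> cancel (@fps2_of_row l) (row_of_fps2 l).
Proof.
move=> ul r; apply/rowP => k; rewrite mxE /fps2_of_row -surjective_pairing (bigD1 k) //=.
rewrite eqxx mulr1 big1 ?addr0 // => k' kk'.
by rewrite nth_uniq // (negPf (_ : k' != k :> nat)) ?mulr0.
Qed.

Lemma row_of_fps2K l f i j : uniq l -> (i, j) \in l ->
  fps2_of_row (row_of_fps2 l f) i j = f i j.
Proof. by move=> ul; apply: (row_of_fps2P l _ f).2; exact: fps2_of_rowK. Qed.

Lemma fps2_of_row_lin l c r r' :
  fps2_of_row (l := l) (c *: r + r') = fps2_scale c (fps2_of_row r) + fps2_of_row r'.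
Proof.
apply: fps2P => i j; rewrite fps2DE fps2_scaleE mulr_sumr -big_split /=.
by apply: eq_bigr => k _; rewrite !mxE mulrDl mulrA.
Qed.

Lemma row_of_fps2_lin l c f g :
  row_of_fps2 l (fps2_scale c f + g) = c *: row_of_fps2 l f + row_of_fps2 l g.
Proof. by apply/rowP => k; rewrite !mxE. Qed.

End FiniteSupport.

Section KoszulMaps.
Variables (K : fieldType) (lA lB lC lW : seq (nat * nat)) (g h : fps2 K).

Definition koszul1 (C : 'rV[K]_(size lC)) : 'rV[K]_(size lA) * 'rV[K]_(size lB) :=
  (row_of_fps2 lA (fps2_of_row C * h), row_of_fps2 lB (- (fps2_of_row C * g))).

Definition koszul0 (AB : 'rV[K]_(size lA) * 'rV[K]_(size lB)) : 'rV[K]_(size lW) :=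
  row_of_fps2 lW (fps2_of_row AB.1 * g + fps2_of_row AB.2 * h).

Lemma koszul1_linear : linear koszul1.
Proof.
move=> c x y; rewrite /koszul1 fps2_of_row_lin; congr (_, _).
  by rewrite mulrDl fps2_scaleM row_of_fps2_lin.
rewrite mulrDl fps2_scaleM -row_of_fps2_lin; congr row_of_fps2.
by apply: fps2P => i j; rewrite fps2NE !fps2DE !fps2_scaleE !fps2NE mulrN opprD.
Qed.

Lemma koszul0_linear : linear koszul0.
Proof.
move=> c x y; rewrite /koszul0 !fps2_of_row_lin -row_of_fps2_lin; congr row_of_fps2.
rewrite !mulrDl !fps2_scaleM.
by apply: fps2P => i j; rewrite !fps2DE !fps2_scaleE !fps2DE mulrDr; ring.
Qed.

HB.instance Definition _ := GRing.isLinear.Build K _ _ _ koszul1 koszul1_linear.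
HB.instance Definition _ := GRing.isLinear.Build K _ _ _ koszul0 koszul0_linear.

(** The three premises say that C -> A + B -> W is injective on the left and exact in the middle;
    rank-nullity applied twice gives the dimension of the image in W. *)
Lemma koszul_dim :
  (forall C, koszul1 C = 0 -> C = 0) -> (forall C, koszul0 (koszul1 C) = 0) ->
  (forall AB, koszul0 AB = 0 -> exists C, AB = koszul1 C) ->
  (\dim (limg (linfun koszul0)) + size lC = size lA + size lB)%N.
Proof.
move=> inj cpx ex.
have d0 := limg_ker_dim (linfun koszul0) fullv; rewrite capfv in d0.
have d1 := limg_ker_dim (linfun koszul1) fullv; rewrite capfv in d1.
have k1 : lker (linfun koszul1) = 0%VS.
  apply/eqP; rewrite -subv0; apply/subvP => C; rewrite memv_ker lfunE /= => /eqP /inj ->.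
  exact: mem0v.
have k0 : lker (linfun koszul0) = limg (linfun koszul1).
  apply/eqP; rewrite eqEsubv; apply/andP; split; apply/subvP => AB.
    rewrite memv_ker lfunE /= => /eqP /ex[C ->].
    by rewrite -[koszul1 C](lfunE koszul1) memv_img ?memvf.
  by case/memv_imgP => C _ ->; rewrite memv_ker !lfunE /= cpx.
rewrite k1 dimv0 add0n !dimvf dim_matrix mul1r in d1.
rewrite k0 d1 !dimvf in d0; rewrite addnC d0.
have -> : dim ('rV[K]_(size lA) * 'rV[K]_(size lB))%type =
  (dim 'rV[K]_(size lA) + dim 'rV[K]_(size lB))%N by [].
by rewrite !dim_matrix !mul1r.
Qed.

End KoszulMaps.

(** * A basis of the Jacobian algebra truncated at a level *)

Section QuotientBasis.
Variables (K : numFieldType) (s D p q : nat) (vx vy al be : nat -> nat).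
Hypothesis pol : polygon s D p q vx vy al be.
Variable F : fps2 K.
Local Notation nu := (nu s al be).
Hypothesis F_ge : forall i j, F i j != 0 -> (D <= nu i j)%N.
Hypothesis F_eq : forall i j, F i j != 0 -> nu i j = D ->
  exists2 m, (m <= s)%N & (i, j) = (vx m, vy m).
Hypothesis F_vert : forall m, (m <= s)%N -> F (vx m) (vy m) != 0.
Local Notation dX := (fps2_dx F).
Local Notation dY := (fps2_dy F).

Definition fin_supp (f : fps2 K) := exists N, forall i j, f i j != 0 -> (i < N)%N /\ (j < N)%N.

Lemma fin_supp_row l r : fin_supp (@fps2_of_row K l r).
Proof.
exists (\max_(x <- l) (x.1 + x.2).+1)%N => i j f0.
have : (i, j) \in l by apply: contra_neqT f0; exact: fps2_of_row_out.
move=> /(@leq_bigmax_seq _ l xpredT (fun x => (x.1 + x.2).+1)%N) /(_ isT) /= H.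
by split; apply: leq_trans H; rewrite ltnS ?leq_addr ?leq_addl.
Qed.

(** Kouchnirenko's number: the sum is twice the area under the polygon, and p and q are its
    intercepts. When F fits the polygon the subtraction is exact, the value being the codimension
    computed in [dimWC]. *)
Definition polygon_mu := ((\sum_(e < s) delta vx vy e).+1 - p - q)%N.

Variable n : nat.
Hypothesis n_gt0 : (0 < n)%N.
(** The degree is at most [nu], so N bounds all four sets. Their levels drop by D at each stage of
    the complex, weighed after multiplication by x y, y, x and 1. *)
Let N := (n + 2 * D).+1.
Let lW := box_pts N (fun i j => nu i.+1 j.+1 < n + 2 * D)%N.
Let lA := box_pts N (fun i j => nu i j.+1 < n + D)%N.
Let lB := box_pts N (fun i j => nu i.+1 j < n + D)%N.
Let lC := box_pts N (fun i j => nu i j < n)%N.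

Let mem_l i j :
  [/\ ((i, j) \in lW) = (nu i.+1 j.+1 < n + 2 * D)%N,
      ((i, j) \in lA) = (nu i j.+1 < n + D)%N,
      ((i, j) \in lB) = (nu i.+1 j < n + D)%N
    & ((i, j) \in lC) = (nu i j < n)%N].
Proof.
have d1 := nu_deg pol i.+1 j.+1; have d2 := nu_deg pol i j.+1.
have d3 := nu_deg pol i.+1 j; have d4 := nu_deg pol i j.
by rewrite !mem_box_pts /N; split; apply/idP/idP => [/and3P[] //|lt]; rewrite lt /=; lia.
Qed.

Let uW : uniq lW. Proof. exact: box_pts_uniq. Qed.
Let uA : uniq lA. Proof. exact: box_pts_uniq. Qed.
Let uB : uniq lB. Proof. exact: box_pts_uniq. Qed.
Let uC : uniq lC. Proof. exact: box_pts_uniq. Qed.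

Let trunc l (f : fps2 K) : fps2 K := fps2_of_row (row_of_fps2 l f).

Let trunc_diff l (f : fps2 K) i j : uniq l -> (f - trunc l f) i j != 0 -> (i, j) \notin l.
Proof. by move=> ul; apply: contraNN => ijl; rewrite fps2BE /trunc row_of_fps2K // subrr. Qed.

(** The discarded terms of A and B have level at least n + D, and the derivatives of F add D, so
    nothing changes below n + 2 D. *)
Let trunc_ideal (A B : fps2 K) :
  row_of_fps2 lW (trunc lA A * dX + trunc lB B * dY) = row_of_fps2 lW (A * dX + B * dY).
Proof.
apply/row_of_fps2P => i j; have [-> _ _ _] := mem_l i j => lt.
apply/eqP; rewrite -subr_eq0 -fps2BE.
have -> : trunc lA A * dX + trunc lB B * dY - (A * dX + B * dY) =
  - ((A - trunc lA A) * dX + (B - trunc lB B) * dY) by ring.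
rewrite fps2NE oppr_eq0 fps2DE.
have -> : ((A - trunc lA A) * dX) i j = 0.
  apply: contraTeq lt => /(level_mul_dx pol F_ge (m := n + D)).
  rewrite -leqNgt mul2n -addnn addnA; apply => k l /(trunc_diff uA).
  by have [_ -> _ _] := mem_l k l; rewrite -leqNgt.
have -> : ((B - trunc lB B) * dY) i j = 0.
  apply: contraTeq lt => /(level_mul_dy pol F_ge (m := n + D)).
  rewrite -leqNgt mul2n -addnn addnA; apply => k l /(trunc_diff uB).
  by have [_ _ -> _] := mem_l k l; rewrite -leqNgt.
by rewrite addr0.
Qed.

Let Phi := koszul0 (lA := lA) (lB := lB) lW dX dY.
Let Psi := koszul1 (lC := lC) lA lB dX dY.

Let Psi_inj C : Psi C = 0 -> C = 0.
Proof.
case=> hA hB; rewrite -(fps2_of_rowK uC C).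
have r0 l : row_of_fps2 l (0 : fps2 K) = 0 by apply/rowP => k; rewrite !mxE.
rewrite -(r0 lA) in hA; rewrite -(r0 lB) in hB.
move/row_of_fps2P in hA; move/row_of_fps2P in hB.
have lv : level s al be n (fps2_of_row C).
  apply: (koszul_inj pol F_ge F_eq F_vert) => i j ij.
    by rewrite hA //; have [_ -> _ _] := mem_l i j.
  have := hB i j; have [_ _ -> _] := mem_l i j => /(_ ij) /eqP.
  by rewrite fps2NE oppr_eq0 => /eqP.
apply/esym; rewrite -(r0 lC); apply/row_of_fps2P => i j; have [_ _ _ ->] := mem_l i j => lt.
by apply/esym/eqP; apply: contraTT lt => /lv; rewrite -leqNgt.
Qed.

Let Phi_Psi C : Phi (Psi C) = 0.
Proof.
rewrite /Phi /koszul0 /= -/(trunc lA _) -/(trunc lB _) trunc_ideal.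
by apply/rowP => k; rewrite !mxE -[RHS](fps20E K 0 0) mulNr mulrAC subrr.
Qed.

Let Phi_ker AB : Phi AB = 0 -> exists C, AB = Psi C.
Proof.
move=> H; have [|C HC] := @koszul_exact K _ _ _ _ _ _ _ _ pol F F_ge F_eq F_vert (n + D)
    (fps2_of_row AB.1) (fps2_of_row AB.2).
  move=> i j; rewrite -addnA addnn -mul2n; have [<- _ _ _] := mem_l i j.
  move: i j; apply/row_of_fps2P.
  by rewrite [LHS]H; apply/rowP => k; rewrite !mxE.
exists (row_of_fps2 lC C); rewrite [AB]surjective_pairing; congr (_, _).
  rewrite -[LHS](fps2_of_rowK uA); apply/row_of_fps2P => i j.
  have [_ -> _ _] := mem_l i j => lt; rewrite (HC i j).1 //.
  apply/eqP; rewrite -subr_eq0 -fps2BE -mulrBl; apply: contraTT lt.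
  move/(level_dy pol F_ge (m := n)); rewrite -leqNgt; apply=> k l /(trunc_diff uC).
  by have [_ _ _ ->] := mem_l k l; rewrite -leqNgt.
rewrite -[LHS](fps2_of_rowK uB); apply/row_of_fps2P => i j.
have [_ _ -> _] := mem_l i j => lt; rewrite (HC i j).2 // fps2NE; congr (- _).
apply/eqP; rewrite -subr_eq0 -fps2BE -mulrBl; apply: contraTT lt.
move/(level_dx pol F_ge (m := n)); rewrite -leqNgt; apply=> k l /(trunc_diff uC).
by have [_ _ _ ->] := mem_l k l; rewrite -leqNgt.
Qed.

Let W := limg (linfun Phi).

Let dimWC : \dim (W^C)%VS = polygon_mu.
Proof.
have E := koszul_dim Psi_inj Phi_Psi Phi_ker; rewrite -/Phi -/W in E.
have nN : (n + 2 * D < N)%N by [].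
have cnt := polygon_cnt pol n_gt0 nN.
have sA : size lA = _ := size_box_pts _ _; have sB : size lB = _ := size_box_pts _ _.
have sC : size lC = _ := size_box_pts _ _; have sW : size lW = _ := size_box_pts _ _.
rewrite -sA -sB -sC -sW in cnt.
have le := dimvS (subvf W); rewrite dimvf dim_matrix mul1r in le.
rewrite dimv_compl dimvf dim_matrix mul1r /polygon_mu.
lia.
Qed.

(** The germs lift a basis of a complement of the ideal in the space of truncations. What matters
    later is that their number is the same for all n. *)
Lemma quotient_basis : exists e : 'I_polygon_mu -> fps2 K,
  [/\ forall k, fin_supp (e k),
      forall u, exists (a : 'I_polygon_mu -> K) A B, [/\ fin_supp A, fin_supp B &
        forall i j, (nu i.+1 j.+1 < n + 2 * D)%N ->
          u i j = \sum_k a k * e k i j + (A * dX + B * dY) i j]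
    & forall (a : 'I_polygon_mu -> K) A B,
        (forall i j, (nu i.+1 j.+1 < n + 2 * D)%N ->
          \sum_k a k * e k i j = (A * dX + B * dY) i j) -> forall k, a k = 0].
Proof.
rewrite -dimWC; set U := (W^C)%VS; pose b (k : 'I_(\dim U)) := (vbasis U)`_k.
have bE (a : 'I_(\dim U) -> K) i j : \sum_k a k * fps2_of_row (b k) i j =
    fps2_of_row (\sum_k a k *: b k) i j.
  rewrite /fps2_of_row.
  under eq_bigr do rewrite mulr_sumr.
  rewrite exchange_big /=; apply: eq_bigr => l _; rewrite summxE mulr_suml.
  by apply: eq_bigr => k _; rewrite mxE mulrA.
exists (fun k => fps2_of_row (b k)); split=> [k|u|a A B H].
- exact: fin_supp_row.
- have : row_of_fps2 lW u \in (W + U)%VS by rewrite addv_complf memvf.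
  case/memv_addP => w /memv_imgP[AB _ ->] [c cU E].
  exists (fun k => coord (vbasis U) k c), (fps2_of_row AB.1), (fps2_of_row AB.2).
  split; [exact: fin_supp_row..|] => i j; have [<- _ _ _] := mem_l i j => ijl.
  have -> : (fps2_of_row AB.1 * dX + fps2_of_row AB.2 * dY) i j = fps2_of_row (Phi AB) i j.
    by rewrite /Phi /koszul0 row_of_fps2K.
  have Eu : row_of_fps2 lW u = 1 *: c + Phi AB by rewrite E lfunE scale1r addrC.
  transitivity (fps2_of_row (1 *: c + Phi AB) i j).
    by rewrite -Eu row_of_fps2K.
  rewrite fps2_of_row_lin fps2DE fps2_scaleE mul1r; congr (_ + _).
  by rewrite bE; congr (fps2_of_row _ i j); exact: coord_vbasis.
have E : \sum_k a k *: b k = Phi (row_of_fps2 lA A, row_of_fps2 lB B).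
  rewrite /Phi /koszul0 /= -/(trunc lA A) -/(trunc lB B) trunc_ideal.
  rewrite -[LHS](fps2_of_rowK uW); apply/row_of_fps2P => i j.
  by have [-> _ _ _] := mem_l i j => /H <-; rewrite -bE.
have : \sum_k a k *: b k \in (W :&: U)%VS.
  rewrite memv_cap; apply/andP; split.
    by rewrite E -[Phi _](lfunE Phi) memv_img ?memvf.
  apply: memv_suml => k _; apply: memvZ; apply: vbasis_mem.
  apply: mem_nth; exact: leq_trans (ltn_ord k) (eq_leq (esym (size_tuple _))).
rewrite capv_compl memv0 => /eqP; apply/freeP.
exact: basis_free (vbasisP U).
Qed.

End QuotientBasis.

Section DeepIdeal.
Variables (K : numFieldType) (s D p q : nat) (vx vy al be : nat -> nat).
Hypothesis pol : polygon s D p q vx vy al be.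
Variable F : fps2 K.
Local Notation nu := (nu s al be).
Hypothesis F_ge : forall i j, F i j != 0 -> (D <= nu i j)%N.
Hypothesis F_eq : forall i j, F i j != 0 -> nu i j = D ->
  exists2 m, (m <= s)%N & (i, j) = (vx m, vy m).
Hypothesis F_vert : forall m, (m <= s)%N -> F (vx m) (vy m) != 0.
Local Notation dX := (fps2_dx F).
Local Notation dY := (fps2_dy F).
Local Notation mu0 := (polygon_mu s p q vx vy).

Let idl T (f : fps2 K) := exists A B, forall i j, (nu i.+1 j.+1 < T)%N -> f i j = (A * dX + B * dY) i j.

Let idl0 T : idl T 0.
Proof. by exists 0, 0 => i j _; rewrite !mul0r addr0. Qed.

Let idlD T f g : idl T f -> idl T g -> idl T (f + g).
Proof.
move=> [A [B H]] [A' [B' H']]; exists (A + A'), (B + B') => i j ij.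
by rewrite !mulrDl addrACA fps2DE H // H'.
Qed.

Let idlZ T c f : idl T f -> idl T (fps2_scale c f).
Proof.
move=> [A [B H]]; exists (fps2_scale c A), (fps2_scale c B) => i j ij.
by rewrite !fps2_scaleM fps2DE !fps2_scaleE H // fps2DE mulrDr.
Qed.

Let idl_sum T m (a : 'I_m -> K) (f : 'I_m -> fps2 K) :
  (forall k, idl T (f k)) -> idl T (\sum_k fps2_scale (a k) (f k)).
Proof. by move=> H; elim/big_ind: _ => *; [exact: idl0 | exact: idlD | exact: idlZ]. Qed.

Let idl_le T T' f : (T <= T')%N -> idl T' f -> idl T f.
Proof. by move=> TT [A [B H]]; exists A, B => i j ij; apply: H; exact: leq_trans TT. Qed.

(* The dimension of the quotient does not depend on the level n, so that the
   ideals cut out at the levels n and n' agree. *)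
Lemma ideal_deep n n' u : (0 < n)%N -> (n <= n')%N ->
  (forall i j, (nu i.+1 j.+1 < n + 2 * D)%N -> u i j = 0) ->
  exists A B, [/\ fin_supp A, fin_supp B &
    forall i j, (nu i.+1 j.+1 < n' + 2 * D)%N -> u i j = (A * dX + B * dY) i j].
Proof.
move=> n0 nn' u0; have n'0 := leq_trans n0 nn'.
have TT : (n + 2 * D <= n' + 2 * D)%N by rewrite leq_add2r.
have [e [fe spe inde]] := quotient_basis pol F_ge F_eq F_vert n0.
have [e' [fe' spe' inde']] := quotient_basis pol F_ge F_eq F_vert n'0.
have ind (a : 'I_mu0 -> K) : idl (n + 2 * D) (\sum_k fps2_scale (a k) (e k)) -> forall k, a k = 0.
  move=> [A [B H]]; apply: (inde a A B) => i j ij; rewrite -H // fps2_sumE.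
  by apply: eq_bigr.
have ex1 k : exists M : 'I_mu0 -> K,
    idl (n + 2 * D) (e' k - \sum_l fps2_scale (M l) (e l)).
  have [a [A [B [_ _ H]]]] := spe (e' k); exists a, A, B => i j ij.
  by rewrite fps2BE H // fps2_sumE addrC addrA [X in X + _]addNr add0r.
have ex2 k : exists M : 'I_mu0 -> K,
    idl (n + 2 * D) (e k - \sum_l fps2_scale (M l) (e' l)).
  have [a [A [B [_ _ H]]]] := spe' (e k); exists a; apply: (idl_le TT); exists A, B => i j ij.
  by rewrite fps2BE H // fps2_sumE addrC addrA [X in X + _]addNr add0r.
have [M HM] := choice ex1; have [M' HM'] := choice ex2.
have comb (a : 'I_mu0 -> K) : idl (n + 2 * D) (\sum_k fps2_scale (a k) (e' k)) ->
    forall l, \sum_k a k * M k l = 0.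
  move=> Ha l; apply: (ind (fun l => \sum_k a k * M k l)).
  have -> : \sum_l fps2_scale (\sum_k a k * M k l) (e l) =
     \sum_k fps2_scale (a k) (e' k) +
     \sum_k fps2_scale (- a k) (e' k - \sum_l fps2_scale (M k l) (e l)).
    apply: fps2P => i j; rewrite fps2DE !fps2_sumE -big_split /=.
    under eq_bigr do rewrite fps2_scaleE mulr_suml.
    rewrite exchange_big /=; apply: eq_bigr => k _.
    rewrite !fps2_scaleE fps2BE fps2_sumE mulrBr mulNr addrA subrr add0r mulNr opprK mulr_sumr.
    by apply: eq_bigr => m _; rewrite fps2_scaleE mulrA.
  by apply: idlD => //; apply: idl_sum.
(* Both families have [mu0] members, so M' M = 1 makes the square matrix M invertible: the finer
   basis e' is still independent modulo the coarser level. *)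
have MM l m : \sum_k M' l k * M k m = (l == m)%:R.
  apply/eqP; rewrite -subr_eq0; apply/eqP.
  apply: (ind (fun m => \sum_k M' l k * M k m - (l == m)%:R)).
  have -> : \sum_m fps2_scale (\sum_k M' l k * M k m - (l == m)%:R) (e m) =
     fps2_scale (-1) (e l - \sum_k fps2_scale (M' l k) (e' k)) +
     \sum_k fps2_scale (- M' l k) (e' k - \sum_m fps2_scale (M k m) (e m)).
    apply: fps2P => i j; rewrite fps2DE !fps2_sumE fps2_scaleE fps2BE fps2_sumE.
    under eq_bigr do rewrite fps2_scaleE mulrBl mulr_suml.
    rewrite big_split /= exchange_big /= sumrN.
    rewrite [X in _ - X](bigD1 l) //= eqxx mul1r [X in _ - (_ + X)]big1 => [|k kl]; last first.
      by rewrite eq_sym (negPf kl) mul0r.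
    rewrite addr0 mulN1r opprB addrAC -big_split /=; congr (_ - _).
    apply: eq_bigr => k _; rewrite !fps2_scaleE fps2BE fps2_sumE mulrBr mulNr addrA subrr add0r.
    by rewrite mulNr opprK mulr_sumr; apply: eq_bigr => m' _; rewrite fps2_scaleE mulrA.
  by apply: idlD; [exact: idlZ | exact: idl_sum].
have [a [A [B [fA fB H]]]] := spe' u.
(* At the coarser level u is zero, so its coordinates on e' give a dependency there. *)
have aM : forall l, \sum_k a k * M k l = 0.
  apply: comb; exists (- A), (- B) => i j ij; have := H i j (leq_trans ij TT).
  rewrite u0 // !mulNr -opprD fps2NE => /eqP; rewrite eq_sym addr_eq0 => /eqP <-.
  by rewrite fps2_sumE; apply: eq_bigr.
have a0 k : a k = 0.
  pose Mx := \matrix_(k, l) M k l; pose Mx' := \matrix_(k, l) M' k l.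
  have MxE : Mx' *m Mx = 1%:M.
    by apply/matrixP => l m; rewrite !mxE -MM; apply: eq_bigr => k' _; rewrite !mxE.
  pose av := \row_k a k.
  have av0 : av *m Mx = 0.
    by apply/rowP => l; rewrite !mxE -[RHS](aM l); apply: eq_bigr => k' _; rewrite !mxE.
  have : av = 0 by rewrite -(mulmx1 av) -(mulmx1C MxE) mulmxA av0 mul0mx.
  by move/rowP/(_ k); rewrite !mxE.
exists A, B; split=> // i j ij; rewrite H // big1 ?add0r // => k _.
by rewrite a0 mul0r.
Qed.

End DeepIdeal.

(** * Weighted l1 bounds *)

Section TriangularSums.
Variable V : nmodType.

Lemma sum_triangle n (X : nat -> nat -> V) :
  \sum_(i < n) \sum_(k < i.+1) X k (i - k)%N =
  \sum_(k < n) \sum_(l < n) (if (k + l < n)%N then X k l else 0).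
Proof.
have -> : \sum_(i < n) \sum_(k < i.+1) X k (i - k)%N =
    \sum_(i < n) \sum_(k < n) \sum_(l < n) (if (l == (i - k)%N :> nat) && (k <= i)%N then X k l else 0).
  apply: eq_bigr => i _.
  rewrite (big_ord_widen n (fun k => X k (i - k)%N)) // big_mkcond /=; apply: eq_bigr => k _.
  rewrite ltnS (@sum_ord_only _ n (i - k)%N (fun l => if (l == (i - k)%N) && (k <= i)%N then X k l else 0)).
    by rewrite (leq_ltn_trans (leq_subr _ _)) // eqxx.
  by move=> l _ /negPf ->.
rewrite exchange_big /=; apply: eq_bigr => k _; rewrite exchange_big /=; apply: eq_bigr => l _.
rewrite (@sum_ord_only _ n (k + l)%N (fun i => if (l == (i - k)%N :> nat) && (k <= i)%N then X k l else 0)).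
  by case: ifP => // _; rewrite addKn eqxx leq_addr.
by move=> i _ ne; case: ifP => // /andP[/eqP lE ki]; case/eqP: ne; rewrite lE subnKC.
Qed.

Lemma sum_triangle2 n (X : nat -> nat -> nat -> nat -> V) :
  \sum_(i < n) \sum_(j < n) \sum_(k < i.+1) \sum_(l < j.+1) X k (i - k)%N l (j - l)%N =
  \sum_(k < n) \sum_(k' < n) \sum_(l < n) \sum_(l' < n)
    (if (k + k' < n)%N && (l + l' < n)%N then X k k' l l' else 0).
Proof.
under eq_bigr => i _ do rewrite exchange_big /=.
rewrite (sum_triangle n (fun k k' => \sum_(j < n) \sum_(l < j.+1) X k k' l (j - l)%N)).
apply: eq_bigr => k _; apply: eq_bigr => k' _; case: ifP => _ /=.
  exact: (sum_triangle n (fun l l' => X k k' l l')).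
by rewrite big1 // => l _; rewrite big1.
Qed.

End TriangularSums.

Section Bounds.
Variable K : numFieldType.
Implicit Types (f g : fps2 K) (x y M N : K).

Definition psum x y f n := \sum_(i < n) \sum_(j < n) f i j * x ^+ i * y ^+ j.
(** The weighted l1 norm is at most M, stated through finite sums so that no limit in [K] is
    needed. *)
Definition bnd x y f M :=
  forall n, \sum_(i < n) \sum_(j < n) `|f i j| * (x ^+ i * y ^+ j) <= M.

Lemma psumM x y f g n : psum x y f n * psum x y g n =
  \sum_(k < n) \sum_(k' < n) \sum_(l < n) \sum_(l' < n)
   (f k l * g k' l') * x ^+ (k + k') * y ^+ (l + l').
Proof.
rewrite /psum mulr_suml; apply: eq_bigr => k _.
rewrite mulr_sumr; apply: eq_bigr => k' _.
rewrite mulr_suml; apply: eq_bigr => l _.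
rewrite mulr_sumr; apply: eq_bigr => l' _.
by rewrite !exprD; ring.
Qed.

Lemma psum_mul x y f g n : psum x y (f * g) n =
  \sum_(k < n) \sum_(k' < n) \sum_(l < n) \sum_(l' < n)
   (if (k + k' < n)%N && (l + l' < n)%N then (f k l * g k' l') * x ^+ (k + k') * y ^+ (l + l')
    else 0).
Proof.
rewrite -(sum_triangle2 n (fun k k' l l' => (f k l * g k' l') * x ^+ (k + k') * y ^+ (l + l'))).
apply: eq_bigr => i _; apply: eq_bigr => j _; rewrite fps2ME !mulr_suml.
apply: eq_bigr => k _; rewrite !mulr_suml; apply: eq_bigr => l _ /=.
by rewrite !subnKC // -ltnS.
Qed.

Definition fps2_norm f : fps2 K := fun i j => `|f i j|.

Lemma bndE x y f M : bnd x y f M <-> forall n, psum x y (fps2_norm f) n <= M.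
Proof.
have E n : psum x y (fps2_norm f) n = \sum_(i < n) \sum_(j < n) `|f i j| * (x ^+ i * y ^+ j).
  by apply: eq_bigr => i _; apply: eq_bigr => j _; rewrite -mulrA.
by split=> H n; [rewrite E|rewrite -E]; exact: H.
Qed.

Lemma psum_norm_ge0 x y f n : 0 <= x -> 0 <= y -> 0 <= psum x y (fps2_norm f) n.
Proof.
by move=> x0 y0; apply: sumr_ge0 => i _; apply: sumr_ge0 => j _; rewrite /fps2_norm !mulr_ge0 ?exprn_ge0.
Qed.

Lemma bnd_ge0 x y f M : bnd x y f M -> 0 <= M.
Proof. by move/(_ 0%N); rewrite big_ord0. Qed.

Lemma bnd_le x y x' y' f g M : 0 <= x' <= x -> 0 <= y' <= y ->
  (forall i j, `|g i j| <= `|f i j|) -> bnd x y f M -> bnd x' y' g M.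
Proof.
move=> /andP[x0 xx] /andP[y0 yy] gf Hf n; apply: le_trans (Hf n).
apply: ler_sum => i _; apply: ler_sum => j _.
by rewrite ler_pM ?mulr_ge0 ?exprn_ge0 // ler_pM ?exprn_ge0 // lerXn2r ?nnegrE // (le_trans _ xx, le_trans _ yy).
Qed.

Lemma bndD x y f g M N : 0 <= x -> 0 <= y -> bnd x y f M -> bnd x y g N ->
  bnd x y (f + g) (M + N).
Proof.
move=> x0 y0 Hf Hg n; apply: le_trans (lerD (Hf n) (Hg n)); rewrite -big_split /=.
apply: ler_sum => i _; rewrite -big_split /=; apply: ler_sum => j _.
by rewrite -mulrDl ler_wpM2r ?mulr_ge0 ?exprn_ge0 // fps2DE ler_normD.
Qed.

Lemma bndZ x y c f M : bnd x y f M -> bnd x y (fps2_scale c f) (`|c| * M).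
Proof.
move=> Hf n; apply: le_trans (ler_wpM2l (normr_ge0 c) (Hf n)); rewrite mulr_sumr.
apply: ler_sum => i _; rewrite mulr_sumr; apply: ler_sum => j _.
by rewrite fps2_scaleE normrM -mulrA.
Qed.

Lemma bndN x y f M : bnd x y f M -> bnd x y (- f) M.
Proof.
move=> Hf n; apply: le_trans (Hf n); apply: ler_sum => i _; apply: ler_sum => j _.
by rewrite fps2NE normrN.
Qed.

Lemma bnd_weaken x y f M N : M <= N -> bnd x y f M -> bnd x y f N.
Proof. by move=> MN Hf n; exact: le_trans (Hf n) MN. Qed.

Lemma bndM x y f g M N : 0 <= x -> 0 <= y -> bnd x y f M -> bnd x y g N ->
  bnd x y (f * g) (M * N).
Proof.
move=> x0 y0 Hf Hg n.
apply: (@le_trans _ _ (psum x y (fps2_norm f * fps2_norm g) n)).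
  apply: ler_sum => i _; apply: ler_sum => j _.
  rewrite -[leRHS]mulrA ler_wpM2r ?mulr_ge0 ?exprn_ge0 // !fps2ME.
  apply: le_trans (ler_norm_sum _ _ _) _; apply: ler_sum => k _.
  apply: le_trans (ler_norm_sum _ _ _) _; apply: ler_sum => l _.
  by rewrite normrM.
move/bndE in Hf; move/bndE in Hg.
apply: (@le_trans _ _ (psum x y (fps2_norm f) n * psum x y (fps2_norm g) n)).
  rewrite psum_mul psumM; do 4!apply: ler_sum => ? _.
  by rewrite /fps2_norm; case: ifP => // _; rewrite !mulr_ge0 ?exprn_ge0.
by rewrite ler_pM ?psum_norm_ge0.
Qed.

Lemma bnd_coef x y f M i j : 0 <= x -> 0 <= y -> bnd x y f M ->
  `|f i j| * (x ^+ i * y ^+ j) <= M.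
Proof.
move=> x0 y0 /(_ (maxn i j).+1); apply: le_trans.
have iN : (i < (maxn i j).+1)%N by rewrite ltnS leq_maxl.
have jN : (j < (maxn i j).+1)%N by rewrite ltnS leq_maxr.
rewrite (bigD1 (Ordinal iN)) //= (bigD1 (Ordinal jN)) //= -addrA lerDl addr_ge0 //.
  by apply: sumr_ge0 => l _; rewrite !mulr_ge0 ?exprn_ge0.
by apply: sumr_ge0 => k _; apply: sumr_ge0 => l _; rewrite !mulr_ge0 ?exprn_ge0.
Qed.

Lemma bnd_shift x y f g m n M : 0 < x -> 0 < y ->
  (forall i j, `|g i j| <= `|f (i + m)%N (j + n)%N|) ->
  bnd x y f M -> bnd x y g (M / (x ^+ m * y ^+ n)).
Proof.
move=> x0 y0 gf Hf k; rewrite ler_pdivlMr ?mulr_gt0 ?exprn_gt0 //.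
apply: le_trans (Hf (k + (m + n))%N).
rewrite mulr_suml.
apply: (@le_trans _ _ (\sum_(i < k) \sum_(j < k) `|f (i + m)%N (j + n)%N| * (x ^+ (i + m) * y ^+ (j + n)))).
  apply: ler_sum => i _; rewrite mulr_suml; apply: ler_sum => j _.
  rewrite -mulrA mulrACA -!exprD ler_wpM2r // mulr_ge0 ?exprn_ge0 // ltW //.
pose G i j := `|f i j| * (x ^+ i * y ^+ j).
have G0 i j : 0 <= G i j by rewrite !mulr_ge0 ?exprn_ge0 // ltW.
have mono (u : nat -> K) a c d : (forall i, 0 <= u i) ->
    \sum_(i < c) u (i + a)%N <= \sum_(i < c + (a + d)) u i.
  move=> u0; rewrite addnA big_split_ord /= (addnC c) big_split_ord /= addrAC.
  under eq_bigr do rewrite addnC.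
  by rewrite lerDr addr_ge0 // sumr_ge0.
apply: (@le_trans _ _ (\sum_(i < k) \sum_(j < k + (m + n)) G (i + m)%N j)).
  by apply: ler_sum => i _; rewrite (addnC m); apply: (mono (G (i + m)%N)).
by apply: (mono (fun i => \sum_(j < k + (m + n)) G i j)) => i; apply: sumr_ge0.
Qed.

Lemma bnd_fin_supp x y f : 0 <= x -> 0 <= y -> fin_supp f -> exists M, bnd x y f M.
Proof.
move=> x0 y0 [N HN]; exists (\sum_(i < N) \sum_(j < N) `|f i j| * (x ^+ i * y ^+ j)) => n.
pose G i j := `|f i j| * (x ^+ i * y ^+ j).
have G0 i j : 0 <= G i j by rewrite !mulr_ge0 ?exprn_ge0.
have mono (u : nat -> K) : (forall i, 0 <= u i) -> (forall i, (N <= i)%N -> u i = 0) ->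
    \sum_(i < n) u i <= \sum_(i < N) u i.
  move=> u0 uN; case: (leqP n N) => [/subnKC <-|/ltnW /subnKC <-].
    by rewrite big_split_ord /= lerDl sumr_ge0.
  rewrite big_split_ord /= [X in _ + X <= _]big1 ?addr0 // => i _.
  by rewrite uN ?leq_addr.
apply: (@le_trans _ _ (\sum_(i < n) \sum_(j < N) G i j)).
  apply: ler_sum => i _; apply: (mono (G i)) => // j Nj; rewrite /G.
  case: (eqVneq (f i j) 0) => [->|/HN [_]]; first by rewrite normr0 mul0r.
  by rewrite ltnNge Nj.
apply: (mono (fun i => \sum_(j < N) G i j)) => [i|i Ni]; first exact: sumr_ge0.
apply: big1 => j _; rewrite /G; case: (eqVneq (f i j) 0) => [->|/HN [+ _]].
  by rewrite normr0 mul0r.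
by rewrite ltnNge Ni.
Qed.

(** Halving the radius pays for the factor i + 1 <= 2^i of the derivative; the quotient by x
    accounts for the shift. *)
Lemma bnd_dx x y f M : 0 < x -> 0 < y -> bnd x y f M -> bnd (x / 2) y (fps2_dx f) (M / x).
Proof.
move=> x0 y0 Hf.
have H2 n : (n.+1%:R : K) <= 2 ^+ n by rewrite -natrX ler_nat ltn_expl.
have -> : M / x = M / (x ^+ 1 * y ^+ 0) by rewrite expr1 expr0 mulr1.
pose g : fps2 K := fun i j => f i.+1 j.
have Hg : bnd x y g (M / (x ^+ 1 * y ^+ 0)).
  by apply: bnd_shift Hf => // i j; rewrite /g addn1 addn0.
move=> n; apply: le_trans (Hg n); apply: ler_sum => i _; apply: ler_sum => j _.
rewrite /fps2_dx /g normrMn expr_div_n -[X in X * _ <= _]mulr_natr -!mulrA ler_wpM2l //.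
have -> : i.+1%:R * (x ^+ i * ((2 ^+ i)^-1 * y ^+ j)) = i.+1%:R / 2 ^+ i * (x ^+ i * y ^+ j) by ring.
apply: ler_piMl; first by rewrite mulr_ge0 ?exprn_ge0 // ltW.
by rewrite ler_pdivrMr ?exprn_gt0 // mul1r.
Qed.

Lemma bnd_tr x y f M : bnd x y f M -> bnd y x (fun i j => f j i) M.
Proof.
move=> Hf n; apply: le_trans (Hf n); rewrite [leRHS]exchange_big /=.
by apply: ler_sum => i _; apply: ler_sum => j _; rewrite [y ^+ i * _]mulrC.
Qed.

Lemma bnd_dy x y f M : 0 < x -> 0 < y -> bnd x y f M -> bnd x (y / 2) (fps2_dy f) (M / y).
Proof. by move=> x0 y0 Hf; apply: (bnd_tr (bnd_dx y0 x0 (bnd_tr Hf))). Qed.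

End Bounds.

(** * The ring of convergent germs *)

Section Convergent.
Variable K : numFieldType.
Implicit Types f g h u : fps2 K.

Definition conv f := exists2 r : K, 0 < r & exists M, bnd r r f M.

Lemma conv_bnd2 f g : conv f -> conv g ->
  exists2 r : K, 0 < r & (exists M, bnd r r f M) /\ (exists M, bnd r r g M).
Proof.
move=> [r r0 [M HM]] [t t0 [N HN]]; have rt : 0 < r + t by rewrite addr_gt0.
(* The order of [K] is only partial, so r t / (r + t) stands in for the minimum of r and t. *)
have c0 : 0 < r * t / (r + t) by rewrite divr_gt0 ?mulr_gt0.
exists (r * t / (r + t)) => //.
have r1 : 0 <= r * t / (r + t) <= r.
  by rewrite (ltW c0) /= ler_pdivrMr // ler_wpM2l ?lerDr ?(ltW r0).
have t1 : 0 <= r * t / (r + t) <= t.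
  by rewrite (ltW c0) /= ler_pdivrMr // mulrC ler_wpM2l ?lerDl ?(ltW t0).
by split; [exists M; apply: bnd_le HM | exists N; apply: bnd_le HN].
Qed.

Lemma convD f g : conv f -> conv g -> conv (f + g).
Proof.
move=> cf cg; have [r r0 [[M HM] [N HN]]] := conv_bnd2 cf cg.
by exists r => //; exists (M + N); apply: bndD => //; exact: ltW.
Qed.

Lemma convM f g : conv f -> conv g -> conv (f * g).
Proof.
move=> cf cg; have [r r0 [[M HM] [N HN]]] := conv_bnd2 cf cg.
by exists r => //; exists (M * N); apply: bndM => //; exact: ltW.
Qed.

Lemma convN f : conv f -> conv (- f).
Proof. by move=> [r r0 [M HM]]; exists r => //; exists M; exact: bndN. Qed.

Lemma convB f g : conv f -> conv g -> conv (f - g).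
Proof. by move=> cf cg; apply: convD => //; exact: convN. Qed.

Lemma convZ c f : conv f -> conv (fps2_scale c f).
Proof. by move=> [r r0 [M HM]]; exists r => //; exists (`|c| * M); exact: bndZ. Qed.

Lemma conv_fin f : fin_supp f -> conv f.
Proof. by move=> ff; exists 1 => //; apply: bnd_fin_supp. Qed.

Lemma fin_supp_mon m n : fin_supp (fps2_mon K m n).
Proof.
exists (maxn m n).+1 => i j; rewrite /fps2_mon.
case: (eqVneq i m) => [->|_] /=; last by rewrite eqxx.
case: (eqVneq j n) => [->|_] /=; last by rewrite eqxx.
by rewrite !ltnS leq_maxl leq_maxr.
Qed.

Lemma conv_mon m n : conv (fps2_mon K m n).
Proof. exact/conv_fin/fin_supp_mon. Qed.

Lemma conv_shift m n f g : (forall i j, `|g i j| <= `|f (i + m)%N (j + n)%N|) -> conv f -> conv g.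
Proof. by move=> gf [r r0 [M HM]]; exists r => //; exists (M / (r ^+ m * r ^+ n)); exact: bnd_shift HM. Qed.

Lemma conv_dx f : conv f -> conv (fps2_dx f).
Proof.
move=> [r r0 [M HM]]; exists (r / 2); first by rewrite divr_gt0.
exists (M / r); apply: bnd_le (bnd_dx r0 r0 HM) => //.
  by rewrite divr_ge0 ?lexx // ltW.
have r2 : 0 < r / 2 by rewrite divr_gt0.
by rewrite (ltW r2) /= ler_pdivrMr // ler_peMr ?ler1n ?(ltW r0).
Qed.

Lemma conv_tr f : conv f -> conv (fun i j => f j i).
Proof. by move=> [r r0 [M HM]]; exists r => //; exists M; exact: bnd_tr. Qed.

Lemma conv_dy f : conv f -> conv (fps2_dy f).
Proof. by move=> /conv_tr/conv_dx/conv_tr. Qed.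

Lemma conv_sum (I : Type) (r : seq I) (P : pred I) (f : I -> fps2 K) :
  (forall k, conv (f k)) -> conv (\sum_(k <- r | P k) f k).
Proof.
move=> cf; elim/big_ind: _ => //; [|exact: convD].
by apply: conv_fin; exists 0%N => i j; rewrite fps20E eqxx.
Qed.

Lemma fps2M00 f g : (f * g) 0%N 0%N = f 0%N 0%N * g 0%N 0%N.
Proof. by rewrite fps2ME !big_ord1. Qed.

Lemma fps2_expr_order u n i j : u 0%N 0%N = 0 -> (u ^+ n) i j != 0 -> (n <= i + j)%N.
Proof.
move=> u0; elim: n i j => [//|n IH] i j; rewrite exprS fps2ME => H.
rewrite ltnNge; apply: contraNN H => ijn; apply/eqP; apply: big1 => k _; apply: big1 => l _.
have ki : (k <= i)%N by rewrite -ltnS.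
have lj : (l <= j)%N by rewrite -ltnS.
have [->|ukl] := eqVneq (u k l) 0; first by rewrite mul0r.
have [->|/IH H] := eqVneq ((u ^+ n) (i - k)%N (j - l)%N) 0; first by rewrite mulr0.
have [k0 l0] : k = 0%N :> nat /\ l = 0%N :> nat by lia.
by rewrite k0 l0 u0 eqxx in ukl.
Qed.

(* The geometric series; its partial sums are bounded on a polydisc where the
   l1 norm of u is at most 1/2. *)
Lemma conv_inv u : u 0%N 0%N = 0 -> conv u -> exists2 v, conv v & (1 - u) * v = 1.
Proof.
move=> u0 [r r0 [M HM]].
pose v : fps2 K := fun i j => \sum_(n < (i + j).+1) (u ^+ n) i j.
have vE N i j : (i + j < N)%N -> v i j = (\sum_(n < N) u ^+ n) i j.
  move=> ijN; rewrite fps2_sumE /v (big_ord_widen N (fun n => (u ^+ n) i j)) // big_mkcond /=.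
  apply: eq_bigr => n _; case: ifP => // /negbT; rewrite -leqNgt => nij.
  by apply/esym/eqP/negPn/negP => /(fps2_expr_order u0); rewrite leqNgt nij.
exists v; last first.
  apply: fps2P => i j; set N := (i + j).+1.
  have -> : (1 - u) * v = (1 - u) * (\sum_(n < N) u ^+ n) + (1 - u) * (v - \sum_(n < N) u ^+ n).
    by ring.
  have -> : (1 - u) * (\sum_(n < N) u ^+ n) = 1 - u ^+ N.
    by rewrite -opprB mulNr -subrX1 opprB.
  rewrite fps2DE fps2BE [X in _ + X]fps2ME big1 => [|k _].
    rewrite addr0; have -> : (u ^+ N) i j = 0; last by rewrite subr0.
    by apply/eqP/negPn/negP => /(fps2_expr_order u0); rewrite ltnn.
  apply: big1 => l _; rewrite fps2BE (vE N) ?subrr ?mulr0 //.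
  by rewrite ltnS leq_add // leq_subr.
have M0 : 0 <= M := bnd_ge0 HM.
(* As u has no constant term, shrinking the radius by la gains at least a factor la, and la M <=
   1/2. *)
pose la := (2 * (M + 1))^-1; have M1 : 0 < 2 * (M + 1) by rewrite mulr_gt0 // ltr_wpDl.
have la0 : 0 < la by rewrite invr_gt0.
have la1 : la <= 1.
  rewrite invf_le1 // mulrDr mulr1 ler_wpDl ?ler1n // mulr_ge0 //.
pose t := la * r; have t0 : 0 < t by rewrite mulr_gt0.
have Hu : bnd t t u (2^-1).
  move=> N; apply: (@le_trans _ _ (la * M)); last first.
    rewrite /la mulrC ler_pdivrMr // mulrA mulVf ?pnatr_eq0 // mul1r lerDl ler01 //.
  apply: le_trans (ler_wpM2l (ltW la0) (HM N)); rewrite mulr_sumr; apply: ler_sum => i _.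
  rewrite mulr_sumr; apply: ler_sum => j _; rewrite [leRHS]mulrCA /t.
  have [->|uij] := eqVneq (u i j) 0; first by rewrite normr0 !mul0r.
  have ij : (0 < i + j)%N.
    rewrite lt0n; apply: contraNN uij; rewrite addn_eq0 => /andP[/eqP -> /eqP ->].
    by rewrite u0.
  have rij : 0 <= r ^+ i * r ^+ j by rewrite mulr_ge0 ?exprn_ge0 ?(ltW r0).
  rewrite ler_wpM2l // !exprMn mulrACA -exprD ler_wpM2r //.
  by rewrite -{2}[la]expr1 ler_wiXn2l ?(ltW la0).
have Hn n : bnd t t (u ^+ n) (2^-1 ^+ n).
  elim: n => [|n IH]; last by rewrite !exprS; apply: bndM => //; exact: ltW.
  move=> N; rewrite !expr0.
  apply: (@le_trans _ _ (\sum_(i < N) \sum_(j < N) (if (i == 0%N :> nat) && (j == 0%N :> nat) then 1 else 0))).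
    apply: ler_sum => i _; apply: ler_sum => j _.
    rewrite -[1 : fps2 K]/(fps2_mon K 0 0) /fps2_mon.
    case: andP => [[/eqP -> /eqP ->]|_]; last by rewrite normr0 mul0r.
    by rewrite normr1 !expr0 !mulr1.
  rewrite (@sum_ord_only _ N 0 (fun i => \sum_(j < N) (if (i == 0%N) && (j == 0%N :> nat) then 1 else 0))).
    case: ifP => // N0; rewrite (@sum_ord_only _ N 0 (fun j => if (0 == 0)%N && (j == 0%N) then 1 else 0)) ?N0 //.
    by move=> j _ /negPf ->.
  by move=> i _ /negPf ->; apply: big1.
exists t => //; exists 2 => N.
have tE i j : 0 <= t ^+ i * t ^+ j by rewrite mulr_ge0 ?exprn_ge0 // ltW.
(* On the box of side N the total degree is below 2 N, so only the powers of u with exponent below 2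
   N contribute. *)
apply: (@le_trans _ _ (\sum_(n < N + N) (2^-1 : K) ^+ n)).
  apply: (@le_trans _ _ (\sum_(n < N + N) \sum_(i < N) \sum_(j < N) `|(u ^+ n) i j| * (t ^+ i * t ^+ j))).
    rewrite [leRHS]exchange_big /=; apply: ler_sum => i _; rewrite [leRHS]exchange_big /=; apply: ler_sum => j _.
    rewrite -mulr_suml ler_wpM2r // (vE (N + N)%N); last by rewrite -addSn leq_add // ltnW.
    by rewrite fps2_sumE ler_norm_sum.
  by apply: ler_sum => n _; exact: Hn.
have : (2^-1 - 1) * (\sum_(n < N + N) (2^-1 : K) ^+ n) = 2^-1 ^+ (N + N) - 1 by rewrite -subrX1.
have e0 : 0 <= (2^-1 : K) ^+ (N + N) by rewrite exprn_ge0 // invr_ge0.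
move: (\sum_(n < _) _) ((2^-1) ^+ _) e0 => S e e0 E.
have -> : S = 2 - 2 * e.
  have -> : e = (2^-1 - 1) * S + 1 by rewrite E subrK.
  by field.
by rewrite gerDl oppr_le0 mulr_ge0.
Qed.

(** * The Jacobian ideal *)

Definition conv_ideal (g h f : fps2 K) :=
  exists A B, [/\ conv A, conv B & f = A * g + B * h].

Lemma conv_idealD g h f f' : conv_ideal g h f -> conv_ideal g h f' -> conv_ideal g h (f + f').
Proof.
move=> [A [B [cA cB ->]]] [A' [B' [cA' cB' ->]]]; exists (A + A'), (B + B').
by split; [exact: convD..|ring].
Qed.

Lemma conv_idealM g h c f : conv c -> conv_ideal g h f -> conv_ideal g h (c * f).
Proof.
move=> cc [A [B [cA cB ->]]]; exists (c * A), (c * B).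
by split; [exact: convM..|ring].
Qed.

(** Nakayama's lemma for two generators, by Cramer's rule: the determinant (1 - a)(1 - d) - b c
    equals 1 - w, where w vanishes at the origin. *)
Lemma conv_ideal_nakayama g h X Y i1 i2 a b c d :
  conv_ideal g h i1 -> conv_ideal g h i2 -> conv a -> conv b -> conv c -> conv d ->
  a 0%N 0%N = 0 -> b 0%N 0%N = 0 -> c 0%N 0%N = 0 -> d 0%N 0%N = 0 ->
  X = i1 + (a * X + b * Y) -> Y = i2 + (c * X + d * Y) ->
  conv_ideal g h X /\ conv_ideal g h Y.
Proof.
move=> I1 I2 ca cb cc cd a0 b0 c0 d0 EX EY.
pose w := a + d - a * d + b * c.
have cw : conv w by apply: convD; [apply: convB; [exact: convD|exact: convM]|exact: convM].
have w0 : w 0%N 0%N = 0 by rewrite /w fps2DE fps2BE fps2DE !fps2M00 a0 b0 c0 d0 !mul0r !addr0 subr0.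
have [v cv Ev] := conv_inv w0 cw.
have c1 : conv (1 : fps2 K) := conv_mon 0 0.
have XE : X = (v * (1 - d)) * i1 + (v * b) * i2.
  have -> : i1 = X - (a * X + b * Y) by rewrite {1}EX addrK.
  have -> : i2 = Y - (c * X + d * Y) by rewrite {1}EY addrK.
  transitivity ((1 - w) * v * X); first by rewrite Ev mul1r.
  by rewrite /w; ring.
have YE : Y = (v * c) * i1 + (v * (1 - a)) * i2.
  have -> : i1 = X - (a * X + b * Y) by rewrite {1}EX addrK.
  have -> : i2 = Y - (c * X + d * Y) by rewrite {1}EY addrK.
  transitivity ((1 - w) * v * Y); first by rewrite Ev mul1r.
  by rewrite /w; ring.
rewrite XE YE; split; apply: conv_idealD; apply: conv_idealM => //.
- by apply: convM => //; apply: convB.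
- exact: convM.
- exact: convM.
- by apply: convM => //; apply: convB.
Qed.

Lemma conv_ideal_box g h M (f : fps2 K) :
  conv_ideal g h (fps2_mon K M 0) -> conv_ideal g h (fps2_mon K 0 M) -> conv f ->
  (forall i j, (i < M)%N -> (j < M)%N -> f i j = 0) -> conv_ideal g h f.
Proof.
move=> IX IY cf f0.
pose r1 : fps2 K := fun i j => f (i + M)%N j.
pose r2 : fps2 K := fun i j => if (i < M)%N then f i (j + M)%N else 0.
have -> : f = r1 * fps2_mon K M 0 + r2 * fps2_mon K 0 M.
  apply: fps2P => i j; rewrite mulrC [r2 * _]mulrC fps2DE !fps2_monE /= !subn0 andbT /r1 /r2.
  case: (leqP M i) => Mi; first by rewrite subnK //; case: ifP; rewrite addr0.
  by rewrite add0r; case: (leqP M j) => Mj; [rewrite subnK | rewrite f0].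
apply: conv_idealD; apply: conv_idealM => //.
  by apply: (conv_shift (m := M) (n := 0)) cf => i j; rewrite addn0.
apply: (conv_shift (m := 0) (n := M)) cf => i j; rewrite addn0 /r2.
by case: ifP => // _; rewrite normr0.
Qed.

End Convergent.

Section JacobianIdeal.
Variables (K : numFieldType) (s D p q : nat) (vx vy al be : nat -> nat).
Hypothesis pol : polygon s D p q vx vy al be.
Variable F : fps2 K.
Local Notation nu := (nu s al be).
Hypothesis F_ge : forall i j, F i j != 0 -> (D <= nu i j)%N.
Hypothesis F_eq : forall i j, F i j != 0 -> nu i j = D ->
  exists2 m, (m <= s)%N & (i, j) = (vx m, vy m).
Hypothesis F_vert : forall m, (m <= s)%N -> F (vx m) (vy m) != 0.
Hypothesis F_conv : conv F.
Local Notation dX := (fps2_dx F).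
Local Notation dY := (fps2_dy F).
Local Notation mu0 := (polygon_mu s p q vx vy).

Let cX : conv dX := conv_dx F_conv.
Let cY : conv dY := conv_dy F_conv.
Let W := (al 0%N + be 0%N)%N.

Let nu_box M i j : (i < M)%N -> (j < M)%N -> (nu i.+1 j.+1 <= W * M)%N.
Proof.
move=> iM jM; apply: leq_trans (nu_le al be i.+1 j.+1 (pol_s pol)) _.
by rewrite /ell /W mulnDl leq_add // leq_mul2l ?iM ?jM orbT.
Qed.

(** The monomial vanishes below level 1 + 2 D, so [ideal_deep] starts from n = 1; the level it
    reaches is chosen to cover the box of side k. *)
Let deep_mon M k u : u = fps2_mon K M 0 \/ u = fps2_mon K 0 M -> (1 + 2 * D <= M)%N ->
  exists A B, [/\ conv A, conv B & forall i j, (i < k)%N -> (j < k)%N ->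
    u i j = (A * dX + B * dY) i j].
Proof.
move=> uM DM.
have [|i j|A [B [fA fB H]]] := @ideal_deep _ _ _ _ _ _ _ _ _ pol F F_ge F_eq F_vert 1 (W * k).+1 u isT.
- by rewrite ltnS.
- move=> lt; apply/eqP; move: lt; apply: contraTT => uij.
  have ijM : (i + j = M)%N.
    case: uM uij => ->; rewrite /fps2_mon;
      case: (eqVneq i _) => [->|_] /=; rewrite ?eqxx //;
      by case: (eqVneq j _) => [->|_] /=; rewrite ?eqxx ?addn0.
  by rewrite -leqNgt; apply: leq_trans (nu_deg pol _ _); lia.
exists A, B; split; [exact: conv_fin..|] => i j ik jk.
by apply: H; rewrite ltn_addr // ltnS nu_box.
Qed.

(** The box has side 2 M rather than M so that the cofactors vanish at the origin, as Nakayama's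
    lemma requires. *)
Let split_box M (R : fps2 K) : (0 < M)%N -> conv R ->
  (forall i j, (i < M + M)%N -> (j < M + M)%N -> R i j = 0) ->
  exists a b, [/\ conv a, conv b, a 0%N 0%N = 0, b 0%N 0%N = 0 &
    R = a * fps2_mon K M 0 + b * fps2_mon K 0 M].
Proof.
move=> M0 cR R0.
pose r1 : fps2 K := fun i j => if (M <= i)%N then R (i + M)%N j else 0.
pose r2 : fps2 K := fun i j => if (M <= j)%N && (i < M + M)%N then R i (j + M)%N else 0.
exists r1, r2; split.
- apply: (conv_shift (m := M) (n := 0)) cR => i j; rewrite addn0 /r1.
  by case: ifP => // _; rewrite normr0.
- apply: (conv_shift (m := 0) (n := M)) cR => i j; rewrite addn0 /r2.
  by case: ifP => // _; rewrite normr0.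
- by rewrite /r1 leqNgt M0.
- by rewrite /r2 leqNgt M0.
apply: fps2P => i j; rewrite mulrC [r2 * _]mulrC fps2DE !fps2_monE /= !subn0 andbT /r1 /r2.
case: (ltnP i (M + M)) => iM.
  have -> : (M <= i - M)%N = false by apply/negbTE; rewrite -ltnNge; lia.
  rewrite if_same add0r; case: (leqP M j) => Mj; last by rewrite R0 //; lia.
  rewrite andbT; case: (leqP M (j - M)) => MjM; first by rewrite subnK.
  by rewrite R0 //; lia.
have -> : (M <= i)%N by lia.
have -> : (M <= i - M)%N by lia.
by rewrite andbF if_same addr0 subnK //; lia.
Qed.

Lemma jacobian_cofinite : exists2 M, (0 < M)%N &
  conv_ideal dX dY (fps2_mon K M 0) /\ conv_ideal dX dY (fps2_mon K 0 M).
Proof.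
pose M := (1 + 2 * D)%N; have M0 : (0 < M)%N by [].
exists M => //.
have rel u : u = fps2_mon K M 0 \/ u = fps2_mon K 0 M -> conv u -> exists i a b,
   [/\ conv_ideal dX dY i, conv a, conv b, a 0%N 0%N = 0 & b 0%N 0%N = 0] /\
   u = i + (a * fps2_mon K M 0 + b * fps2_mon K 0 M).
  move=> uM cu; have [A [B [cA cB H]]] := @deep_mon M (M + M) u uM (leqnn _).
  have [||a [b [ca cb a0 b0 E]]] := @split_box M (u - (A * dX + B * dY)) M0.
  - by apply: convB => //; apply: convD; apply: convM.
  - by move=> i j iM jM; rewrite fps2BE H // subrr.
  exists (A * dX + B * dY), a, b; split; first by split=> //; exists A, B.
  by rewrite -E addrC subrK.
have [i1 [a [b [[I1 ca cb a0 b0] EX]]]] := rel _ (or_introl erefl) (conv_mon K M 0).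
have [i2 [c [d [[I2 cc cd c0 d0] EY]]]] := rel _ (or_intror erefl) (conv_mon K 0 M).
exact: (conv_ideal_nakayama I1 I2 ca cb cc cd a0 b0 c0 d0 EX EY).
Qed.

Lemma jacobian_basis : exists e : 'I_mu0 -> fps2 K,
  [/\ forall k, conv (e k),
      forall u, conv u -> exists (a : 'I_mu0 -> K) A B, [/\ conv A, conv B &
        forall i j, u i j = \sum_k a k * e k i j + (A * dX) i j + (B * dY) i j]
    & forall (a : 'I_mu0 -> K) A B, conv A -> conv B ->
        (forall i j, \sum_k a k * e k i j = (A * dX) i j + (B * dY) i j) -> forall k, a k = 0].
Proof.
have [M M0 [IX IY]] := jacobian_cofinite.
(* At this level the truncation contains the box of side M, and a convergent germ without terms in
   that box is in the ideal. *)
have [e [fe spe inde]] := quotient_basis pol F_ge F_eq F_vert (ltn0Sn (W * M)).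
exists e; split=> [k|u cu|a A B _ _ H]; first exact: conv_fin.
  have [a [A [B [fA fB H]]]] := spe u.
  have cA := conv_fin fA; have cB := conv_fin fB.
  pose S := \sum_k fps2_scale (a k) (e k).
  have [||A' [B' [cA' cB' E]]] := @conv_ideal_box _ dX dY M (u - S - (A * dX + B * dY)) IX IY.
  - apply: convB; last by apply: convD; exact: convM.
    by apply: convB => //; apply: conv_sum => k; apply: convZ; apply: conv_fin.
  - move=> i j iM jM; have SE : S i j = \sum_k a k * e k i j by rewrite /S fps2_sumE.
    rewrite !fps2BE SE (H i j) 1?addrAC ?addrK ?subrr //; last by rewrite ltn_addr // ltnS nu_box.
  exists a, (A + A'), (B + B'); split; [exact: convD..|] => i j.
  have -> : u = S + (A + A') * dX + (B + B') * dY.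
    have -> : u = (u - S - (A * dX + B * dY)) + S + (A * dX + B * dY) by ring.
    by rewrite E; ring.
  by rewrite !fps2DE /S fps2_sumE.
by apply: (inde a A B) => i j _; rewrite H fps2DE.
Qed.

End JacobianIdeal.

Local Open Scope classical_set_scope.
Local Open Scope ring_scope.

(** * Convergence and evaluation over the complex numbers *)

Section Completeness.
Variable R : realType.
Local Notation CR := (C R).

Lemma ReS (I : Type) (r : seq I) (P : pred I) (f : I -> R[i]) :
  complex.Re (\sum_(k <- r | P k) f k) = \sum_(k <- r | P k) complex.Re (f k).
Proof. by elim/big_rec2: _ => // k y [a b] _ /= <-; case: (f k). Qed.

Lemma ImS (I : Type) (r : seq I) (P : pred I) (f : I -> R[i]) :
  complex.Im (\sum_(k <- r | P k) f k) = \sum_(k <- r | P k) complex.Im (f k).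
Proof. by elim/big_rec2: _ => // k y [a b] _ /= <-; case: (f k). Qed.

Lemma normC_le (z : R[i]) : `|z| <= (`|complex.Re z| + `|complex.Im z|)%:C%C.
Proof.
rewrite normc_def lecR -[leRHS]ger0_norm ?addr_ge0 // -sqrtr_sqr ler_wsqrtr //.
rewrite sqrrD !real_normK ?num_real // lerD2r lerDl mulrn_wge0 ?mulr_ge0 //.
Qed.

Lemma normC_ge_Re (z : R[i]) : `|complex.Re z| <= complex.Re `|z|.
Proof. by rewrite normc_def /= -sqrtr_sqr ler_wsqrtr // lerDl sqr_ge0. Qed.

Lemma normC_ge_Im (z : R[i]) : `|complex.Im z| <= complex.Re `|z|.
Proof. by rewrite normc_def /= -sqrtr_sqr ler_wsqrtr // lerDr sqr_ge0. Qed.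

Lemma real_abs_cvg (x : nat -> R) (M : R) :
  (forall n, \sum_(k < n) `|x k| <= M) -> cvgn (fun n => \sum_(k < n) x k).
Proof.
move=> H; have -> : (fun n => \sum_(k < n) x k) = series x.
  by apply/funext => n; rewrite /series /= big_mkord.
apply: normed_cvg; apply: nondecreasing_is_cvgn.
  by apply: nondecreasing_series => n _ _; exact: normr_ge0.
by exists M => _ [n _ <-]; have := H n; rewrite -(big_mkord xpredT (fun k => `|x k|)).
Qed.

Lemma abs_cvg (a : nat -> CR) (M : CR) :
  (forall n, \sum_(k < n) `|a k| <= M) -> cvgn (fun n => \sum_(k < n) a k).
Proof.
move=> H.
have HR n : \sum_(k < n) complex.Re `|a k| <= complex.Re M.
  by have := H n; rewrite lecE => /andP[_]; rewrite ReS.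
have /cvg_ex[l1 c1] : cvgn (fun n => \sum_(k < n) complex.Re (a k)).
  apply: (@real_abs_cvg (fun k => complex.Re (a k)) (complex.Re M)) => n; apply: le_trans (HR n).
  by apply: ler_sum => k _; exact: normC_ge_Re.
have /cvg_ex[l2 c2] : cvgn (fun n => \sum_(k < n) complex.Im (a k)).
  apply: (@real_abs_cvg (fun k => complex.Im (a k)) (complex.Re M)) => n; apply: le_trans (HR n).
  by apply: ler_sum => k _; exact: normC_ge_Im.
apply/cvg_ex; exists ((l1 +i* l2)%C : CR); apply/cvgrPdist_lt => e e0.
have eE : e = ((complex.Re e)%:C)%C :> R[i].
  by rewrite RRe_real // gtr0_real.
have e0' : 0 < complex.Re e / 2.
  by rewrite divr_gt0 //; move: e0; rewrite ltcE => /andP[].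
have n1 := (cvgrPdist_lt _ _).1 c1 _ e0'; have n2 := (cvgrPdist_lt _ _).1 c2 _ e0'.
near=> n.
apply: le_lt_trans (normC_le _) _.
have -> : complex.Re ((l1 +i* l2)%C - \sum_(k < n) a k : R[i]) = l1 - \sum_(k < n) complex.Re (a k).
  by rewrite -ReS; case: (\sum_(k < n) a k).
have -> : complex.Im ((l1 +i* l2)%C - \sum_(k < n) a k : R[i]) = l2 - \sum_(k < n) complex.Im (a k).
  by rewrite -ImS; case: (\sum_(k < n) a k).
rewrite eE ltcR (splitr (complex.Re e)) ltrD //.
  by near: n; exact: n1.
by near: n; exact: n2.
Unshelve. all: by end_near.
Qed.

End Completeness.

Lemma sum_widen_le (K : numDomainType) (n m : nat) (u v : nat -> K) :
  (forall k, (k < n)%N -> u k <= v k) -> (forall k, 0 <= v k) ->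
  \sum_(k < n) u k <= \sum_(k < n + m) v k.
Proof.
move=> uv v0; rewrite big_split_ord /= -[leLHS]addr0 lerD ?sumr_ge0 //.
by apply: ler_sum => k _; exact: uv.
Qed.

(** Indices below n have sums below 2 n, so a product of two partial sums of order n is dominated by
    the Cauchy product of order 2 n. *)
Lemma sum_widen4_le (K : numDomainType) (n : nat) (T : nat -> nat -> nat -> nat -> K) :
  (forall k k' l l', 0 <= T k k' l l') ->
  \sum_(k < n) \sum_(k' < n) \sum_(l < n) \sum_(l' < n) T k k' l l' <=
  \sum_(k < n + n) \sum_(k' < n + n) \sum_(l < n + n) \sum_(l' < n + n)
    (if (k + k' < n + n)%N && (l + l' < n + n)%N then T k k' l l' else 0).
Proof.
move=> T0; pose U k k' l l' :=
  if (k + k' < n + n)%N && (l + l' < n + n)%N then T k k' l l' else 0.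
have U0 k k' l l' : 0 <= U k k' l l' by rewrite /U; case: ifP.
apply: (@sum_widen_le _ n n
  (fun k => \sum_(k' < n) \sum_(l < n) \sum_(l' < n) T k k' l l')
  (fun k => \sum_(k' < n + n) \sum_(l < n + n) \sum_(l' < n + n) U k k' l l')) => [k kn|k];
  last by do 3!(apply: sumr_ge0 => ? _).
apply: (@sum_widen_le _ n n (fun k' => \sum_(l < n) \sum_(l' < n) T k k' l l')
  (fun k' => \sum_(l < n + n) \sum_(l' < n + n) U k k' l l')) => [k' kn'|k'];
  last by do 2!(apply: sumr_ge0 => ? _).
apply: (@sum_widen_le _ n n (fun l => \sum_(l' < n) T k k' l l')
  (fun l => \sum_(l' < n + n) U k k' l l')) => [l ln|l]; last exact: sumr_ge0.
apply: (@sum_widen_le _ n n (T k k' l) (U k k' l)) => // l' ln'.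
rewrite /U; have -> : (k + k' < n + n)%N by lia.
by have -> : (l + l' < n + n)%N by lia.
Qed.

Lemma sum_square_succ (V : nmodType) (n : nat) (G : nat -> nat -> V) :
  \sum_(i < n.+1) \sum_(j < n.+1) G i j =
  \sum_(i < n) \sum_(j < n) G i j + (\sum_(i < n) G i n + \sum_(j < n.+1) G n j).
Proof.
rewrite big_ord_recr /=; under eq_bigr do rewrite big_ord_recr /=.
by rewrite big_split /= addrA.
Qed.

(** The form in which completeness of the complex numbers enters; [abs_cvg] supplies it. *)
Definition abs_complete (K : numFieldType) := forall (a : nat -> K) (M : K),
  (forall n, \sum_(k < n) `|a k| <= M) -> cvgn (fun n => \sum_(k < n) a k).

Section Evaluation.
Variable CR : numFieldType.
Hypothesis complete : abs_complete CR.
Implicit Types (f g : fps2 CR) (x y : CR).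

Lemma psum_cvg x y f M : bnd `|x| `|y| f M -> cvgn (psum x y f).
Proof.
(* The terms b k are sums over the borders of successive squares, which turns square partial sums
   into an ordinary series. *)
move=> H; pose b k := psum x y f k.+1 - psum x y f k.
have -> : psum x y f = (fun n => \sum_(k < n) b k).
  apply/funext; elim=> [|n IH]; first by rewrite /psum !big_ord0.
  by rewrite big_ord_recr /= -IH /b addrC subrK.
apply: (@complete b M) => n; apply: le_trans (H n).
elim: n => [|n IH]; first by rewrite !big_ord0.
rewrite big_ord_recr /= (sum_square_succ n (fun i j => `|f i j| * (`|x| ^+ i * `|y| ^+ j))) lerD //.
rewrite /b /psum (sum_square_succ n (fun i j => f i j * x ^+ i * y ^+ j)) addrC addKr.
have E i j : `|f i j * x ^+ i * y ^+ j| = `|f i j| * (`|x| ^+ i * `|y| ^+ j).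
  by rewrite !normrM !normrX mulrA.
apply: le_trans (ler_normD _ _) _; rewrite lerD //.
  by apply: le_trans (ler_norm_sum _ _ _) _; apply: ler_sum => i _; rewrite E.
by apply: le_trans (ler_norm_sum _ _ _) _; apply: ler_sum => i _; rewrite E.
Qed.

(** With P n the partial sums of the product of the absolute series, the product of two partial sums
    differs from the partial sum of the product by at most P (2 n) - P n. This tends to 0 because P
    converges. *)
Lemma psum_mul_cvg0 x y f g M N : bnd `|x| `|y| f M -> bnd `|x| `|y| g N ->
  psum x y g @ \oo --> (0 : CR) -> psum x y (f * g) @ \oo --> (0 : CR).
Proof.
move=> Hf Hg g0; have /cvg_ex[lf cf] := psum_cvg Hf.
pose nf := fps2_norm f; pose ng := fps2_norm g.
pose P := psum `|x| `|y| (nf * ng).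
have bP : bnd `|(`|x| : CR)| `|(`|y| : CR)| (nf * ng) (M * N).
  rewrite (normr_id x) (normr_id y); apply: bndM => //.
    by apply: bnd_le Hf; rewrite ?normr_ge0 ?lexx // => i j; rewrite normr_id.
  by apply: bnd_le Hg; rewrite ?normr_ge0 ?lexx // => i j; rewrite normr_id.
have /cvg_ex[L cP] : cvgn P by exact: psum_cvg bP.
pose d n := psum x y f n * psum x y g n - psum x y (f * g) n.
have dP n : `|d n| <= P (n + n)%N - P n.
  pose t k k' l l' := f k l * g k' l' * x ^+ (k + k') * y ^+ (l + l').
  pose T k k' l l' := nf k l * ng k' l' * `|x| ^+ (k + k') * `|y| ^+ (l + l').
  have T0 k k' l l' : 0 <= T k k' l l'.
    by rewrite /T /nf /ng /fps2_norm !mulr_ge0 ?exprn_ge0.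
  have tT k k' l l' : `|t k k' l l'| = T k k' l l' by rewrite /t !normrM !normrX.
  rewrite /d psumM psum_mul.
  apply: (@le_trans _ _ (psum `|x| `|y| nf n * psum `|x| `|y| ng n - P n)).
    rewrite /P psumM psum_mul.
    do 4![rewrite -!sumrB; apply: le_trans (ler_norm_sum _ _ _) _; apply: ler_sum => ? _].
    by case: ifP => _; rewrite ?subrr ?normr0 // !subr0 tT.
  rewrite lerD2r psumM /P psum_mul.
  exact: (@sum_widen4_le _ n T).
have d0 : d @ \oo --> (0 : CR).
  apply/cvgrPdist_lt => e e0; have e2 : 0 < e / 2 by rewrite divr_gt0.
  have [N0 _ HN] := (cvgrPdist_lt _ _).1 cP _ e2.
  exists N0 => // n /= Nn; rewrite sub0r normrN.
  apply: le_lt_trans (dP n) _.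
  have Pr : P (n + n)%N - P n <= `|P (n + n)%N - P n|.
    by apply: real_ler_norm; apply: ger0_real; exact: le_trans (dP n).
  apply: le_lt_trans Pr _.
  have -> : P (n + n)%N - P n = (L - P n) - (L - P (n + n)%N) by ring.
  apply: le_lt_trans (ler_normB _ _) _; rewrite (splitr e) ltrD //; apply: HN => //=.
  by rewrite (leq_trans Nn) ?leq_addr.
have -> : psum x y (f * g) = (fun n => psum x y f n * psum x y g n - d n).
  by apply/funext => n; rewrite /d opprB addrC subrK.
have -> : (0 : CR) = lf * 0 - 0 by rewrite mulr0 subr0.
by apply: cvgB => //; apply: cvgM.
Qed.

Definition eval f (z : CR * CR) : CR := limn (psum z.1 z.2 f).

Lemma eval_cvg f z M : bnd `|z.1| `|z.2| f M -> psum z.1 z.2 f @ \oo --> eval f z.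
Proof. by move=> /psum_cvg. Qed.

Lemma eval0 f : eval f (0, 0) = f 0%N 0%N.
Proof.
apply: (lim_near_cst (@norm_hausdorff _ CR)); exists 1%N => // n /= n0.
rewrite /psum (@sum_ord_only _ n 0 (fun i => \sum_(j < n) f i j * 0 ^+ i * 0 ^+ j)) => [|i _ /negPf i0].
  rewrite n0 (@sum_ord_only _ n 0 (fun j => f 0%N j * 0 ^+ 0 * 0 ^+ j)) => [|j _ /negPf j0].
    by rewrite n0 !expr0 !mulr1.
  by rewrite [0 ^+ j]expr0n j0 mulr0.
by apply: big1 => j _; rewrite expr0n i0 mulr0 mul0r.
Qed.

Lemma psum_mon x y m n N : (m < N)%N -> (n < N)%N ->
  psum x y (fps2_mon CR m n) N = x ^+ m * y ^+ n.
Proof.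
move=> mN nN; rewrite /psum (@sum_ord_only _ N m (fun i => \sum_(j < N) fps2_mon CR m n i j * x ^+ i * y ^+ j)).
  rewrite mN (@sum_ord_only _ N n (fun j => fps2_mon CR m n m j * x ^+ m * y ^+ j)).
    by rewrite nN /fps2_mon !eqxx mul1r.
  by move=> j _ /negPf nj; rewrite /fps2_mon nj andbF !mul0r.
by move=> i _ /negPf ni; apply: big1 => j _; rewrite /fps2_mon ni !mul0r.
Qed.

Lemma mon_root z m n g h A B M1 M2 M3 M4 :
  bnd `|z.1| `|z.2| g M1 -> bnd `|z.1| `|z.2| h M2 ->
  bnd `|z.1| `|z.2| A M3 -> bnd `|z.1| `|z.2| B M4 ->
  eval g z = 0 -> eval h z = 0 -> fps2_mon CR m n = A * g + B * h ->
  z.1 ^+ m * z.2 ^+ n = 0.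
Proof.
move=> bg bh bA bB eg eh E.
have cg : psum z.1 z.2 g @ \oo --> (0 : CR) by rewrite -eg; exact: eval_cvg bg.
have ch : psum z.1 z.2 h @ \oo --> (0 : CR) by rewrite -eh; exact: eval_cvg bh.
have c1 := psum_mul_cvg0 bA bg cg; have c2 := psum_mul_cvg0 bB bh ch.
have c0 : psum z.1 z.2 (fps2_mon CR m n) @ \oo --> (0 : CR).
  have -> : psum z.1 z.2 (fps2_mon CR m n) =
      (fun N => psum z.1 z.2 (A * g) N + psum z.1 z.2 (B * h) N).
    apply/funext => N; rewrite E /psum -big_split /=; apply: eq_bigr => i _.
    by rewrite -big_split /=; apply: eq_bigr => j _; rewrite fps2DE -!mulrA mulrDl.
  by rewrite -[0 in X in _ --> X]addr0; apply: cvgD.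
have c1' : psum z.1 z.2 (fps2_mon CR m n) @ \oo --> (z.1 ^+ m * z.2 ^+ n : CR).
  apply: cvg_near_cst; exists (m + n).+1 => // N /= mnN.
  by rewrite psum_mon //; apply: leq_ltn_trans mnN; rewrite ?leq_addr ?leq_addl.
exact: (cvg_unique (@norm_hausdorff _ CR) c1' c0).
Qed.

Definition isolated f := \forall z \near ((0, 0) : CR * CR),
    [/\ eval (fps2_dx f) z = 0, eval (fps2_dy f) z = 0 & eval f z = 0] <-> z = (0, 0).

(** Where both derivatives and all four cofactors converge, a zero of the gradient is a zero of x^M
    and of y^M. *)
Lemma isolated_cofinite f M : conv f -> (0 < M)%N ->
  f 0%N 0%N = 0 -> f 1%N 0%N = 0 -> f 0%N 1%N = 0 ->
  conv_ideal (fps2_dx f) (fps2_dy f) (fps2_mon CR M 0) ->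
  conv_ideal (fps2_dx f) (fps2_dy f) (fps2_mon CR 0 M) -> isolated f.
Proof.
move=> cf M0 f00 f10 f01 [A [B [cA cB EX]]] [A' [B' [cA' cB' EY]]].
have cX := conv_dx cf; have cY := conv_dy cf.
have [r1 r10 [[a1 b1] [a2 b2]]] := conv_bnd2 cX cY.
have [r2 r20 [[a3 b3] [a4 b4]]] := conv_bnd2 cA cB.
have [r3 r30 [[a5 b5] [a6 b6]]] := conv_bnd2 cA' cB'.
have n0 : nbhs ((0, 0) : CR * CR) [set z | (`|z.1| < r1 /\ `|z.2| < r1) /\
    ((`|z.1| < r2 /\ `|z.2| < r2) /\ (`|z.1| < r3 /\ `|z.2| < r3))].
  have H r : 0 < r -> nbhs ((0, 0) : CR * CR) [set z | `|z.1| < r /\ `|z.2| < r].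
    move=> r0; exists ([set x : CR | `|x| < r], [set x : CR | `|x| < r]).
      by split; exact: (@pseudometric_normed_Zmodule.nbhs0_lt CR CR r r0).
    by move=> [z1 z2] [].
  by do ![apply: filterI; first exact: H]; exact: H.
apply: filterS n0 => z [[z11 z12] [[z21 z22] [z31 z32]]].
have L (r t : CR) : `|t| < r -> 0 <= `|t| <= r by move=> tr; apply/andP; split; [exact: normr_ge0 | exact: ltW].
have W r g N : `|z.1| < r -> `|z.2| < r -> bnd r r g N -> bnd `|z.1| `|z.2| g N.
  by move=> h1 h2; apply: bnd_le => //; exact: L.
split=> [[eX eY _]|->]; last first.
  by split; rewrite eval0 // /fps2_dx /fps2_dy ?f10 ?f01 mul0rn.
have X0 := mon_root (W _ _ _ z11 z12 b1) (W _ _ _ z11 z12 b2) (W _ _ _ z21 z22 b3)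
  (W _ _ _ z21 z22 b4) eX eY EX.
have Y0 := mon_root (W _ _ _ z11 z12 b1) (W _ _ _ z11 z12 b2) (W _ _ _ z31 z32 b5)
  (W _ _ _ z31 z32 b6) eX eY EY.
move: X0 Y0; rewrite !expr0 mulr1 mul1r => /eqP + /eqP.
rewrite !expf_eq0 M0 /= => /eqP E1 /eqP E2.
by case: z E1 E2 {z11 z12 z21 z22 z31 z32 W eX eY} => /= z1 z2 -> ->.
Qed.

End Evaluation.

(** * Upper bounds for multiplicities *)

Lemma kernel_vector (K : fieldType) m n (A : 'M[K]_(m, n)) : (n < m)%N ->
  exists2 v : 'rV[K]_m, v != 0 & v *m A = 0.
Proof.
move=> nm; have : kermx A != 0.
  rewrite -mxrank_eq0 mxrank_ker subn_eq0 -ltnNge.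
  exact: leq_ltn_trans (rank_leq_col _) nm.
by case/rowV0Pn => v /sub_kermxP vA v0; exists v.
Qed.

Section Multiplicity.
Variable K : numFieldType.
Hypothesis small : forall x c : K, 0 <= x -> (forall n, x * 2 ^+ n <= c) -> x = 0.
Variables (g h : fps2 K) (n : nat) (e : 'I_n -> fps2 K).
Hypotheses (g_conv : conv g) (h_conv : conv h).
Hypothesis e_conv : forall k, conv (e k).
Hypothesis e_span : forall u, conv u -> exists a : 'I_n -> K,
  conv_ideal g h (u - \sum_k fps2_scale (a k) (e k)).
Hypothesis e_free : forall a : 'I_n -> K,
  conv_ideal g h (\sum_k fps2_scale (a k) (e k)) -> forall k, a k = 0.
Local Notation I := (conv_ideal g h).

Let I0 : I 0.
Proof.
by exists 0, 0; split; [apply: conv_fin; exists 0%N => i j; rewrite fps20E eqxx..|rewrite !mul0r addr0].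
Qed.

Let I_Z c u : I u -> I (fps2_scale c u).
Proof.
move=> [A [B [cA cB ->]]]; exists (fps2_scale c A), (fps2_scale c B).
split; [exact: convZ..|rewrite !fps2_scaleM].
by apply: fps2P => i j; rewrite fps2DE !fps2_scaleE fps2DE mulrDr.
Qed.

Let I_N u : I u -> I (- u).
Proof.
move=> [A [B [cA cB ->]]]; exists (- A), (- B).
by split; [exact: convN..|ring].
Qed.

Let I_B u v : I u -> I v -> I (u - v).
Proof. by move=> Iu Iv; apply: conv_idealD => //; exact: I_N. Qed.

(** The implication under the quantifier makes coordinates a total function; their values on
    divergent series are arbitrary. *)
Let ex_crd u : exists a : 'I_n -> K, conv u -> I (u - \sum_k fps2_scale (a k) (e k)).
Proof.
by have [/e_span[a Ha]|nc] := pselect (conv u); [exists a | exists (fun=> 0)].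
Qed.

Let crd u : 'I_n -> K := projT1 (cid (ex_crd u)).
Let crdP u : conv u -> I (u - \sum_k fps2_scale (crd u k) (e k)).
Proof. by rewrite /crd; case: cid. Qed.

Let crd_uniq u a : conv u -> I (u - \sum_k fps2_scale (a k) (e k)) -> forall k, crd u k = a k.
Proof.
move=> cu Ia k; apply/eqP; rewrite -subr_eq0; apply/eqP.
apply: (e_free (a := fun k => crd u k - a k)).
have -> : \sum_k fps2_scale (crd u k - a k) (e k) =
   (u - \sum_k fps2_scale (a k) (e k)) - (u - \sum_k fps2_scale (crd u k) (e k)).
  rewrite opprB addrCA addrAC subrr add0r -sumrB; apply: eq_bigr => l _.
  by apply: fps2P => i j; rewrite fps2BE !fps2_scaleE mulrBl.
by apply: I_B => //; exact: crdP.
Qed.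

Let crd_lin c u v k : conv u -> conv v ->
  crd (fps2_scale c u + v) k = c * crd u k + crd v k.
Proof.
move=> cu cv; apply: (crd_uniq (a := fun k => c * crd u k + crd v k)).
  by apply: convD => //; exact: convZ.
have -> : fps2_scale c u + v - \sum_k fps2_scale (c * crd u k + crd v k) (e k) =
  fps2_scale c (u - \sum_k fps2_scale (crd u k) (e k)) + (v - \sum_k fps2_scale (crd v k) (e k)).
  apply: fps2P => i j; rewrite !(fps2BE, fps2DE, fps2_scaleE, fps2_sumE).
  under eq_bigr do rewrite fps2_scaleE mulrDl -mulrA.
  by rewrite big_split /= mulrBr mulr_sumr; ring.
by apply: conv_idealD; [apply: I_Z|]; exact: crdP.
Qed.

Let crd_I u k : I u -> crd u k = 0.
Proof.
move=> Iu; apply: (crd_uniq (a := fun=> 0)).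
  by case: Iu => A [B [cA cB ->]]; apply: convD; exact: convM.
rewrite big1 ?subr0 // => l _; apply: fps2P => i j.
by rewrite fps2_scaleE mul0r.
Qed.

Let crd_e l k : crd (e l) k = (l == k)%:R.
Proof.
apply: (crd_uniq (a := fun k => (l == k)%:R)) => //.
have -> : \sum_k fps2_scale (l == k)%:R (e k) = e l; last by rewrite subrr.
apply: fps2P => i j; rewrite fps2_sumE (bigD1 l) //= fps2_scaleE eqxx mul1r big1 ?addr0 // => m ml.
by rewrite fps2_scaleE eq_sym (negPf ml) mul0r.
Qed.

Let crd_sum m (c : 'I_m -> K) (u : 'I_m -> fps2 K) k : (forall l, conv (u l)) ->
  crd (\sum_l fps2_scale (c l) (u l)) k = \sum_l c l * crd (u l) k.
Proof.
move=> cu; elim: m c u cu => [|m IH] c u cu; first by rewrite !big_ord0 crd_I.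
rewrite !big_ord_recl crd_lin // ?IH //.
by apply: conv_sum => l; exact: convZ.
Qed.

(* The first n.+1 powers of z are linearly dependent modulo the ideal; a
   dependency relation is a power of z times a unit. *)
Let power_in_ideal z : conv z -> z 0%N 0%N = 0 -> exists s, I (z ^+ s).
Proof.
move=> cz z0; have c1 : conv (1 : fps2 K) := conv_mon K 0 0.
have czn m : conv (z ^+ m) by elim: m => [|m IH]; rewrite ?expr0 // exprS; exact: convM.
have [c c0 cX] := kernel_vector (\matrix_(k < n.+1, l < n) crd (z ^+ k) l) (ltnSn n).
have /existsP ex : [exists k, c 0 k != 0].
  apply: contraNT c0; rewrite negb_exists => /forallP H; apply/eqP/rowP => k; rewrite mxE.
  by apply/eqP; have := H k; rewrite negbK.
have {}ex : exists k, (k < n.+1)%N && (c 0 (inord k) != 0).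
  by case: ex => k ck; exists k; rewrite ltn_ord inord_val.
pose s := ex_minn ex; have sP : (s < n.+1)%N && (c 0 (inord s) != 0) by rewrite /s; case: ex_minnP.
have smin k : (k < s)%N -> c 0 (inord k) = 0.
  move=> ks; rewrite /s in ks; case: ex_minnP ks => m /andP[mn _] min_m km.
  by apply/eqP/negPn/negP => H; have := min_m k; rewrite H (ltn_trans km mn) leqNgt km => /(_ isT).
case/andP: sP => sn cs; exists s.
pose P := \sum_(k < n.+1) fps2_scale (c 0 k) (z ^+ k).
have cP : conv P by apply: conv_sum => k; exact: convZ.
have IP : I P.
  have := crdP cP; rewrite big1 ?subr0 // => k _; apply: fps2P => i j; rewrite fps2_scaleE.
  rewrite crd_sum //; have := congr1 (fun v : 'rV_n => v 0 k) cX; rewrite !mxE.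
  by under eq_bigr do rewrite mxE; move=> ->; rewrite mul0r.
pose w := \sum_(k < n.+1) (if (s < k)%N then fps2_scale (- (c 0 k / c 0 (inord s))) (z ^+ (k - s)) else 0).
have cw : conv w.
  apply: conv_sum => k; case: ifP => _; first exact: convZ.
  by apply: conv_fin; exists 0%N => i j; rewrite fps20E eqxx.
have w0 : w 0%N 0%N = 0.
  rewrite /w fps2_sumE big1 // => k _; case: ifP => // sk.
  rewrite fps2_scaleE; case: (k - s)%N (subn_gt0 s k) => [|m]; first by rewrite sk.
  by rewrite exprS fps2M00 z0 mul0r mulr0.
have PE : P = fps2_scale (c 0 (inord s)) (z ^+ s * (1 - w)).
  rewrite mulrBr mulr1 /w mulr_sumr; apply: fps2P => i j.
  rewrite fps2_scaleE fps2BE !fps2_sumE mulrBr mulr_sumr -sumrN.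
  rewrite /P fps2_sumE (bigD1 (Ordinal sn)) //= fps2_scaleE.
  have -> : Ordinal sn = inord s by apply: val_inj; rewrite /= inordK.
  congr (_ + _); rewrite big_mkcond /=; apply: eq_bigr => k _.
  case: (ltngtP s k) => [sk|ks|ks].
  - rewrite ifT; last by rewrite -val_eqE /= inordK // gtn_eqF.
    rewrite fps2_scaleE mulrC -[X in _ = - (_ * X)]/((z ^+ s * fps2_scale _ _) i j).
    rewrite [z ^+ s * _]mulrC fps2_scaleM -exprD subnK ?(ltnW sk) // fps2_scaleE.
    by field.
  - rewrite mulr0 fps20E mulr0 oppr0; case: ifP => // _.
    by rewrite fps2_scaleE -[k]inord_val smin ?mul0r.
  - rewrite mulr0 fps20E mulr0 oppr0 ifF //; apply/negbTE; rewrite negbK.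
    by apply/eqP/val_inj; rewrite /= inordK ?ks.
have [v cv wv] := conv_inv w0 cw.
have -> : z ^+ s = fps2_scale (c 0 (inord s))^-1 (v * P).
  rewrite PE [v * _]mulrC fps2_scaleM -mulrA wv mulr1.
  by apply: fps2P => i j; rewrite !fps2_scaleE mulrA mulVf ?mul1r.
by apply: I_Z; exact: conv_idealM.
Qed.

Let box_in_ideal : exists s, I (fps2_mon K s 0) /\ I (fps2_mon K 0 s).
Proof.
have mX m : fps2_mon K 1 0 ^+ m = fps2_mon K m 0.
  by elim: m => [//|m IH]; rewrite exprS IH fps2_monM.
have mY m : fps2_mon K 0 1 ^+ m = fps2_mon K 0 m.
  by elim: m => [//|m IH]; rewrite exprS IH fps2_monM.
have [||s1 I1] := power_in_ideal (z := fps2_mon K 1 0); [exact: conv_mon|by []|].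
have [||s2 I2] := power_in_ideal (z := fps2_mon K 0 1); [exact: conv_mon|by []|].
rewrite mX in I1; rewrite mY in I2; exists (s1 + s2)%N; split.
  have -> : fps2_mon K (s1 + s2) 0 = fps2_mon K s2 0 * fps2_mon K s1 0 by rewrite fps2_monM addnC.
  by apply: conv_idealM => //; exact: conv_mon.
have -> : fps2_mon K 0 (s1 + s2) = fps2_mon K 0 s1 * fps2_mon K 0 s2 by rewrite fps2_monM.
by apply: conv_idealM => //; exact: conv_mon.
Qed.

Variables (x y : K) (m1 m2 : nat).
Hypotheses (x_gt0 : 0 < x) (y_gt0 : 0 < y).
Hypothesis contraction : forall u B, bnd x y u B -> exists v,
  [/\ bnd x y v (B / 2), conv v &
   I (u - \sum_(i < m1) \sum_(j < m2) fps2_scale (u i j) (fps2_mon K i j) - v)].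

Lemma multiplicity_le : (n <= m1 * m2)%N.
Proof.
rewrite leqNgt; apply/negP => nm.
pose dec (k : 'I_(m1 * m2)) := fps2_mon K (k %/ m2) (k %% m2).
pose X : 'M[K]_(n, m1 * m2) := \matrix_(k, l) crd (dec l) k.
have [phi phi0 phiX] := kernel_vector X nm.
pose psi u := \sum_k phi 0 k * crd u k.
have psi_lin c u v : conv u -> conv v -> psi (fps2_scale c u + v) = c * psi u + psi v.
  move=> cu cv; rewrite /psi mulr_sumr -big_split /=; apply: eq_bigr => k _.
  by rewrite crd_lin //; ring.
have psi_I u : I u -> psi u = 0 by move=> Iu; apply: big1 => k _; rewrite crd_I ?mulr0.
have conv0 : conv (0 : fps2 K) by apply: conv_fin; exists 0%N => i j; rewrite fps20E eqxx.
have psiD u v : conv u -> conv v -> psi (u + v) = psi u + psi v.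
  move=> cu cv; rewrite -[psi u]mul1r -psi_lin //; congr (psi (_ + _)).
  by apply: fps2P => i j; rewrite fps2_scaleE mul1r.
have psi_sum m (u : 'I_m -> fps2 K) : (forall l, conv (u l)) -> psi (\sum_l u l) = \sum_l psi (u l).
  elim: m u => [|m IH] u cu; first by rewrite !big_ord0 psi_I.
  by rewrite !big_ord_recl psiD ?IH //; apply: conv_sum.
have psiZ c u : conv u -> psi (fps2_scale c u) = c * psi u.
  move=> cu; rewrite -[fps2_scale c u]addr0 psi_lin // [psi 0]psi_I ?addr0 //.
have psi_mon i j : (i < m1)%N -> (j < m2)%N -> psi (fps2_mon K i j) = 0.
  move=> im jm; have ijm : (i * m2 + j < m1 * m2)%N.
    have := leq_mul im (leqnn m2); rewrite mulSn; lia.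
  have := congr1 (fun v : 'rV_(m1 * m2) => v 0 (Ordinal ijm)) phiX; rewrite !mxE => H.
  rewrite -[RHS]H; apply: eq_bigr => k _; rewrite mxE /dec /=.
  by rewrite divnMDl ?(leq_ltn_trans _ jm) // divn_small // addn0 modnMDl modn_small.
have [s [IX IY]] := box_in_ideal.
pose tr (u : fps2 K) : fps2 K := \sum_(i < s) \sum_(j < s) fps2_scale (u i j) (fps2_mon K i j).
have ctr u : conv (tr u).
  by apply: conv_sum => i; apply: conv_sum => j; apply: convZ; exact: conv_mon.
have trE (u : fps2 K) i j : tr u i j = if (i < s)%N && (j < s)%N then u i j else 0.
  exact: fps2_boxE.
have psi_tr u : conv u -> psi u = psi (tr u).
  move=> cu; have -> : u = (u - tr u) + tr u by rewrite subrK.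
  rewrite psiD //; last exact: convB.
  rewrite [psi (u - _)]psi_I ?add0r ?subrK //; apply: (conv_ideal_box IX IY).
    exact: convB.
  by move=> i j is_ js; rewrite fps2BE trE is_ js subrr.
(* Modulo the ideal only the coefficients in a box of side s matter, so psi is continuous for the l1
   norm. Without this bound the repeated halving would prove nothing. *)
pose c := \sum_(i < s) \sum_(j < s) `|psi (fps2_mon K i j)| / (x ^+ i * y ^+ j).
have psi_bnd u B : conv u -> bnd x y u B -> `|psi u| <= c * B.
  move=> cu Hu; rewrite psi_tr // /tr psi_sum; last first.
    by move=> i; apply: conv_sum => j; apply: convZ; exact: conv_mon.
  rewrite mulr_suml; apply: le_trans (ler_norm_sum _ _ _) _; apply: ler_sum => i _.
  rewrite psi_sum; last by move=> j; apply: convZ; exact: conv_mon.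
  rewrite mulr_suml; apply: le_trans (ler_norm_sum _ _ _) _; apply: ler_sum => j _.
  have xy : 0 < x ^+ i * y ^+ j by rewrite mulr_gt0 ?exprn_gt0.
  rewrite psiZ; last exact: conv_mon.
  rewrite normrM mulrC -mulrA ler_wpM2l // mulrC ler_pdivlMr //.
  by apply: bnd_coef Hu; exact: ltW.
have psi0 u B : conv u -> bnd x y u B -> psi u = 0.
  move=> cu Hu; apply/eqP; rewrite -normr_eq0; apply/eqP; apply: (small (c := c * B)) => //.
  move=> N; elim: N u B cu Hu => [|N IH] u B cu Hu; first by rewrite expr0 mulr1 psi_bnd.
  have [v [Hv cv Iv]] := contraction Hu.
  set P := \sum_(i < m1) _ in Iv.
  have cP : conv P.
    by apply: conv_sum => i; apply: conv_sum => j; apply: convZ; exact: conv_mon.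
  have -> : psi u = psi v.
    have -> : u = (u - P - v) + (P + v) by ring.
    rewrite psiD; [|by apply: convB => //; exact: convB|exact: convD].
    suff psiP : psi P = 0 by rewrite (psi_I _ Iv) add0r psiD // psiP add0r.
    rewrite /P psi_sum => [|i]; last by apply: conv_sum => j; apply: convZ; exact: conv_mon.
    rewrite big1 // => i _; rewrite psi_sum => [|j]; last by apply: convZ; exact: conv_mon.
    by apply: big1 => j _; rewrite psiZ ?psi_mon ?mulr0 //; exact: conv_mon.
  rewrite exprS mulrCA [leLHS]mulrC -ler_pdivlMr // -mulrA; exact: IH.
(* The germ e k need not converge on the polydisc of radii x and y; its truncation does and has the
   same image under psi. *)
have phi_e k : phi 0 k = 0.
  have fin_tr : fin_supp (tr (e k)).
    by exists s => i j; rewrite trE; case: andP => // _; rewrite eqxx.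
  have [B HB] := bnd_fin_supp (ltW x_gt0) (ltW y_gt0) fin_tr.
  have := psi_tr _ (e_conv k); rewrite (psi0 (tr (e k)) B) // /psi (bigD1 k) //= crd_e eqxx mulr1.
  rewrite big1 ?addr0 // => l lk.
  by rewrite crd_e eq_sym (negPf lk) mulr0.
by move/negP: phi0; apply; apply/eqP/rowP => k; rewrite mxE phi_e.
Qed.

End Multiplicity.

(** * Division by the leading monomials of a perturbed gradient *)

Section Contraction.
Variable K : numFieldType.
Implicit Types (f g h u v : fps2 K).

Lemma bnd_conv (x y : K) u B : 0 < x -> 0 < y -> bnd x y u B -> conv u.
Proof.
move=> x0 y0 Hu; have c0 : 0 < x * y / (x + y) by rewrite divr_gt0 ?mulr_gt0 ?addr_gt0.
have xy : 0 < x + y by rewrite addr_gt0.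
exists (x * y / (x + y)) => //; exists B; apply: bnd_le Hu => //.
  by rewrite (ltW c0) /= ler_pdivrMr // ler_wpM2l ?lerDr ?(ltW x0) ?(ltW y0).
by rewrite (ltW c0) /= ler_pdivrMr // mulrC ler_wpM2l ?lerDl ?(ltW x0) ?(ltW y0).
Qed.

(* Division by the leading monomials: x^m1 divides the terms with i >= m1, and
   y^m2 those of the remaining ones with j >= m2. *)
Lemma division_contraction (x y : K) m1 m2 g h g' h' (c1 c2 : K) :
  0 < x -> 0 < y -> c1 != 0 -> c2 != 0 ->
  g = fps2_scale c1 (fps2_mon K m1 0 + g') -> h = fps2_scale c2 (fps2_mon K 0 m2 + h') ->
  bnd x y g' (x ^+ m1 / 4) -> bnd x y h' (y ^+ m2 / 4) ->
  forall u B, bnd x y u B -> exists v,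
  [/\ bnd x y v (B / 2), conv v &
   conv_ideal g h (u - \sum_(i < m1) \sum_(j < m2) fps2_scale (u i j) (fps2_mon K i j) - v)].
Proof.
move=> x0 y0 c10 c20 gE hE bg bh u B Hu.
pose a : fps2 K := fun i j => u (i + m1)%N j.
pose b : fps2 K := fun i j => if (i < m1)%N then u i (j + m2)%N else 0.
have Ha : bnd x y a (B / (x ^+ m1 * y ^+ 0)).
  by apply: bnd_shift Hu => // i j; rewrite addn0.
have Hb : bnd x y b (B / (x ^+ 0 * y ^+ m2)).
  by apply: bnd_shift Hu => // i j; rewrite /b addn0; case: ifP => // _; rewrite normr0.
rewrite expr0 mulr1 in Ha; rewrite expr0 mul1r in Hb.
have xm : x ^+ m1 != 0 by rewrite expf_neq0 // gt_eqF.
have ym : y ^+ m2 != 0 by rewrite expf_neq0 // gt_eqF.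
(* Each of the two divisions leaves at most a quarter of B. *)
have Hv : bnd x y (- (a * g' + b * h')) (B / 2).
  apply: bndN; have -> : B / 2 = B / x ^+ m1 * (x ^+ m1 / 4) + B / y ^+ m2 * (y ^+ m2 / 4).
    by field; rewrite xm ym.
  by apply: bndD; [exact: ltW..|apply: bndM|apply: bndM] => //; exact: ltW.
exists (- (a * g' + b * h')); split=> //; first exact: bnd_conv Hv.
exists (fps2_scale c1^-1 a), (fps2_scale c2^-1 b); split.
- by apply: convZ; exact: bnd_conv Ha.
- by apply: convZ; exact: bnd_conv Hb.
have -> : fps2_scale c1^-1 a * g = a * (fps2_mon K m1 0 + g').
  rewrite gE fps2_scaleM [a * _]mulrC fps2_scaleM [_ * a]mulrC.
  by apply: fps2P => i j; rewrite !fps2_scaleE mulrA mulVf ?mul1r.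
have -> : fps2_scale c2^-1 b * h = b * (fps2_mon K 0 m2 + h').
  rewrite hE fps2_scaleM [b * _]mulrC fps2_scaleM [_ * b]mulrC.
  by apply: fps2P => i j; rewrite !fps2_scaleE mulrA mulVf ?mul1r.
suff E : u = \sum_(i < m1) \sum_(j < m2) fps2_scale (u i j) (fps2_mon K i j) +
    (a * fps2_mon K m1 0 + b * fps2_mon K 0 m2) by rewrite {1}E; ring.
apply: fps2P => i j; rewrite fps2DE fps2_boxE fps2DE.
rewrite mulrC [b * _]mulrC !fps2_monE /= !subn0 andbT /a /b.
case: (ltnP i m1) => im /=; last by rewrite subnK // if_same addr0 add0r.
by case: (ltnP j m2) => jm; rewrite !add0r ?addr0 // subnK.
Qed.

(** Scaling the radii quasi-homogeneously by l gains l^w on terms of weight at least w. *)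
Lemma bnd_weight p q w (a l : K) u B : 0 <= a -> 0 <= l <= 1 ->
  (forall i j, u i j != 0 -> (w <= p * i + q * j)%N) ->
  bnd (a ^+ p) (a ^+ q) u B -> bnd ((l * a) ^+ p) ((l * a) ^+ q) u (l ^+ w * B).
Proof.
move=> a0 /andP[l0 l1] uw Hu n; have lw : 0 <= l ^+ w by rewrite exprn_ge0.
apply: le_trans (ler_wpM2l lw (Hu n)); rewrite mulr_sumr; apply: ler_sum => i _.
rewrite mulr_sumr; apply: ler_sum => j _; rewrite [leRHS]mulrCA.
have [->|/uw wij] := eqVneq (u i j) 0; first by rewrite normr0 !mul0r.
rewrite ler_wpM2l // -!exprM -!exprD exprMn ler_wpM2r ?exprn_ge0 //.
by rewrite ler_wiXn2l.
Qed.

Section Perturbation.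
Variables (p q : nat) (f : fps2 K) (r M : K).
Hypotheses (p_gt0 : (0 < p)%N) (q_gt0 : (0 < q)%N) (pq : coprime p q).
Hypotheses (r_gt0 : 0 < r) (f_bnd : bnd r r f M).
Hypothesis f_support : forall a b, f a b != 0 -> (p * q <= p * a + q * b)%N.
Hypotheses (fq : f q 0%N != 0) (fp : f 0%N p != 0).

Lemma coprime_segment i j : (p * i + q * j = p * q)%N ->
  (i, j) = (q, 0%N) \/ (i, j) = (0%N, p).
Proof.
move=> E; have qi : (q %| i)%N.
  rewrite -(@Gauss_dvdr q p) 1?coprime_sym //.
  have : (q %| p * i + q * j)%N by rewrite E dvdn_mull.
  by rewrite dvdn_addl // dvdn_mulr.
case/dvdnP: qi E => k ->; case: k => [|[|k]].
- rewrite mul0n muln0 add0n [RHS]mulnC => /eqP; rewrite eqn_pmul2l // => /eqP ->; by right.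
- rewrite mul1n => /eqP; rewrite -[X in _ == X]addn0 eqn_add2l muln_eq0 gtn_eqF //= => /eqP ->.
  by left.
- move=> E; have : (p * (k.+2 * q) <= p * q)%N by rewrite -E leq_addr.
  rewrite leq_pmul2l // -{2}(mul1n q) leq_pmul2r //.
Qed.

Lemma perturbation_contraction : exists x y : K, [/\ 0 < x, 0 < y &
  exists2 eta : K, 0 < eta & forall G, bnd r r (G - f) eta ->
  forall u B, bnd x y u B -> exists v,
  [/\ bnd x y v (B / 2), conv v &
   conv_ideal (fps2_dx G) (fps2_dy G)
     (u - \sum_(i < q.-1) \sum_(j < p.-1) fps2_scale (u i j) (fps2_mon K i j) - v)]].
Proof.
have [c1 c1E] : exists c, c = f q 0%N *+ q by eexists.
have [c2 c2E] : exists c, c = f 0%N p *+ p by eexists.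
have c10 : c1 != 0 by rewrite c1E mulrn_eq0 negb_or -lt0n q_gt0.
have c20 : c2 != 0 by rewrite c2E mulrn_eq0 negb_or -lt0n p_gt0.
pose U1 := fps2_dx f - fps2_scale c1 (fps2_mon K q.-1 0).
pose U2 := fps2_dy f - fps2_scale c2 (fps2_mon K 0 p.-1).
have U1w i j : U1 i j != 0 -> ((p * q.-1).+1 <= p * i + q * j)%N.
  rewrite /U1 fps2BE fps2_scaleE /fps2_dx /fps2_mon.
  case: (eqVneq (i, j) (q.-1, 0%N)) => [[-> ->]|ne].
    by rewrite !eqxx mulr1 prednK // c1E subrr eqxx.
  have -> : (i == q.-1) && (j == 0%N) = false.
    by apply: contraNF ne => /andP[/eqP -> /eqP ->].
  rewrite mulr0 subr0 mulrn_eq0 /= => /f_support; rewrite leq_eqVlt => /orP[/eqP/esym/coprime_segment|].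
    by case=> -[Ei Ej] //; case/negP: ne; rewrite -Ei Ej.
  by case: (q) q_gt0 => // q' _; rewrite !mulnS /=; lia.
have U2w i j : U2 i j != 0 -> ((q * p.-1).+1 <= p * i + q * j)%N.
  rewrite /U2 fps2BE fps2_scaleE /fps2_dy /fps2_mon.
  case: (eqVneq (i, j) (0%N, p.-1)) => [[-> ->]|ne].
    by rewrite !eqxx mulr1 prednK // c2E subrr eqxx.
  have -> : (i == 0%N) && (j == p.-1) = false.
    by apply: contraNF ne => /andP[/eqP -> /eqP ->].
  rewrite mulr0 subr0 mulrn_eq0 /= => /f_support; rewrite leq_eqVlt => /orP[/eqP/esym/coprime_segment|].
    by case=> -[Ei Ej] //; case/negP: ne; rewrite -Ej Ei.
  by case: (p) p_gt0 => // p' _; rewrite !mulnS !mulSn /=; lia.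
have r2r : r / 2 <= r by rewrite ler_pdivrMr // ler_peMr ?ler1n ?(ltW r_gt0).
(* a common radius a with a^p, a^q <= r / 2 *)
pose a := r / (r + 2); have ra : 0 < r + 2 by rewrite addr_gt0.
have a0 : 0 < a by rewrite divr_gt0.
have a1 : a <= 1 by rewrite ler_pdivrMr // mul1r lerDl.
have ar : a <= r / 2 by rewrite ler_wpM2l ?(ltW r_gt0) // lef_pV2 ?posrE // lerDr ltW.
have aE n : (0 < n)%N -> 0 < a ^+ n <= r / 2.
  by move=> n0; rewrite exprn_gt0 // (le_trans _ ar) // -{2}[a]expr1 ler_wiXn2l ?(ltW a0).
have b1 : exists B, bnd (a ^+ p) (a ^+ q) U1 B.
  have [B HB] : exists B, bnd (a ^+ p) (a ^+ q) (fps2_scale c1 (fps2_mon K q.-1 0)) B.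
    have [B HB] := bnd_fin_supp (ltW (andP (aE p p_gt0)).1) (ltW (andP (aE q q_gt0)).1) (fin_supp_mon K q.-1 0).
    by exists (`|c1| * B); exact: bndZ.
  exists (M / r + B); apply: bndD; [by rewrite exprn_ge0 ?(ltW a0)..| |exact: bndN].
  have [/andP[h1 h2] /andP[h3 h4]] := (aE p p_gt0, aE q q_gt0).
  apply: bnd_le (bnd_dx r_gt0 r_gt0 f_bnd) => //; first by rewrite (ltW h1).
  by rewrite (ltW h3) (le_trans h4).
have b2 : exists B, bnd (a ^+ p) (a ^+ q) U2 B.
  have [B HB] : exists B, bnd (a ^+ p) (a ^+ q) (fps2_scale c2 (fps2_mon K 0 p.-1)) B.
    have [B HB] := bnd_fin_supp (ltW (andP (aE p p_gt0)).1) (ltW (andP (aE q q_gt0)).1) (fin_supp_mon K 0 p.-1).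
    by exists (`|c2| * B); exact: bndZ.
  exists (M / r + B); apply: bndD; [by rewrite exprn_ge0 ?(ltW a0)..| |exact: bndN].
  have [/andP[h1 h2] /andP[h3 h4]] := (aE p p_gt0, aE q q_gt0).
  apply: bnd_le (bnd_dy r_gt0 r_gt0 f_bnd) => //; first by rewrite (ltW h1) (le_trans h2).
  by rewrite (ltW h3).
have [B1 HB1] := b1; have [B2 HB2] := b2.
have B10 := bnd_ge0 HB1; have B20 := bnd_ge0 HB2.
pose w1 := (p * q.-1)%N; pose w2 := (q * p.-1)%N.
have nc1 : 0 < `|c1| by rewrite normr_gt0.
have nc2 : 0 < `|c2| by rewrite normr_gt0.
pose d1 := `|c1| * a ^+ w1 / 8; pose d2 := `|c2| * a ^+ w2 / 8.
have d10 : 0 < d1 by rewrite !mulr_gt0 ?exprn_gt0 ?invr_gt0.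
have d20 : 0 < d2 by rewrite !mulr_gt0 ?exprn_gt0 ?invr_gt0.
(* The spare factor l in [bnd_weight] brings U1 and U2 below an eighth of the leading terms; the sum
   in the denominator stands in for a maximum. *)
pose l := (1 + B1 / d1 + B2 / d2)^-1.
have q1 : 0 <= B1 / d1 by rewrite divr_ge0 ?(ltW d10).
have q2 : 0 <= B2 / d2 by rewrite divr_ge0 ?(ltW d20).
have s0 : 0 < 1 + B1 / d1 + B2 / d2 by rewrite -addrA ltr_wpDr ?addr_ge0.
have l0 : 0 < l by rewrite invr_gt0.
have l1 : l <= 1 by rewrite invf_le1 // -addrA lerDl addr_ge0.
have lB1 : l * B1 <= d1.
  rewrite /l mulrC ler_pdivrMr // !mulrDr mulr1 mulrCA divff ?gt_eqF // mulr1.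
  by rewrite addrAC lerDr addr_ge0 ?(ltW d10) // mulr_ge0 ?(ltW d10).
have lB2 : l * B2 <= d2.
  rewrite /l mulrC ler_pdivrMr // !mulrDr mulr1 [d2 * (B2 / d2)]mulrCA divff ?gt_eqF // mulr1.
  by rewrite lerDr addr_ge0 ?(ltW d20) // mulr_ge0 ?(ltW d20).
pose x := (l * a) ^+ p; pose y := (l * a) ^+ q.
have la0 : 0 < l * a by rewrite mulr_gt0.
have x0 : 0 < x by rewrite exprn_gt0.
have y0 : 0 < y by rewrite exprn_gt0.
have laE n : (0 < n)%N -> 0 <= (l * a) ^+ n <= r / 2.
  move=> n0; rewrite exprn_ge0 ?(ltW la0) //=; case/andP: (aE n n0) => _; apply: le_trans.
  by rewrite lerXn2r ?nnegrE ?(ltW la0) ?(ltW a0) // ler_piMl ?(ltW a0).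
have l01 : 0 <= l <= 1 by rewrite (ltW l0).
have HU1 := bnd_weight (ltW a0) l01 U1w HB1.
have HU2 := bnd_weight (ltW a0) l01 U2w HB2.
(* The other eighth is left to the perturbation; the factor r cancels the quotient in [bnd_dx] and
   [bnd_dy]. *)
pose eta1 := r * (`|c1| * x ^+ q.-1 / 8); pose eta2 := r * (`|c2| * y ^+ p.-1 / 8).
have e10 : 0 < eta1 by rewrite !mulr_gt0 ?exprn_gt0 ?invr_gt0.
have e20 : 0 < eta2 by rewrite !mulr_gt0 ?exprn_gt0 ?invr_gt0.
exists x, y; split=> //; exists (eta1 * eta2 / (eta1 + eta2)); first exact: divr_gt0 (mulr_gt0 e10 e20) (addr_gt0 e10 e20).
move=> G HG; have es : 0 < eta1 + eta2 by rewrite addr_gt0.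
have HG1 : bnd r r (G - f) eta1.
  by apply: bnd_weaken HG; rewrite ler_pdivrMr // ler_wpM2l ?lerDr ?(ltW e10) ?(ltW e20).
have HG2 : bnd r r (G - f) eta2.
  by apply: bnd_weaken HG; rewrite ler_pdivrMr // mulrC ler_wpM2l ?lerDl ?(ltW e10) ?(ltW e20).
pose g' := fps2_scale c1^-1 (U1 + fps2_dx (G - f)).
pose h' := fps2_scale c2^-1 (U2 + fps2_dy (G - f)).
apply: (@division_contraction x y q.-1 p.-1 _ _ g' h' c1 c2) => //.
- apply: fps2P => i j; rewrite /g' /U1 !(fps2_scaleE, fps2NE, fps2DE).
  rewrite /fps2_dx fps2BE mulrnBl; field; exact: c10.
- apply: fps2P => i j; rewrite /h' /U2 !(fps2_scaleE, fps2NE, fps2DE).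
  rewrite /fps2_dy fps2BE mulrnBl; field; exact: c20.
- have -> : x ^+ q.-1 / 4 = `|c1^-1| * (`|c1| * x ^+ q.-1 / 8 + eta1 / r).
    by rewrite /eta1 normfV; field; rewrite !gt_eqF.
  apply: bndZ; apply: bndD; [exact: ltW..| |].
    apply: bnd_weaken HU1; rewrite exprSr -mulrA.
    apply: le_trans (ler_wpM2l _ lB1) _; first by rewrite exprn_ge0 ?(ltW l0).
    have -> : x ^+ q.-1 = l ^+ w1 * a ^+ w1 by rewrite /x -exprM exprMn.
    by rewrite /d1 le_eqVlt; apply/orP; left; apply/eqP; move: (l ^+ w1) (a ^+ w1) => *; ring.
  apply: bnd_le (bnd_dx r_gt0 r_gt0 HG1) => //; first exact: laE.
  by case/andP: (laE q q_gt0) => -> /le_trans ->.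
have -> : y ^+ p.-1 / 4 = `|c2^-1| * (`|c2| * y ^+ p.-1 / 8 + eta2 / r).
  by rewrite /eta2 normfV; field; rewrite !gt_eqF.
apply: bndZ; apply: bndD; [exact: ltW..| |].
  apply: bnd_weaken HU2; rewrite exprSr -mulrA.
  apply: le_trans (ler_wpM2l _ lB2) _; first by rewrite exprn_ge0 ?(ltW l0).
  have -> : y ^+ p.-1 = l ^+ w2 * a ^+ w2 by rewrite /y -exprM exprMn.
  by rewrite /d2 le_eqVlt; apply/orP; left; apply/eqP; move: (l ^+ w2) (a ^+ w2) => *; ring.
apply: bnd_le (bnd_dy r_gt0 r_gt0 HG2) => //; last exact: laE.
by case/andP: (laE p p_gt0) => -> /le_trans ->.
Qed.

End Perturbation.
End Contraction.

(** * Slices of a germ in three variables *)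

Section Slices.
Variable K : numFieldType.
Hypothesis complete : abs_complete K.

Lemma cvgn_sum (I : Type) (s : seq I) (u : I -> nat -> K) (l : I -> K) :
  (forall i, u i @ \oo --> l i) ->
  (fun n => \sum_(i <- s) u i n) @ \oo --> \sum_(i <- s) l i.
Proof.
move=> H; elim: s => [|a s IH].
  have -> : (fun n => \sum_(i <- [::]) u i n) = (fun=> 0) by apply/funext => n; rewrite big_nil.
  by rewrite big_nil; exact: cvg_cst.
have -> : (fun n => \sum_(i <- a :: s) u i n) = (fun n => u a n + \sum_(i <- s) u i n).
  by apply/funext => n; rewrite big_cons.
by rewrite big_cons; apply: cvgD.
Qed.

(** The premise [0 <= l] makes l comparable with M in the partial order, so that one can argue by
    contradiction. *)
Lemma cvgn_le (u : nat -> K) (l M : K) : u @ \oo --> l -> 0 <= l ->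
  (forall n, 0 <= u n <= M) -> l <= M.
Proof.
move=> ul l0 uM; have M0 : 0 <= M by have /andP[h1 h2] := uM 0%N; exact: le_trans h1 h2.
rewrite real_leNgt ?ger0_real //; apply/negP => Ml.
have e0 : 0 < l - M by rewrite subr_gt0.
have [N _ HN] := (cvgrPdist_lt _ _).1 ul _ e0.
have := HN N (leqnn N); have /andP[h1 h2] := uM N.
rewrite /= ger0_norm ?subr_ge0; last exact: le_trans h2 (ltW Ml).
by rewrite ltrD2l ltrN2 => /(le_lt_trans h2); rewrite ltxx.
Qed.

Definition slice3 (F : nat -> nat -> nat -> K) (t : K) : fps2 K := fun i j =>
  limn (fun n : nat => \sum_(k < n) F k i j * t ^+ k).

Lemma slice3_0 F i j : slice3 F 0 i j = F 0%N i j.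
Proof.
apply: (lim_near_cst (@norm_hausdorff _ K)); exists 1%N => // n /= n0.
rewrite (@sum_ord_only _ n 0 (fun k => F k i j * 0 ^+ k)) ?n0 ?expr0 ?mulr1 //.
by move=> k _ /negPf k0; rewrite expr0n k0 mulr0.
Qed.

Variables (F : nat -> nat -> nat -> K) (r M : K).
Hypothesis r0 : 0 < r.
Hypothesis F_bnd : forall n, \sum_(k < n) \sum_(i < n) \sum_(j < n)
  `|F k i j| * r ^+ (k + i + j) <= M.

Let G k i j := `|F k i j| * r ^+ (k + i + j).
Let G0 k i j : 0 <= G k i j.
Proof. by rewrite mulr_ge0 ?exprn_ge0 ?(ltW r0). Qed.

Let box_le m n : \sum_(k < m) \sum_(i < n) \sum_(j < n) G k i j <= M.
Proof.
apply: le_trans (F_bnd (m + n)); rewrite -/G.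
apply: (@sum_widen_le _ m n (fun k => \sum_(i < n) \sum_(j < n) G k i j)
  (fun k => \sum_(i < m + n) \sum_(j < m + n) G k i j)) => [k _|k]; last by do 2!(apply: sumr_ge0 => ? _).
rewrite addnC; apply: (@sum_widen_le _ n m (fun i => \sum_(j < n) G k i j)
  (fun i => \sum_(j < n + m) G k i j)) => [i _|i]; last exact: sumr_ge0.
exact: (@sum_widen_le _ n m (G k i) (G k i)).
Qed.

Variable t : K.
Hypothesis tr : `|t| <= r.

Let term_le k i j : `|F k i j * t ^+ k| * r ^+ (i + j) <= G k i j.
Proof.
have -> : G k i j = `|F k i j| * r ^+ k * r ^+ (i + j) by rewrite /G -mulrA -exprD addnA.
rewrite normrM normrX ler_wpM2r ?exprn_ge0 ?(ltW r0) // ler_wpM2l //.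
by rewrite lerXn2r ?nnegrE // ltW.
Qed.

Let slice_cvg i j : (fun n => \sum_(k < n) F k i j * t ^+ k) @ \oo --> slice3 F t i j.
Proof.
apply: (@complete (fun k => F k i j * t ^+ k) (M / r ^+ (i + j))) => n.
rewrite ler_pdivlMr ?exprn_gt0 // mulr_suml.
apply: le_trans (box_le n (i + j).+1); apply: ler_sum => k _.
apply: le_trans (term_le k i j) _.
have iN : (i < (i + j).+1)%N by rewrite ltnS leq_addr.
have jN : (j < (i + j).+1)%N by rewrite ltnS leq_addl.
rewrite (bigD1 (Ordinal iN)) //= (bigD1 (Ordinal jN)) //= -addrA lerDl.
by rewrite addr_ge0 ?sumr_ge0 // => *; exact: sumr_ge0.
Qed.

(** Every term with k > 0 carries |t|^k, which is at most (|t| / r) r^k. *)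
Lemma slice_bnd : bnd r r (slice3 F t - (F 0%N : fps2 K)) (`|t| / r * M).
Proof.
(* Summing up to k = m inclusive keeps the term k = 0 present, so that it cancels against F 0. *)
move=> n; pose u m := \sum_(i < n) \sum_(j < n)
  `|(\sum_(k < m.+1) F k i j * t ^+ k) - F 0%N i j| * (r ^+ i * r ^+ j).
have c i j : (fun m => `|(\sum_(k < m.+1) F k i j * t ^+ k) - F 0%N i j| * (r ^+ i * r ^+ j))
    @ \oo --> `|(slice3 F t - (F 0%N : fps2 K)) i j| * (r ^+ i * r ^+ j).
  apply: cvgM; last exact: cvg_cst.
  apply: cvg_norm; apply: cvgB; last exact: cvg_cst.
  have := @slice_cvg i j; rewrite -cvg_shiftS; exact.
have cu : u @ \oo --> \sum_(i < n) \sum_(j < n)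
    `|(slice3 F t - (F 0%N : fps2 K)) i j| * (r ^+ i * r ^+ j).
  apply: (cvgn_sum (u := fun (i : 'I_n) m => \sum_(j < n)
    `|(\sum_(k < m.+1) F k i j * t ^+ k) - F 0%N i j| * (r ^+ i * r ^+ j))) => i.
  exact: (cvgn_sum (u := fun (j : 'I_n) m =>
    `|(\sum_(k < m.+1) F k i j * t ^+ k) - F 0%N i j| * (r ^+ i * r ^+ j))).
have rr i j : 0 <= r ^+ i * r ^+ j by rewrite mulr_ge0 ?exprn_ge0 ?(ltW r0).
apply: (cvgn_le cu).
  by apply: sumr_ge0 => i _; apply: sumr_ge0 => j _; rewrite mulr_ge0.
move=> m; apply/andP; split.
  by apply: sumr_ge0 => i _; apply: sumr_ge0 => j _; rewrite mulr_ge0.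
have tr0 : 0 <= `|t| / r by rewrite divr_ge0 ?(ltW r0).
apply: (@le_trans _ _ (`|t| / r * \sum_(k < m) \sum_(i < n) \sum_(j < n) G k.+1 i j)); last first.
  rewrite ler_wpM2l //; apply: le_trans (box_le m.+1 n); rewrite big_ord_recl /= lerDr.
  by apply: sumr_ge0 => i _; exact: sumr_ge0.
rewrite mulr_sumr.
under [leRHS]eq_bigr do rewrite mulr_sumr.
rewrite [leRHS]exchange_big /=; apply: ler_sum => i _.
under [leRHS]eq_bigr do rewrite mulr_sumr.
rewrite [leRHS]exchange_big /=; apply: ler_sum => j _.
rewrite big_ord_recl /= expr0 mulr1 addrC addKr.
apply: le_trans (ler_wpM2r (rr i j) (ler_norm_sum _ _ _)) _.
rewrite mulr_suml; apply: ler_sum => k _; rewrite /bump /= add1n.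
have -> : G k.+1 i j = `|F k.+1 i j| * (r * r ^+ k) * (r ^+ i * r ^+ j).
  by rewrite /G !exprD exprS; ring.
have -> : `|t| / r * (`|F k.+1 i j| * (r * r ^+ k) * (r ^+ i * r ^+ j)) =
  `|F k.+1 i j| * (`|t| * r ^+ k) * (r ^+ i * r ^+ j) by field; rewrite gt_eqF.
rewrite normrM normrX ler_wpM2r // ler_wpM2l // exprS ler_wpM2l //.
by rewrite lerXn2r ?nnegrE // ltW.
Qed.

End Slices.

Local Open Scope nat_scope.

(** * Lattice paths *)

Implicit Types (w : nat * nat) (l : seq (nat * nat)).

(** The determinant of the two steps is non-negative. A zero step breaks transitivity, hence
    [pairwise] rather than [sorted] below. *)
Definition turn_le w w' := w.2 * w'.1 <= w.1 * w'.2.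
Definition turn_lt w w' := w.2 * w'.1 < w.1 * w'.2.
Definition sum1 l := \sum_(w <- l) w.1.
Definition sum2 l := \sum_(w <- l) w.2.

(* Twice the area between the path with steps l and its chord. *)
Fixpoint path_area l : int := if l is w :: l' then
  (w.1%:Z * (sum2 l')%:Z - w.2%:Z * (sum1 l')%:Z + path_area l')%R else 0%R.

Lemma sum1_cons w l : sum1 (w :: l) = w.1 + sum1 l.
Proof. by rewrite /sum1 big_cons. Qed.

Lemma sum2_cons w l : sum2 (w :: l) = w.2 + sum2 l.
Proof. by rewrite /sum2 big_cons. Qed.

Lemma sum1_nil : sum1 [::] = 0. Proof. by rewrite /sum1 big_nil. Qed.
Lemma sum2_nil : sum2 [::] = 0. Proof. by rewrite /sum2 big_nil. Qed.

Lemma turn_lt_trans u v w : turn_lt u v -> turn_lt v w -> turn_lt u w.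
Proof.
case: u v w => [u1 u2] [v1 v2] [w1 w2]; rewrite /turn_lt /= => uv vw.
have v10 : 0 < v1 by case: v1 uv vw => // _; rewrite mul0n ltn0.
rewrite -(ltn_pmul2l v10).
apply: (@leq_ltn_trans (u1 * v2 * w1)).
  by rewrite mulnA (mulnC v1) leq_mul2r ltnW ?orbT.
have u10 : 0 < u1 by case: u1 uv => //; rewrite mul0n.
by rewrite (mulnCA v1) -mulnA ltn_pmul2l.
Qed.

(* Parallel consecutive steps can be merged. *)
Lemma strict_path l : pairwise turn_le l -> exists l',
  [/\ pairwise turn_lt l', all (fun w => 0 < w.1 + w.2) l',
     sum1 l' = sum1 l /\ sum2 l' = sum2 l, path_area l' = path_area l
   & forall w, all (turn_le w) l -> all (turn_le w) l'].
Proof.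
elim: l => [|w l IH] /=; first by exists [::].
case/andP=> wl /IH[l' [lt' nz' [E1 E2] Ea Hle]].
have [w0|w_gt0] := posnP (w.1 + w.2).
  have [w1 w2] : w.1 = 0 /\ w.2 = 0 by lia.
  exists l'; split=> //; first by rewrite sum1_cons sum2_cons w1 w2.
    by rewrite w1 w2 !mul0r subrr add0r.
  by move=> v /andP[_]; exact: Hle.
case: l' lt' nz' E1 E2 Ea Hle => [|v l'] lt' nz' E1 E2 Ea Hle.
  exists [:: w]; split=> //=; rewrite ?w_gt0 //.
  - by rewrite !sum1_cons !sum2_cons -E1 -E2 sum1_nil sum2_nil.
  - by rewrite -E1 -E2 -Ea sum1_nil sum2_nil.
  - by move=> u /andP[-> _].
move: lt' nz' => /= /andP[vl' lt'] /andP[v_gt0 nz'].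
(* The last conjunct of the induction hypothesis compares w with the merged steps; equality with the
   first of them is the parallel case. *)
have := Hle w wl; rewrite /= => /andP[]; rewrite /turn_le leq_eqVlt => /orP[/eqP Ewv|wv] wl'.
  exists ((w.1 + v.1, w.2 + v.2) :: l'); split=> //=.
  - rewrite lt' andbT; apply/allP => u ul'.
    have := allP vl' u ul'; have := allP wl' u ul'; rewrite /turn_lt /turn_le /=; nia.
  - by rewrite nz' andbT; lia.
  - by rewrite !sum1_cons !sum2_cons -E1 -E2 !sum1_cons !sum2_cons /= !addnA.
  - rewrite -Ea -E1 -E2 !sum1_cons !sum2_cons /= !PoszD.
    have : (w.2%:Z * v.1%:Z = w.1%:Z * v.2%:Z)%R by rewrite -!PoszM Ewv.
    move=> E; rewrite -[X in (_ = X)%R]addr0 -(subrr (w.1%:Z * v.2%:Z))%R -{1}E; ring.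
  - move=> u /andP[uw ul]; have /andP[uv ul'] := Hle u ul.
    apply/andP; split; last exact: ul'.
    by move: uw uv; rewrite /turn_le /=; nia.
exists (w :: v :: l'); split=> //=.
- rewrite vl' lt' !andbT; apply/andP; split; first exact: wv.
  apply/allP => u ul'.
  exact: turn_lt_trans wv (allP vl' u ul').
- by rewrite w_gt0 v_gt0 nz'.
- by rewrite !sum1_cons !sum2_cons -E1 -E2 !sum1_cons !sum2_cons.
- by rewrite -Ea -E1 -E2.
- by move=> u /andP[uw /Hle/= uv]; apply/andP.
Qed.

Definition path_exists a b k := exists l, [/\ pairwise turn_le l, sum1 l = a, sum2 l = b
  & path_area l = k%:Z%R].

Lemma sqrt_bounds n : exists c, c * c <= n < c.+1 * c.+1.
Proof.
elim: n => [|n [c /andP[h1 h2]]]; first by exists 0.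
have [lt|ge] := ltnP n.+1 (c.+1 * c.+1); first by exists c; lia.
by exists c.+1; nia.
Qed.

(** The shear (a, b) -> (a + b, b) has determinant 1 and so preserves turns and areas. *)
Lemma path_shear1 a b k : path_exists a b k -> path_exists (a + b) b k.
Proof.
rewrite /path_exists => -[l [ple <- <- <-]]; exists (map (fun w => (w.1 + w.2, w.2)) l).
elim: l ple => [|w l IH] /=; first by rewrite sum1_nil sum2_nil.
case/andP=> wl /IH[ple E1 E2 Ea]; split.
- rewrite ple andbT all_map; apply: sub_all wl => u; rewrite /turn_le /=; nia.
- by rewrite !sum1_cons sum2_cons E1 /=; lia.
- by rewrite !sum2_cons E2.
- by rewrite E1 E2 Ea /= !PoszD; ring.
Qed.

Lemma path_shear2 a b k : path_exists a b k -> path_exists a (a + b) k.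
Proof.
rewrite /path_exists => -[l [ple <- <- <-]]; exists (map (fun w => (w.1, w.1 + w.2)) l).
elim: l ple => [|w l IH] /=; first by rewrite sum1_nil sum2_nil.
case/andP=> wl /IH[ple E1 E2 Ea]; split.
- rewrite ple andbT all_map; apply: sub_all wl => u; rewrite /turn_le /=; nia.
- by rewrite !sum1_cons E1.
- by rewrite !sum2_cons sum1_cons E2 /=; lia.
- by rewrite E1 E2 Ea /= !PoszD; ring.
Qed.

Lemma path4 (w1 w2 w3 w4 : nat * nat) a b k :
  [&& turn_le w1 w2, turn_le w1 w3, turn_le w1 w4, turn_le w2 w3, turn_le w2 w4 & turn_le w3 w4] ->
  w1.1 + w2.1 + w3.1 + w4.1 = a -> w1.2 + w2.2 + w3.2 + w4.2 = b ->
  w1.1 * (w2.2 + w3.2 + w4.2) + w2.1 * (w3.2 + w4.2) + w3.1 * w4.2 =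
  k + w1.2 * (w2.1 + w3.1 + w4.1) + w2.2 * (w3.1 + w4.1) + w3.2 * w4.1 ->
  path_exists a b k.
Proof.
case/and5P=> h12 h13 h14 h23 /andP[h24 h34] <- <- E; exists [:: w1; w2; w3; w4]; split.
- by rewrite /= h12 h13 h14 h23 h24 h34.
- by rewrite !sum1_cons sum1_nil; lia.
- by rewrite !sum2_cons sum2_nil; lia.
rewrite /= !sum1_cons !sum2_cons sum1_nil sum2_nil.
have := congr1 Posz E; rewrite !(PoszD, PoszM); lia.
Qed.

(* Four steps suffice: with c^2 <= n < (c + 1)^2, the path cuts a region of
   double area n off the corner of the rectangle with sides a and b. *)
Lemma path_small_triangle a b n : a < b -> n < a * a -> path_exists a b (a * b - n).
Proof.
move=> ab na; have [c /andP[c1 c2]] := sqrt_bounds n.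
have ca : c < a by rewrite ltnNge; apply/negP => /(fun H => leq_mul H H); lia.
have [a' Ea] : exists a', a = c.+1 + a' by exists (a - c.+1); rewrite subnKC.
have [b' Eb] : exists b', b = c.+2 + b' by exists (b - c.+2); rewrite subnKC // (leq_ltn_trans ca).
have [s Es] : exists s, n = c * c + s by exists (n - c * c); rewrite subnKC.
have [sc|sc] := leqP s c.
  (* The steps (d, d) and (s, s+1) cut off a corner of width c and height c + 1. Their bend has
     determinant d, so the double area removed is c (c + 1) - d = n. *)
  have [d Ed] : exists d, c = s + d by exists (c - s); rewrite subnKC.
  apply: (@path4 (a'.+1, 0) (d, d) (s, s.+1) (0, b'.+1)) => /=;
    first [lia | by rewrite /turn_le /=; repeat (apply/andP; split); nia].
have [s' Es'] : exists s', s = c + s'.+1 by exists (s - c.+1); lia.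
have [d Ed] : exists d, c = s'.+1 + d by exists (c - s'.+1); lia.
(* Here the corner has width c + 1 and height c + 2, and the bend has determinant 2 d + s' + 3. *)
apply: (@path4 (a', 0) (d.+1, d) (s'.+1, s'.+3) (0, b')) => /=;
    first [lia | by rewrite /turn_le /=; repeat (apply/andP; split); nia].
Qed.

(** The mirror image in the diagonal of the previous construction; the reflection also reverses the
    order of the steps. *)
Lemma path_small_triangle' a b n : b < a -> n < b * b -> path_exists a b (a * b - n).
Proof.
move=> ab na; have [c /andP[c1 c2]] := sqrt_bounds n.
have ca : c < b by rewrite ltnNge; apply/negP => /(fun H => leq_mul H H); lia.
have [a' Ea] : exists a', b = c.+1 + a' by exists (b - c.+1); rewrite subnKC.
have [b' Eb] : exists b', a = c.+2 + b' by exists (a - c.+2); rewrite subnKC // (leq_ltn_trans ca).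
have [s Es] : exists s, n = c * c + s by exists (n - c * c); rewrite subnKC.
have [sc|sc] := leqP s c.
  have [d Ed] : exists d, c = s + d by exists (c - s); rewrite subnKC.
  apply: (@path4 (b'.+1, 0) (s.+1, s) (d, d) (0, a'.+1)) => /=;
    first [lia | by rewrite /turn_le /=; repeat (apply/andP; split); nia].
have [s' Es'] : exists s', s = c + s'.+1 by exists (s - c.+1); lia.
have [d Ed] : exists d, c = s'.+1 + d by exists (c - s'.+1); lia.
apply: (@path4 (b', 0) (s'.+3, s'.+1) (d, d.+1) (0, a')) => /=;
    first [lia | by rewrite /turn_le /=; repeat (apply/andP; split); nia].
Qed.

(** For a < b, either k <= a (b - a) and a path for (a, b - a) can be sheared, or the missing area a
    b - k is below a^2 and is cut off at a corner. Coprimality makes the descent end at (1, 1). *)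
Lemma coprime_path_exists a b k : 0 < a -> 0 < b -> coprime a b -> k <= a * b ->
  path_exists a b k.
Proof.
have [m] := ubnP (a + b); elim: m a b k => [//|m IH] a b k; rewrite ltnS => abm a0 b0 cop kab.
have [ab|ba|ab] := ltngtP a b.
- have cop' : coprime a (b - a) by move: cop; rewrite -{1}(subnKC (ltnW ab)) /coprime gcdnDl.
  have [k1|k1] := leqP k (a * (b - a)).
    rewrite -(subnKC (ltnW ab)); apply: path_shear2; apply: IH => //; last by rewrite subn_gt0.
    by lia.
  rewrite -(subKn kab); apply: path_small_triangle => //.
  have := mulnBr a b a; nia.
- have cop' : coprime (a - b) b.
    by move: cop; rewrite -{1}(subnKC (ltnW ba)) /coprime gcdnC gcdnDl gcdnC.
  have [k1|k1] := leqP k ((a - b) * b).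
    rewrite -(subnK (ltnW ba)); apply: path_shear1; apply: IH => //; last by rewrite subn_gt0.
    by lia.
  rewrite -(subKn kab); apply: path_small_triangle' => //.
  have := mulnBl a b b; nia.
have {}ab : a = b by [].
have a1 : a = 1 by move: cop; rewrite ab /coprime gcdnn => /eqP ->.
rewrite -ab a1 in kab *; case: k kab => [|[|//]] _.
  by exists [:: (1, 1)]; split; rewrite //= ?sum1_cons ?sum2_cons ?sum1_nil ?sum2_nil.
by exists [:: (1, 0); (0, 1)]; split; rewrite //= ?sum1_cons ?sum2_cons ?sum1_nil ?sum2_nil.
Qed.

(** * The polygon of a convex lattice path *)

Section PathPolygon.
Variable l : seq (nat * nat).
Hypothesis l_convex : pairwise (fun w w' => w.1 * w'.2 < w'.1 * w.2) l.
Hypothesis l_pos : all (fun w => (0 < w.1) && (0 < w.2)) l.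
Hypothesis l_nil : l != [::].

(** The path is drawn from (0, p) down to (q, 0): second components are descents, so the height at a
    vertex is the sum of those still to come. *)
Definition path_x e := sum1 (take e l).
Definition path_y e := sum2 (drop e l).
Local Notation st e := (nth (0, 0) l e).
Definition path_delta e := (st e).1 * path_y e + path_x e * (st e).2.
(** A common multiple of the edge constants, by which all edge forms are scaled to the same
    value. *)
Definition path_D := \prod_(e < size l) path_delta e.
Definition path_al e := path_D %/ path_delta e * (st e).2.
Definition path_be e := path_D %/ path_delta e * (st e).1.

Let xS e : e < size l -> path_x e.+1 = path_x e + (st e).1.
Proof. by move=> es; rewrite /path_x (take_nth (0, 0) es) /sum1 -cats1 big_cat big_seq1. Qed.

Let yS e : e < size l -> path_y e = (st e).2 + path_y e.+1.
Proof. by move=> es; rewrite /path_y (drop_nth (0, 0) es) sum2_cons. Qed.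

Let st_pos e : e < size l -> (0 < (st e).1) /\ (0 < (st e).2).
Proof. by move=> es; apply/andP; apply: (allP l_pos); exact: mem_nth. Qed.

Let st_lt e e' : e < e' -> e' < size l -> (st e).1 * (st e').2 < (st e').1 * (st e).2.
Proof.
move=> ee es; have /(pairwiseP (0, 0)) H := l_convex.
by apply: H => //; rewrite inE // (ltn_trans ee).
Qed.

Let deltaP e : e < size l -> 0 < path_delta e.
Proof.
move=> es; rewrite /path_delta (yS es).
by have [h1 h2] := st_pos es; rewrite addn_gt0 muln_gt0 h1 addn_gt0 h2.
Qed.

Let D_dvd e : e < size l -> path_D %/ path_delta e * path_delta e = path_D.
Proof.
by move=> es; apply: divnK; rewrite /path_D (bigD1 (Ordinal es)) //= dvdn_mulr.
Qed.

Let D_pos : 0 < path_D.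
Proof. by rewrite /path_D prodn_gt0 // => e; exact: deltaP. Qed.

Let L e m := (st e).2 * path_x m + (st e).1 * path_y m.

Let L_eq e : e < size l -> L e e = path_delta e /\ L e e.+1 = path_delta e.
Proof.
move=> es; rewrite /L /path_delta; split; first by rewrite addnC (mulnC _ (path_x e)).
by rewrite (xS es) (yS es); lia.
Qed.

(** By convexity, each step away from the edge e strictly raises its form. *)
Let L_right e m : e < size l -> e.+1 < m -> m <= size l -> path_delta e < L e m.
Proof.
move=> es; elim: m => [//|m IH]; rewrite ltnS => em ms.
have H : path_delta e <= L e m.
  move: em; rewrite leq_eqVlt => /orP[/eqP <-|em]; first by rewrite (L_eq es).2.
  by apply/ltnW/IH => //; exact: ltnW.
apply: leq_ltn_trans H _; rewrite /L (xS ms) (yS ms).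
by have := st_lt em ms; lia.
Qed.

Let L_left e m : e < size l -> m < e -> path_delta e < L e m.
Proof.
move=> es me; rewrite -(subKn (ltnW me)); have : 0 < e - m by rewrite subn_gt0.
have : e - m <= e by rewrite leq_subr.
elim: (e - m) => [//|d IH] de _.
have H : path_delta e <= L e (e - d).
  case: (posnP d) => [->|d0]; first by rewrite subn0 (L_eq es).1.
  by apply/ltnW/IH => //; exact: ltnW.
apply: leq_ltn_trans H _; have E : e - d = (e - d.+1).+1 by lia.
have ms : e - d.+1 < size l by lia.
have lt : e - d.+1 < e by lia.
rewrite E /L (xS ms) (yS ms); have := st_lt lt es; lia.
Qed.

Lemma path_polygon : polygon (size l) path_D (sum2 l) (sum1 l) path_x path_y path_al path_be.
Proof.
have algebra e m : path_al e * path_x m + path_be e * path_y m = path_D %/ path_delta e * L e m.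
  by rewrite /path_al /path_be /L -!mulnA -mulnDr.
have quo e : e < size l -> 0 < path_D %/ path_delta e.
  by move=> es; have := D_pos; rewrite -{1}(D_dvd es) muln_gt0 => /andP[].
split.
- by case: (l) l_nil.
- by rewrite /path_x take0 sum1_nil.
- by rewrite /path_y drop0.
- by rewrite /path_x take_size.
- by rewrite /path_y drop_size sum2_nil.
- by move=> e es; rewrite (xS es) -{1}[path_x e]addn0 ltn_add2l; case: (st_pos es).
- by move=> e es; rewrite (yS es) -{1}[path_y e.+1]add0n ltn_add2r; case: (st_pos es).
- by move=> e es; rewrite muln_gt0 quo //; case: (st_pos es).
- by move=> e es; rewrite muln_gt0 quo //; case: (st_pos es).
- move=> e m es ms; rewrite algebra -{1}(D_dvd es) leq_mul2l; apply/orP; right.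
  case: (ltngtP m e) => [me|em|->]; [exact/ltnW/L_left| |by rewrite (L_eq es).1].
  move: em; rewrite leq_eqVlt => /orP[/eqP <-|em]; first by rewrite (L_eq es).2.
  exact/ltnW/L_right.
- move=> e m es ms; rewrite algebra -{2}(D_dvd es) eqn_pmul2l ?quo //.
  case: (ltngtP m e) => [me|em|->] /=; last by rewrite (L_eq es).1 eqxx.
    by rewrite gtn_eqF ?L_left // ltn_eqF // ltnW.
  case: (ltngtP m e.+1) => [|em'|->] /=; last by rewrite (L_eq es).2 eqxx.
    by rewrite ltnS leqNgt em.
  by rewrite gtn_eqF ?L_right.
Qed.

End PathPolygon.

(** Twice the area under the path is that under its chord plus the signed area between them. The
    starting abscissa x0 makes the induction go through. *)
Lemma sum_path_delta l x0 :
  (\sum_(e < size l) ((nth (0, 0) l e).1 * sum2 (drop e l) + (x0 + sum1 (take e l)) * (nth (0, 0) l e).2))%:Z%R =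
  ((x0 * sum2 l)%:Z + (sum1 l * sum2 l)%:Z +
    path_area l)%R.
Proof.
elim: l x0 => [|w l IH] x0; first by rewrite big_ord0 sum1_nil sum2_nil /= !muln0.
rewrite big_ord_recl /= sum1_nil addn0 sum1_cons !sum2_cons.
have -> : \sum_(i < size l) ((nth (0, 0) l i).1 * sum2 (drop i l) +
    (x0 + sum1 (w :: take i l)) * (nth (0, 0) l i).2) =
  \sum_(i < size l) ((nth (0, 0) l i).1 * sum2 (drop i l) +
    ((x0 + w.1) + sum1 (take i l)) * (nth (0, 0) l i).2).
  by apply: eq_bigr => i _; rewrite sum1_cons addnA.
rewrite PoszD IH.
rewrite !(PoszD, PoszM); ring.
Qed.

(** * Deformations with prescribed Milnor number *)

(** If every step of [l1] is steeper than every step of [l2], so are the sums; applied at a vertex,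
    this puts it below the chord. *)
Lemma sum_allrel (l1 l2 : seq (nat * nat)) :
  allrel (fun w w' => w.1 * w'.2 < w'.1 * w.2) l1 l2 ->
  sum1 l1 * sum2 l2 <= sum1 l2 * sum2 l1.
Proof.
move=> H; rewrite /sum1 /sum2 !big_distrlr /= [leqRHS]exchange_big /=.
rewrite !big_seq; apply: leq_sum => w wl; rewrite !big_seq; apply: leq_sum => v vl.
exact/ltnW/(allrelP H).
Qed.

Lemma deficient_polygon p q k : 1 < p -> p < q -> coprime p q ->
  k <= q %% p * (p - q %% p) -> exists s D vx vy al be,
  [/\ polygon s D p q vx vy al be, \sum_(e < s) delta vx vy e + k = p * q
   & forall m, m <= s -> p * vx m + q * vy m <= p * q].
Proof.
move=> p1 pq cop; set r := q %% p => kle; set m := q %/ p.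
have p0 : 0 < p by exact: ltnW.
have rp : r < p by rewrite ltn_mod.
have qE : q = m * p + r by exact: divn_eq.
have m0 : 0 < m by rewrite divn_gt0 // ltnW.
have cop_r : coprime p r by rewrite /coprime /r gcdn_modr.
have r0 : 0 < r by rewrite lt0n; apply: contraTneq cop_r => ->; rewrite /coprime gcdn0 gtn_eqF.
have cop' : coprime (p - r) r.
  by move: cop_r; rewrite -{1}(subnK (ltnW rp)) /coprime gcdnC gcdnDr gcdnC.
have pr0 : 0 < p - r by rewrite subn_gt0.
have kle' : k <= (p - r) * r by rewrite mulnC.
have [l0 [ple E1 E2 Ea]] := coprime_path_exists pr0 r0 cop' kle'.
have [l1 [plt nz [F1 F2] Fa _]] := strict_path ple.
rewrite {}E1 in F1; rewrite {}E2 in F2; rewrite {}Ea in Fa.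
(* T has determinant m - (m + 1) = -1, so it reverses turns and the sign of areas, and it sends (p -
   r, r) to (q, p). As m > 0, a nonzero step acquires two positive components. *)
pose T (w : nat * nat) := (m * w.1 + m.+1 * w.2, w.1 + w.2).
pose l := map T l1.
have sumT l' : sum1 (map T l') = m * sum1 l' + m.+1 * sum2 l' /\ sum2 (map T l') = sum1 l' + sum2 l'.
  rewrite /sum1 /sum2 !big_map /T /= !big_split /=.
  by split=> //; rewrite -!big_distrr.
have areaT : path_area l = (- path_area l1)%R.
  rewrite /l; elim: (l1) => [|w l' IH] /=; first by rewrite oppr0.
  have [-> ->] := sumT l'; rewrite IH /= !(PoszD, PoszM) -[m.+1]addn1 PoszD; ring.
have [S1 S2] := sumT l1; rewrite -/l F1 F2 in S1 S2.
have {}S1 : sum1 l = q by rewrite S1 qE; nia.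
have {}S2 : sum2 l = p by rewrite S2 subnK // ltnW.
have lcv : pairwise (fun w w' => w.1 * w'.2 < w'.1 * w.2) l.
  rewrite /l pairwise_map; apply: sub_pairwise plt => w w'; rewrite /turn_lt /T /=; nia.
have lpos : all (fun w => (0 < w.1) && (0 < w.2)) l.
  rewrite /l all_map; apply: sub_all nz => w /= w0; rewrite /= w0 andbT.
  by rewrite addn_gt0 !muln_gt0 m0 /= -addn_gt0.
have lnil : l != [::].
  by apply/eqP => ln; move: S2; rewrite ln sum2_nil => p_0; rewrite -p_0 in p0.
exists (size l), (path_D l), (path_x l), (path_y l), (path_al l), (path_be l); split.
- by have := path_polygon lcv lpos lnil; rewrite S1 S2.
- have := sum_path_delta l 0; rewrite mul0n add0r S1 S2 areaT Fa.
  have -> : \sum_(e < size l) delta (path_x l) (path_y l) e =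
     \sum_(e < size l) ((nth (0, 0) l e).1 * sum2 (drop e l) + (0 + sum1 (take e l)) * (nth (0, 0) l e).2).
    apply: eq_bigr => e _; rewrite /delta /path_x /path_y (drop_nth (0, 0) (ltn_ord e)).
    rewrite (take_nth (0, 0) (ltn_ord e)) !sum2_cons -cats1 /sum1 big_cat big_seq1 /=.
    rewrite -/(sum1 _); nia.
  lia.
move=> e es; rewrite /path_x /path_y.
have := lcv; rewrite -{1}(cat_take_drop e l) pairwise_cat => /andP[/sum_allrel H _].
have D1 : sum1 (take e l) + sum1 (drop e l) = q.
  by rewrite -S1 -{3}(cat_take_drop e l) /sum1 big_cat.
have D2 : sum2 (take e l) + sum2 (drop e l) = p.
  by rewrite -S2 -{3}(cat_take_drop e l) /sum2 big_cat.
move: (sum1 (take e l)) (sum1 (drop e l)) (sum2 (take e l)) (sum2 (drop e l)) H D1 D2.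
move=> a b c d H D1 D2; rewrite -D1 -D2; nia.
Qed.

Local Open Scope ring_scope.

(** * Adding the inner vertices of the polygon to f *)

Section NearbyGerm.
Variables (K : numFieldType) (s D p q : nat) (vx vy al be : nat -> nat).
Hypothesis pol : polygon s D p q vx vy al be.
Hypothesis below : forall m, (m <= s)%N -> (p * vx m + q * vy m <= p * q)%N.
Hypotheses (p_gt0 : (0 < p)%N) (q_gt0 : (0 < q)%N) (pq : coprime p q).
Local Notation nu := (nu s al be).
Variable f : fps2 K.
Hypothesis f_support : forall a b, f a b != 0 -> (p * q <= p * a + q * b)%N.
Hypotheses (fq : f q 0%N != 0) (fp : f 0%N p != 0).

(** The chord form divided by p q is at most nu / D: both are linear on each cone, and the vertices
    lie below the chord. Thus the support of f lies above the polygon. *)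
Lemma chord_nu i j : (D * (p * i + q * j) <= p * q * nu i j)%N.
Proof.
have [e co] := cone_ex pol i j; have es : (e < s)%N by case/and3P: (co).
have [a [b [_ _ Ei Ej]]] := cone_dec pol co; have d0 := delta_gt0 pol es.
have [V0 V1] := ell_vert pol es.
have E := cone_ell al be es Ei Ej e; rewrite V0 V1 -(cone_nu pol co) in E.
have B0 := below (ltnW es); have B1 := below es.
rewrite -(leq_pmul2l d0).
have -> : (delta vx vy e * (D * (p * i + q * j)) =
    D * (b * (p * vx e + q * vy e) + a * (p * vx e.+1 + q * vy e.+1)))%N.
  transitivity (D * (p * (delta vx vy e * i) + q * (delta vx vy e * j)))%N; first by ring.
  by rewrite Ei Ej; ring.
have -> : (delta vx vy e * (p * q * nu i j) = D * (b * (p * q) + a * (p * q)))%N.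
  transitivity (p * q * (delta vx vy e * nu i j))%N; first by ring.
  by rewrite E; ring.
by rewrite leq_mul2l; apply/orP; right; apply: leq_add; rewrite leq_mul2l ?B0 ?B1 orbT.
Qed.

(** The end vertices are left out because f already has these monomials. *)
Definition inner_vertices : fps2 K := fun i j =>
  [exists m : 'I_s, [&& (0 < m)%N, vx m == i & vy m == j]]%:R.
Local Notation G := inner_vertices.

Lemma inner_verticesP i j : G i j != 0 ->
  exists m, [/\ (0 < m)%N, (m < s)%N, i = vx m & j = vy m].
Proof.
rewrite /G; case: existsP => [[m /and3P[m0 /eqP <- /eqP <-]] _|_]; last by rewrite eqxx.
by exists m.
Qed.

Lemma inner_vertices_fin : fin_supp G.
Proof.
exists (maxn (vx s) (vy 0%N)).+1 => i j /inner_verticesP[m [m0 ms -> ->]].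
rewrite !ltnS !leq_max (vx_le pol (ltnW ms)) // (_ : vy m <= vy 0)%N ?orbT //.
elim: m ms {m0} => [//|m IH] ms; apply: leq_trans (IH (ltnW ms)).
exact: ltnW (pol_ylt pol (ltnW ms)).
Qed.

Let pol_vert i j : (p * i + q * j = p * q)%N ->
  exists2 m, (m <= s)%N & (i, j) = (vx m, vy m).
Proof.
case/(coprime_segment p_gt0 q_gt0 pq) => ->.
  by exists s => //; rewrite (pol_xs pol) (pol_ys pol).
by exists 0%N => //; rewrite (pol_x0 pol) (pol_y0 pol).
Qed.

Let vx_pos m : (0 < m)%N -> (m <= s)%N -> (0 < vx m)%N.
Proof. by case: m => [//|m] _ ms; exact: (vx_gt0 pol). Qed.

Let pq0 : (0 < p * q)%N. Proof. by rewrite muln_gt0 p_gt0. Qed.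

Variable t : K.
Hypothesis t0 : t != 0.
Let F : fps2 K := f + fps2_scale t G.

Let F_cases i j : F i j != 0 -> G i j != 0 \/ f i j != 0.
Proof.
rewrite /F fps2DE fps2_scaleE; have [->|] := eqVneq (G i j) 0; last by left.
by rewrite mulr0 addr0; right.
Qed.

Lemma nearby_ge i j : F i j != 0 -> (D <= nu i j)%N.
Proof.
case/F_cases => [/inner_verticesP[m [_ ms -> ->]]|/f_support H].
  by rewrite (nu_vert pol (ltnW ms)).
rewrite -(leq_pmul2l pq0) mulnC; apply: leq_trans (chord_nu i j).
by rewrite leq_mul2l H orbT.
Qed.

Lemma nearby_eq i j : F i j != 0 -> nu i j = D ->
  exists2 m, (m <= s)%N & (i, j) = (vx m, vy m).
Proof.
case/F_cases => [/inner_verticesP[m [_ ms -> ->]] _|/f_support H E].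
  by exists m => //; exact: ltnW.
apply: pol_vert; apply/eqP; rewrite eqn_leq H andbT.
by have := chord_nu i j; rewrite E mulnC leq_mul2r gtn_eqF ?(D_gt0 pol).
Qed.

Lemma nearby_vert m : (m <= s)%N -> F (vx m) (vy m) != 0.
Proof.
move=> ms; have [m0|m0] := posnP m.
  rewrite m0 (pol_x0 pol) (pol_y0 pol) /F fps2DE fps2_scaleE.
  suff -> : G 0%N p = 0 by rewrite mulr0 addr0.
  apply/eqP/negPn/negP => /inner_verticesP[n [n0 ns E _]].
  by have := vx_pos n0 (ltnW ns); rewrite -E.
move: ms; rewrite leq_eqVlt => /orP[/eqP ->|ms].
  rewrite (pol_xs pol) (pol_ys pol) /F fps2DE fps2_scaleE.
  suff -> : G q 0%N = 0 by rewrite mulr0 addr0.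
  apply/eqP/negPn/negP => /inner_verticesP[n [n0 ns _ E]].
  by have := vy_gt0 pol ns; rewrite -E.
rewrite /F fps2DE fps2_scaleE.
have -> : G (vx m) (vy m) = 1.
  rewrite /G; case: existsP => // H; case: H; exists (Ordinal ms).
  by rewrite /= m0 !eqxx.
(* A monomial of f at an inner vertex would lie on the chord, whose only lattice points are its
   ends. *)
suff -> : f (vx m) (vy m) = 0 by rewrite add0r mulr1.
apply/eqP/negPn/negP => /f_support H.
have E : (p * vx m + q * vy m = p * q)%N by apply/eqP; rewrite eqn_leq below ?(ltnW ms).
case: (coprime_segment p_gt0 q_gt0 pq E) => -[Ex Ey].
  by have := vy_gt0 pol ms; rewrite Ey.
by have := vx_pos m0 (ltnW ms); rewrite Ex.
Qed.

End NearbyGerm.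

Local Open Scope classical_set_scope.
Local Open Scope ring_scope.

Definition has_basis (K : numFieldType) (g h : fps2 K) (n : nat) :=
  exists e : 'I_n -> fps2 K,
  [/\ forall k, conv (e k),
      forall u, conv u -> exists (a : 'I_n -> K) A B, [/\ conv A, conv B &
        forall i j, u i j = \sum_k a k * e k i j + (A * g) i j + (B * h) i j]
    & forall (a : 'I_n -> K) A B, conv A -> conv B ->
        (forall i j, \sum_k a k * e k i j = (A * g) i j + (B * h) i j) -> forall k, a k = 0].

Lemma has_basis_le (K : numFieldType)
    (small : forall x c : K, 0 <= x -> (forall n, x * 2 ^+ n <= c) -> x = 0)
    (g h : fps2 K) n (x y : K) m1 m2 :
  conv g -> conv h -> 0 < x -> 0 < y ->
  (forall u B, bnd x y u B -> exists v, [/\ bnd x y v (B / 2), conv v &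
    conv_ideal g h (u - \sum_(i < m1) \sum_(j < m2) fps2_scale (u i j) (fps2_mon K i j) - v)]) ->
  has_basis g h n -> (n <= m1 * m2)%N.
Proof.
move=> cg ch x0 y0 H [e [ec es ef]].
apply: (multiplicity_le small cg ch ec _ _ x0 y0 H) => [u /es[a [A [B [cA cB E]]]]|a [A [B [cA cB E]]]].
  exists a, A, B; split=> //; apply: fps2P => i j.
  rewrite fps2BE fps2_sumE fps2DE E; under [X in _ - X]eq_bigr do rewrite fps2_scaleE.
  by rewrite addrC -addrA addKr.
apply: (ef a A B cA cB) => i j; rewrite -fps2DE -E fps2_sumE.
by under [RHS]eq_bigr do rewrite fps2_scaleE.
Qed.

(** * The upper bound for the slices of a deformation *)

Section Semicontinuity.
Variable K : numFieldType.
Hypothesis complete : abs_complete K.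
Hypothesis small : forall x c : K, 0 <= x -> (forall n, x * 2 ^+ n <= c) -> x = 0.
Variables (F : nat -> nat -> nat -> K) (r M : K) (p q : nat).
Hypothesis r0 : 0 < r.
Hypothesis F_bnd : forall n, \sum_(k < n) \sum_(i < n) \sum_(j < n)
  `|F k i j| * r ^+ (k + i + j) <= M.
Hypotheses (p_gt0 : (0 < p)%N) (q_gt0 : (0 < q)%N) (pq : coprime p q).
Hypothesis F_support : forall a b, F 0%N a b != 0 -> (p * q <= p * a + q * b)%N.
Hypotheses (Fq : F 0%N q 0%N != 0) (Fp : F 0%N 0%N p != 0).

Lemma bnd_slice0 : bnd r r (F 0%N : fps2 K) M.
Proof.
case=> [|n]; first by have := F_bnd 0; rewrite !big_ord0.
apply: le_trans (F_bnd n.+1); rewrite [leRHS]big_ord_recl /= -[leLHS]addr0 lerD //.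
  by apply: ler_sum => i _; apply: ler_sum => j _; rewrite add0n exprD.
by do 3!(apply: sumr_ge0 => ? _); rewrite mulr_ge0 ?exprn_ge0 ?(ltW r0).
Qed.

Lemma semicontinuity : exists2 d : K, 0 < d & forall t n, `|t| < d ->
  has_basis (fps2_dx (slice3 F t)) (fps2_dy (slice3 F t)) n -> (n <= q.-1 * p.-1)%N.
Proof.
have M0 : 0 <= M by have := F_bnd 0; rewrite big_ord0.
have [x [y [x0 y0 [eta eta0 H]]]] :=
  perturbation_contraction p_gt0 q_gt0 pq r0 bnd_slice0 F_support Fq Fp.
have s0 : 0 < eta + M + 1 by rewrite addr_gt0 ?ltr01 // ltr_pwDl.
have s1 : eta / (eta + M + 1) <= 1.
  by rewrite ler_pdivrMr // mul1r -addrA lerDl addr_ge0.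
(* This radius ensures both |t| <= r and |t| M / r <= eta. *)
exists (r * (eta / (eta + M + 1))); first by rewrite !mulr_gt0 ?invr_gt0.
move=> t n td.
have tr : `|t| <= r by apply: le_trans (ltW td) _; rewrite ler_piMr ?(ltW r0).
have bS : bnd r r (slice3 F t - (F 0%N : fps2 K)) eta.
  apply: bnd_weaken (slice_bnd complete r0 F_bnd tr).
  apply: (@le_trans _ _ (eta / (eta + M + 1) * M)).
    by rewrite ler_wpM2r // ler_pdivrMr // mulrC ltW.
  rewrite mulrAC ler_pdivrMr // ler_wpM2l ?(ltW eta0) //.
  by rewrite addrAC lerDr addr_ge0 ?(ltW eta0).
have cS : conv (slice3 F t).
  rewrite -[slice3 F t](subrK (F 0%N : fps2 K)).
  by apply: convD; exists r => //; [exists eta|exists M; exact: bnd_slice0].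
apply: (has_basis_le small (conv_dx cS) (conv_dy cS) x0 y0); exact: H.
Qed.

End Semicontinuity.

Section LinearFamily.
Variable K : numFieldType.

Definition pencil (f g : fps2 K) : nat -> nat -> nat -> K := fun k =>
  match k with 0 => f | 1 => g | _ => 0 : fps2 K end.

Lemma slice3_pencil f g t : slice3 (pencil f g) t = f + fps2_scale t g.
Proof.
apply: fps2P => i j; rewrite fps2DE fps2_scaleE; apply: (lim_near_cst (@norm_hausdorff _ K)); exists 2%N => // -[|[|n]] //= _.
rewrite !big_ord_recl /= expr0 expr1 mulr1 big1 ?addr0 1?mulrC // => k _.
by rewrite /= fps20E mul0r.
Qed.

Lemma pencil_bnd f g r M N : 0 < r -> bnd r r f M -> bnd r r g N ->
  forall n, \sum_(k < n) \sum_(i < n) \sum_(j < n)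
    `|pencil f g k i j| * r ^+ (k + i + j) <= M + r * N.
Proof.
move=> r0 Hf Hg n; have rr := ltW r0.
have H0 (k : nat) i j : `|pencil f g k i j| * r ^+ (k + i + j) =
    `|pencil f g k i j| * (r ^+ i * r ^+ j) * r ^+ k by rewrite !exprD; ring.
have HM := bnd_ge0 Hf; have HN := bnd_ge0 Hg.
have E k : \sum_(i < n) \sum_(j < n) `|pencil f g k i j| * r ^+ (k + i + j) =
    (\sum_(i < n) \sum_(j < n) `|pencil f g k i j| * (r ^+ i * r ^+ j)) * r ^+ k.
  rewrite mulr_suml; apply: eq_bigr => i _; rewrite mulr_suml.
  by apply: eq_bigr => j _; exact: H0.
under eq_bigr do rewrite E.
pose S k := \sum_(i < n) \sum_(j < n) `|pencil f g k i j| * (r ^+ i * r ^+ j).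
suff HS m : \sum_(k < m) S k * r ^+ k <= M + r * N by exact: HS.
have L0 : S 0%N <= M := Hf n.
have L1 : S 1%N * r <= r * N by rewrite mulrC; exact: ler_wpM2l (Hg n).
case: m => [|[|m]].
- by rewrite big_ord0 addr_ge0 // mulr_ge0.
- by rewrite big_ord1 expr0 mulr1 -[leLHS]addr0 lerD // mulr_ge0.
rewrite !big_ord_recl [X in _ + (_ + X)]big1 => [|k _]; last first.
  by rewrite /S big1 ?mul0r // => i _; apply: big1 => j _; rewrite /= fps20E normr0 mul0r.
by rewrite expr0 mulr1 expr1 addr0 lerD.
Qed.

End LinearFamily.

Lemma dnbhs0_ex (K : numFieldType) (P : K -> Prop) (d : K) : 0 < d ->
  (\forall t \near (0 : K)^', P t) -> exists t, [/\ t != 0, `|t| < d & P t].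
Proof.
move=> d0 HP; have : \forall t \near (0 : K)^', [/\ t != 0, `|t| < d & P t].
  near=> t; split; last by near: t.
    by near: t; exact: nbhs_dnbhs_neq.
  by near: t; exact: dnbhs0_lt.
by move/filter_ex => [t Ht]; exists t.
Unshelve. all: by end_near.
Qed.

Section NearbySingularity.
Variable K : numFieldType.
Hypothesis complete : abs_complete K.
Variables (s D p q : nat) (vx vy al be : nat -> nat).
Hypothesis pol : polygon s D p q vx vy al be.
Hypothesis below : forall m, (m <= s)%N -> (p * vx m + q * vy m <= p * q)%N.
Hypotheses (p_gt1 : (1 < p)%N) (q_gt1 : (1 < q)%N) (pq : coprime p q).
Variable f : fps2 K.
Hypothesis f_conv : conv f.
Hypothesis f_support : forall a b, f a b != 0 -> (p * q <= p * a + q * b)%N.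
Hypotheses (fq : f q 0%N != 0) (fp : f 0%N p != 0).
Local Notation G := (inner_vertices K s vx vy).

Lemma nearby_singularity (t : K) : t != 0 ->
  let F := slice3 (pencil f G) t in
  [/\ conv F, isolated F & has_basis (fps2_dx F) (fps2_dy F) (polygon_mu s p q vx vy)].
Proof.
rewrite slice3_pencil => t0 F; have p0 := ltnW p_gt1; have q0 := ltnW q_gt1.
have Fge := nearby_ge pol below p0 q0 f_support.
have Feq := nearby_eq pol below p0 q0 pq f_support.
have Fv := nearby_vert pol below p0 q0 pq f_support fq fp t0.
have cF : conv F by apply: convD => //; apply: convZ; apply: conv_fin; exact: (inner_vertices_fin K pol).
(* The points of degree at most 1 lie below the polygon because p, q > 1, so F has no constant or
   linear terms. *)
have lt10 : (nu s al be 1 0 < D)%N.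
  have := nuD pol 1 0 q.-1 0; rewrite add1n prednK // addn0.
  have := nu_vert pol (leqnn s); rewrite (pol_xs pol) (pol_ys pol) => ->.
  by have := nu_deg pol q.-1 0; lia.
have lt01 : (nu s al be 0 1 < D)%N.
  have := nuD pol 0 1 0 p.-1; rewrite add1n prednK // addn0.
  have := nu_vert pol (leq0n s); rewrite (pol_x0 pol) (pol_y0 pol) => ->.
  by have := nu_deg pol 0 p.-1; lia.
have lt00 : (nu s al be 0 0 < D)%N by apply: leq_ltn_trans lt10; exact: (nu_mono pol).
have F0 i j : (nu s al be i j < D)%N -> F i j = 0.
  by move=> lt; apply/eqP; move: lt; apply: contraTT => /Fge; rewrite -leqNgt.
have [M M0 [IX IY]] := jacobian_cofinite pol (Fge t) (Feq t) Fv cF.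
split=> //; last exact: (jacobian_basis pol (Fge t) (Feq t) Fv cF).
by apply: (isolated_cofinite complete cF M0 _ _ _ IX IY); exact: F0.
Qed.

End NearbySingularity.

(** * From attained Milnor numbers to jumps *)

Section Jumps.
Local Open Scope nat_scope.

Lemma rev_iotaS a k : rev (iota a k.+1) = a + k :: rev (iota a k).
Proof. by rewrite -addn1 iotaD rev_cat. Qed.

Lemma prefix_jumps a k (l : seq nat) : prefix (nseq k 1) (jumps (rev (iota a k.+1) ++ l)).
Proof.
rewrite rev_iotaS /=; elim: k => [|k IH]; first by rewrite prefix0s.
by rewrite rev_iotaS /= addnS subSnn eqxx.
Qed.

Lemma jumps_exist (P : nat -> Prop) n k : k < n -> (forall m, P m -> m <= n) ->
  (forall i, i <= k -> P (n - i)) ->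
  exists2 mu, sorted gtn mu /\ (forall m, m \in mu <-> 0 < m /\ P m) &
    prefix (nseq k 1) (jumps mu).
Proof.
move=> kn Pn Pk; exists [seq m <- rev (iota 1 n) | `[<P m>]]; first split.
- apply: sorted_filter; first by move=> ? ? ? /= ab bc; exact: ltn_trans bc ab.
  by rewrite rev_sorted; exact: iota_ltn_sorted.
- move=> m; rewrite mem_filter mem_rev mem_iota add1n ltnS; split.
    by case/andP => /asboolP Pm /andP[m0 _].
  by case=> m0 Pm; rewrite m0 (Pn _ Pm); move/asboolP: Pm => ->.
have -> : n = n - k.+1 + k.+1 by rewrite subnK.
rewrite iotaD rev_cat filter_cat (_ : seq.filter _ _ = rev (iota (1 + (n - k.+1)) k.+1)).
  exact: prefix_jumps.
apply/all_filterP/seq.allP => m; rewrite mem_rev mem_iota => H; apply/asboolP.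
have -> : m = n - (n - m) by lia.
by apply: Pk; lia.
Qed.

End Jumps.

(** * Transfer to the definitions over the complex numbers *)

Section ComplexGerms.
Variable R : realType.
Local Notation CR := (C R).

(** The Archimedean property, read on real parts; it concludes the repeated halving in
    [multiplicity_le]. *)
Lemma small_C (x c : CR) : 0 <= x -> (forall n, x * 2 ^+ n <= c) -> x = 0.
Proof.
move=> x0 H; have H' n : (complex.Re x) *+ n <= complex.Re c.
  have h1 : x *+ n <= c.
    apply: le_trans (H n); rewrite -natrX mulr_natr.
    by apply: ler_wpMn2l => //; exact/ltnW/ltn_expl.
  move: h1; rewrite lecE => /andP[_].
  by rewrite -[n in x *+ n]card_ord -sumr_const ReS sumr_const card_ord.
have xE : x = ((complex.Re x)%:C)%C :> R[i] by rewrite RRe_real // ger0_real.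
suff Rx : complex.Re x = 0 by rewrite xE Rx.
have Rx0 : 0 <= complex.Re x by move: x0; rewrite lecE => /andP[].
apply/eqP; rewrite eq_le Rx0 andbT leNgt; apply/negP => Rxp.
have [n Hn] : exists n : nat, complex.Re c / complex.Re x < n%:R.
  exists (Num.bound `|complex.Re c / complex.Re x|); apply: le_lt_trans (ler_norm _) _.
  exact: archi_boundP (normr_ge0 _).
have := H' n; rewrite leNgt -mulr_natl; move: Hn; rewrite ltr_pdivrMr // => -> //.
Qed.

(** The two types of series are convertible; only r^(i + j) has to be split as r^i r^j. *)
Lemma convergent2E (f : series2 R) : convergent2 f <-> conv (f : fps2 CR).
Proof.
split=> -[r r0 [M HM]]; exists r => //; exists M => n; apply: le_trans (HM n);
  by apply: ler_sum => i _; apply: ler_sum => j _; rewrite exprD.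
Qed.

Lemma multiplicityE (g h : series2 R) n :
  multiplicity g h n <-> has_basis (g : fps2 CR) (h : fps2 CR) n.
Proof.
have mE (A B : series2 R) i j : mul2 A B i j = ((A : fps2 CR) * (B : fps2 CR)) i j.
  by rewrite fps2ME.
split=> -[e [ec es ef]]; exists e;
  (split=> [k|u /convergent2E/es[a [A [B [cA cB E]]]]|a A B cA cB E]; [exact/convergent2E| |]).
1,3: by exists a, A, B; split; [exact/convergent2E..|] => i j; rewrite E !mE.
all: by apply: (ef a A B); [exact/convergent2E..|] => i j; rewrite E !mE.
Qed.

End ComplexGerms.

Section ComplexDeformations.
Variable R : realType.
Local Notation CR := (C R).

Lemma isolated_singularityE (f : series2 R) :
  isolated_singularity f <-> conv (f : fps2 CR) /\ isolated (f : fps2 CR).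
Proof. by split=> -[/convergent2E]. Qed.

Variables (p q : nat) (f : series2 R).
Hypotheses (p_gt1 : (1 < p)%N) (p_lt_q : (p < q)%N) (pq : coprime p q).
Hypothesis f_isolated : isolated_singularity f.
Hypothesis f_support : forall a b : nat, f a b != 0 -> (p * q <= p * a + q * b)%N.
Hypotheses (fq : f q 0%N != 0) (fp : f 0%N p != 0).

Let p_gt0 : (0 < p)%N := ltnW p_gt1.
Let q_gt0 : (0 < q)%N := ltn_trans p_gt0 p_lt_q.

Lemma deformation_milnor_le F n : deformation f F -> deformation_milnor_number F n ->
  (n <= q.-1 * p.-1)%N.
Proof.
move=> [[r r0 [M HM]] F0 _] Fn.
have {}F0 i j : F 0%N i j = f i j by rewrite -F0; exact/esym/(@slice3_0 CR).
have [||| d d0 H] := @semicontinuity CR (@abs_cvg R) (@small_C R) F r M p q r0 HM p_gt0 q_gt0 pq.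
- by move=> a b; rewrite F0; exact: f_support.
- by rewrite F0.
- by rewrite F0.
have [t [_ td Ht]] := dnbhs0_ex d0 Fn.
by apply: (H t n td); apply/multiplicityE; exact: Ht.
Qed.

Lemma deformation_exists k : (k <= q %% p * (p - q %% p))%N ->
  exists2 F, deformation f F & deformation_milnor_number F (q.-1 * p.-1 - k)%N.
Proof.
move=> kle; have [s [D [vx [vy [al [be [pol sum_d below]]]]]]] := deficient_polygon p_gt1 p_lt_q pq kle.
pose G := inner_vertices CR s vx vy; pose F := pencil (f : fps2 CR) G.
have [cf _] := (isolated_singularityE f).1 f_isolated.
have F0 : slice F 0 = f.
  by apply/funext => i; apply/funext => j; exact: (@slice3_0 CR).
have near_sing t := @nearby_singularity CR (@abs_cvg R) _ _ _ _ _ _ _ _ pol below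
  p_gt1 (leq_ltn_trans p_gt0 p_lt_q) pq f cf f_support fq fp t.
exists F; first split.
- have cG : conv G := conv_fin (inner_vertices_fin CR pol).
  have [r r0 [[M HM] [N HN]]] := conv_bnd2 cf cG.
  by exists r => //; exists (M + r * N); exact: (@pencil_bnd CR).
- by move=> i j; rewrite F0.
- near=> t; have [->|t0] := eqVneq t 0; first by rewrite F0.
  have [cF iF _] := near_sing t t0.
  by apply: (isolated_singularityE _).2; split; [exact: cF | exact: iF].
(* Both sides are p q - k + 1 - p - q, since the determinants of the polygon add up to p q - k. *)
have -> : (q.-1 * p.-1 - k = polygon_mu s p q vx vy)%N.
  by rewrite /polygon_mu; case: (p) (q) sum_d p_gt0 q_gt0 => // p' [//|q'] /= sum_d _ _; lia.
rewrite /deformation_milnor_number; near=> t.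
have t0 : t != 0 by near: t; exact: nbhs_dnbhs_neq.
have [_ _ bF] := near_sing t t0; exact: (multiplicityE _ _ _).2 bF.
Unshelve. all: by end_near.
Qed.

End ComplexDeformations.

Theorem theorem1p1 (R : realType) (p q : nat) (f : series2 R)
    (p_gt0 : (0 < p)%N) (p_lt_q : (p < q)%N) (p_q_coprime : coprime p q)
    (f_isolated : isolated_singularity f) (f_nondegenerate : newton_nondegenerate f)
    (f_support : forall a b : nat, f a b != 0 -> (p * q <= p * a + q * b)%N)
    (f_vertex_x : f q 0%N != 0) (f_vertex_y : f 0%N p != 0) :
  exists2 mu : seq nat, milnor_sequence f mu &
    prefix (nseq (q %% p * (p - q %% p))%N 1%N) (jumps mu).
Proof.
(* For p = 1 the coefficient of y would be nonzero, while the y-derivative vanishes at a singular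
   origin. *)
have p_gt1 : (1 < p)%N.
  rewrite ltn_neqAle p_gt0 andbT; apply: contra_neqN f_vertex_y => /eqP <-.
  have [_ /nbhs_singleton H] := f_isolated; have [_ H0 _] := H.2 erefl.
  rewrite -[LHS]mulr1n -[RHS]H0; exact/esym/(@eval0 (C R) (fps2_dy f)).
apply: (@jumps_exist (fun n => exists2 F, deformation f F & deformation_milnor_number F n)
  (q.-1 * p.-1)%N).
(* r(p - r) < (q - 1)(p - 1), so all the values in question are positive. *)
- have := ltn_pmod q p_gt0; case: (p) (q) p_gt1 p_lt_q => // p' [//|q'] /=; nia.
- by move=> n [F Fd]; exact: deformation_milnor_le Fd.
- by move=> k; exact: deformation_exists.
Qed.
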